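(* Let $\Lambda\subset\mathbb{R}^2$ be an algebraic Delone set. Then: (a) There is a finite set $N_{\Lambda}\subset\mathbb{Q}$ such that, for all sets $U$ of four pairwise non-parallel $\Lambda$-directions, the following holds: if the cross ratio of slopes of the directions of $U$, arranged in order of increasing angle with the positive real axis, does not map under the norm $N_{\mathbb{k}_{\Lambda}/\mathbb{Q}}$ to $N_{\Lambda}$ (i.e., its image under $N_{\mathbb{k}_{\Lambda}/\mathbb{Q}}$ is not an element of $N_{\Lambda}$), then the convex subsets of $\Lambda$ are determined by the $X$-rays in the directions of $U$. (b) For all sets $U$ of three or fewer pairwise non-parallel $\Lambda$-directions, the convex subsets of $\Lambda$ are not determined by the $X$-rays in the directions of $U$.
   Context: Identify $\mathbb{R}^2$ with $\mathbb{C}$. A set $\Lambda\subset\mathbb{R}^d$ is uniformly discrete if there is $r>0$ such that every open ball of radius $r$ contains at most one point of $\Lambda$; relatively dense if there is $R>0$ such that every open ball of radius $R$ contains at least one point of $\Lambda$; a Delone set if it is both. For $\Lambda\subset\mathbb{C}$, let $\mathbb{K}_{\Lambda}:=\mathbb{Q}\big((\Lambda-\Lambda)\cup\overline{(\Lambda-\Lambda)}\big)$ (the bar denotes complex conjugation) and $\mathbb{k}_{\Lambda}:=\mathbb{K}_{\Lambda}\cap\mathbb{R}$. A homothety of $\mathbb{R}^d$ is a map $z\mapsto\lambda z+t$ with $\lambda>0$ real and $t\in\mathbb{R}^d$. A Delone set $\Lambda\subset\mathbb{R}^2$ is an algebraic Delone set if (Alg) $[\mathbb{K}_{\Lambda}:\mathbb{Q}]<\infty$,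 and (Hom) for every finite subset $F$ of $\mathbb{K}_{\Lambda}$ there is a homothety $h$ of $\mathbb{R}^2$ with $h(F)\subset\Lambda$. Directions are elements of the unit sphere $\mathbb{S}^{d-1}$. For $S\subset\mathbb{R}^d$, an $S$-direction is a direction parallel to a non-zero element of $S-S$. For a finite set $F\subset\mathbb{R}^d$ and a direction $u$, the $X$-ray $X_uF$ is the function assigning to each line $\ell$ in direction $u$ the number $\operatorname{card}(F\cap\ell)$. The elements of a collection $\mathcal{E}$ of finite sets are determined by the $X$-rays in the directions of a finite set $U$ of directions if, for all $F,F'\in\mathcal{E}$, $X_uF=X_uF'$ for all $u\in U$ implies $F=F'$. A convex subset of $\Lambda\subset\mathbb{R}^2$ is a bounded subset $C\subset\Lambda$ with $C=\operatorname{conv}(C)\cap\Lambda$ (for Delone sets such $C$ are finite). The cross ratio of four pairwise distinct $t_1,t_2,t_3,t_4\in\mathbb{R}\cup\{\infty\}$ is $\langle t_1,t_2,t_3,t_4\rangle:=\frac{(t_3-t_1)(t_4-t_2)}{(t_3-t_2)(t_4-t_1)}$, with the usual conventions if some $t_i=\infty$. The slope of a vertical direction is $\infty$. The angle of a direction $u$ with the positive real axis is the angle in $[0,\pi)$ of the line $\mathbb{R}u$. The cross ratio of slopes of four pairwise non-parallel $\Lambda$-directions lies in $\mathbb{k}_{\Lambda}$. *)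

(* Defs.v *)
From HB Require Import structures.
From mathcomp Require Import all_boot all_order all_algebra finmap.
From mathcomp Require Import complex.
From mathcomp Require Import all_classical all_reals all_analysis.

Set Implicit Arguments.
Unset Strict Implicit.
Unset Printing Implicit Defensive.
Import Order.TTheory GRing.Theory Num.Theory.
Import numFieldNormedType.Exports.
Local Open Scope classical_set_scope.
Local Open Scope complex_scope.
Local Open Scope ring_scope.

(* Extensions of the rationals, realized as subfields K of an ambient field F
   of characteristic zero. *)

Definition generated_field (F : numFieldType) (S : set F) : set F :=
  smallest (fun K : set F => GRing.divring_closed [in K]) S.

Definition rat_comb (F : numFieldType) (n : nat) (b : 'I_n -> F)
    (q : 'rV[rat]_n) : F :=
  \sum_(i < n) ratr (q 0 i) * b i.

Definition rat_basis (F : numFieldType) (K : set F) (n : nat)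
    (b : 'I_n -> F) : Prop :=
  injective (rat_comb b) /\ range (rat_comb b) = K.

Definition finite_degree (F : numFieldType) (K : set F) : Prop :=
  exists (n : nat) (b : 'I_n -> F), rat_basis K b.

(* The norm from K to the rationals: the determinant of multiplication by x on
   K, seen as a rational vector space.  The default value 0 is only used when
   K is not a field of finite degree or x is not in K. *)
Definition field_norm (F : numFieldType) (K : set F) (x : F) : rat :=
  xget 0 [set d | exists (n : nat) (b : 'I_n -> F) (M : 'M[rat]_n),
    [/\ rat_basis K b,
        forall i, x * b i = rat_comb b (row i M)
      & d = \det M]].

(* The topological structures of the complex plane are found through the copy
   R[i]^o of R[i], its algebraic ones on R[i] itself, and its structure of real
   vector space on the copy Rcomplex R. *)

Section AlgebraicDelone.
Variable R : realType.
Local Notation C := (R[i]).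
Implicit Types (L U F : set C) (u v z p : C).

Definition open_ball (z : C) (r : R) : set C := ball (z : C^o) r%:C.

Definition uniformly_discrete L : Prop :=
  exists2 r : R, 0 < r & forall z, is_subset1 (open_ball z r `&` L).

Definition relatively_dense L : Prop :=
  exists2 r : R, 0 < r & forall z, open_ball z r `&` L !=set0.

Definition delone L : Prop := uniformly_discrete L /\ relatively_dense L.

Definition differences L : set C := [set x - y | x in L & y in L].

Definition field_of L : set C :=
  generated_field (differences L `|` conjc @` differences L).

Definition real_field_of L : set R := [set x | field_of L x%:C].

Definition homothety (l : R) (t z : C) : C := l%:C * z + t.

Definition algebraic_delone L : Prop :=
  [/\ delone L,
      finite_degree (field_of L)
    & forall F, finite_set F -> F `<=` field_of L ->
        exists2 l : R, 0 < l & exists t : C, homothety l t @` F `<=` L].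

Definition direction u : Prop := `|u| = 1.

Definition parallel u v : Prop := exists2 c : R, c != 0 & u = c%:C * v.

Definition set_direction L u : Prop :=
  direction u /\ exists v, [/\ differences L v, v != 0 & parallel u v].

Definition pairwise_nonparallel U : Prop :=
  forall u v, U u -> U v -> u <> v -> ~ parallel u v.

Definition line p u : set C := [set p + t%:C * u | t in [set: R]].

Definition lines_along u : Type := {l : set C | exists p, l = line p u}.

Definition xray u F (l : lines_along u) : nat := #|` fset_set (F `&` sval l)|.

Definition determined_by_xrays (E : set (set C)) U : Prop :=
  forall F F', E F -> E F' ->
    (forall u, U u -> xray F (u := u) = xray F' (u := u)) -> F = F'.

Definition convex_hull F : set C :=
  smallest (fun A : set C => @convex_set R (Rcomplex R) A) F.

Definition convex_subset L F : Prop :=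
  bounded_set (F : set C^o) /\ F = convex_hull F `&` L.

Definition angle u : R :=
  xget 0 [set a : R | 0 <= a < pi /\ parallel u (cos a +i* sin a)].

(* Slopes live in the projective line; None stands for infinity. *)
Definition slope u : option R :=
  if complex.Re u == 0 then None else Some (complex.Im u / complex.Re u).

(* When one of the points is infinite, the two factors containing it cancel.
   The value 0 for two or more infinite points is a dummy. *)
Definition cross_ratio (t1 t2 t3 t4 : option R) : R :=
  match t1, t2, t3, t4 with
  | Some t1, Some t2, Some t3, Some t4 =>
      ((t3 - t1) * (t4 - t2)) / ((t3 - t2) * (t4 - t1))
  | None, Some t2, Some t3, Some t4 => (t4 - t2) / (t3 - t2)
  | Some t1, None, Some t3, Some t4 => (t3 - t1) / (t4 - t1)
  | Some t1, Some t2, None, Some t4 => (t4 - t2) / (t4 - t1)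
  | Some t1, Some t2, Some t3, None => (t3 - t1) / (t3 - t2)
  | _, _, _, _ => 0
  end.

End AlgebraicDelone.

(* Main.v *)
(* (a) Suppose that F and F' are distinct convex subsets with the same X-rays in four
   directions.  The points of F \ F' lie outside conv F', those of F' \ F outside
   conv F, and both sets have the same centroid, from which they are seen in
   alternating blocks.  Each direction induces a reflection of the cyclic order of the
   blocks, and the centroids of the blocks form a locally convex polygon.  Its discrete
   Fourier transform has a mode that is not a complex multiple of a real vector, and
   the reflections turn this mode into an expression of the cross ratio by roots of
   unity: (w3 - w1) (w4 - w2) / ((w3 - w2) (w4 - w1)).  Up to units of the ring of
   algebraic integers, 1 - eta is an e-th root of 1 or of a prime p <= e + 1, so the
   norm of such a ratio has bounded numerator and denominator.

   (b) Three pairwise non-parallel directions are parallel to a, b and a - b for some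
   a, b in the field of L.  Put a homothetic copy of the hexagon with vertices +-a, +-b,
   +-(a - b) into L; removing the even or the odd vertices leaves two convex subsets
   with the same X-rays. *)

Require Import Defs.
From HB Require Import structures.
From mathcomp Require Import all_boot all_order all_algebra all_fingroup.
From mathcomp Require Import all_solvable all_field finmap.
From mathcomp Require Import complex.
From mathcomp Require Import all_classical all_reals all_analysis.
From mathcomp Require Import zify ring lra.

Set Implicit Arguments.
Unset Strict Implicit.
Unset Printing Implicit Defensive.
Import Order.TTheory GRing.Theory Num.Theory.
Local Open Scope classical_set_scope.
Local Open Scope complex_scope.
Local Open Scope ring_scope.

(** * Norms of cyclotomic ratios *)

(** The points themselves need not be in convex position, and many of them may share an angular
    sector. Averaging over a block repairs this: a reflection matches blocks of equal size line by
    line, so it preserves the level of the centroid, and positive turn determinants stay positive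
    under averaging. The polygon need not be affinely regular, but the reflection conditions are
    linear and act on every Fourier mode separately, so one nondegenerate mode can replace an
    affinely regular polygon. Cyclic orders are handled by lifting angles to the real line,
    separately for each direction. There the matching, although an arbitrary pairing on each line,
    reverses the order of points of opposite sign. The orders of the roots of unity depend on the
    two sets and are unbounded. The norm is bounded because a factor [1 - eta] contributes only
    [p ^ (d / e)] to a norm of degree [d]: as [p <= e + 1], two such factors yield a positive
    integral exponent of [p] only if [p <= 2 d + 1]. *)

Section AlgebraicIntegers.
Variable F : numClosedFieldType.
Implicit Types (x y z : F) (n p : nat).

Definition alg_int x := integralOver (intr : int -> F) x.

Lemma alg_int_nat n : alg_int n%:R.
Proof. exact: integral_nat. Qed.

Lemma alg_intM x y : alg_int x -> alg_int y -> alg_int (x * y).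
Proof. exact: integral_mul. Qed.

Lemma alg_intB x y : alg_int x -> alg_int y -> alg_int (x - y).
Proof. exact: integral_sub. Qed.

Lemma alg_intX x n : alg_int x -> alg_int (x ^+ n).
Proof.
move=> hx; elim: n => [|n IH]; first exact: integral1.
by rewrite exprS; apply: alg_intM.
Qed.

Lemma alg_int_sum (I : Type) (r : seq I) (P : pred I) (f : I -> F) :
  (forall i, P i -> alg_int (f i)) -> alg_int (\sum_(i <- r | P i) f i).
Proof.
by move=> h; elim/big_ind: _ => //; [exact: mxpoly.integral0|exact: integral_add].
Qed.

Lemma alg_int_unity n x : (0 < n)%N -> x ^+ n = 1 -> alg_int x.
Proof.
move=> n0 hx; exists ('X^n - 1); first by rewrite monicXnsubC.
by rewrite rmorphB /= map_polyXn rmorph1 /root !hornerE hx subrr.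
Qed.

Definition alg_unit x := [/\ x != 0, alg_int x & alg_int x^-1].

Lemma alg_unitM x y : alg_unit x -> alg_unit y -> alg_unit (x * y).
Proof.
move=> [x0 xi xv] [y0 yi yv]; split; first by rewrite mulf_neq0.
  exact: alg_intM.
by rewrite invfM; apply: alg_intM.
Qed.

Lemma alg_unitV x : alg_unit x -> alg_unit x^-1.
Proof. by move=> [x0 xi xv]; split; rewrite ?invr_eq0 ?invrK. Qed.

Lemma alg_unit1 : alg_unit 1.
Proof. by split; rewrite ?oner_eq0 ?invr1 //; exact: integral1. Qed.

Lemma alg_unitX x n : alg_unit x -> alg_unit (x ^+ n).
Proof.
move=> hx; elim: n => [|n IH]; first exact: alg_unit1.
by rewrite exprS; apply: alg_unitM.
Qed.

Lemma alg_unit_prod (I : Type) (r : seq I) (P : pred I) (f : I -> F) :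
  (forall i, P i -> alg_unit (f i)) -> alg_unit (\prod_(i <- r | P i) f i).
Proof.
by move=> h; elim/big_ind: _ => //; [exact: alg_unit1|exact: alg_unitM].
Qed.

Lemma alg_unit_unity n x : (0 < n)%N -> x ^+ n = 1 -> alg_unit x.
Proof.
move=> n0 hx; split; last first.
- by apply: (@alg_int_unity n) => //; rewrite exprVn hx invr1.
- exact: alg_int_unity hx.
by apply/eqP => x0; move: hx; rewrite x0 expr0n gtn_eqF // => /esym/eqP; rewrite oner_eq0.
Qed.

Lemma alg_int_onesub_div z k : alg_int z -> z != 1 -> alg_int ((1 - z ^+ k) / (1 - z)).
Proof.
move=> hz z1; have h : 1 - z != 0 by rewrite subr_eq0 eq_sym.
rewrite -[X in X - _](expr1n _ k) subrXX mulrC mulKf //.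
apply: alg_int_sum => i _; rewrite expr1n mul1r; exact: alg_intX.
Qed.

Lemma prod_onesub_prim n z : n.+1.-primitive_root z ->
  \prod_(1 <= k < n.+1) (1 - z ^+ k) = n.+1%:R.
Proof.
move=> hz; have /= := factor_Xn_sub_1 hz.
rewrite big_ltn // expr0 subrX1 => /(mulfI _); rewrite polyXsubC_eq0 => /(_ isT).
move=> /(congr1 (horner^~ 1)); rewrite horner_prod horner_sum.
under eq_bigr do rewrite hornerXsubC.
by move=> ->; under eq_bigr do rewrite hornerXn expr1n; rewrite sumr_const card_ord.
Qed.


(** These are the cyclotomic units: [z] is in turn a power of [z ^+ k], so the inverse is a quotient
    of the same form, and both quotients are geometric sums. *)
Lemma alg_unit_onesub_coprime n z k : n.-primitive_root z -> z != 1 ->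
  coprime k n -> alg_unit ((1 - z ^+ k) / (1 - z)).
Proof.
move=> hz z1 kn; have n0 := prim_order_gt0 hz.
have hzi : alg_int z by exact: alg_int_unity n0 (prim_expr_order hz).
have hzk : n.-primitive_root (z ^+ k) by rewrite prim_root_exp_coprime.
have [j zj] := prim_rootP hzk (prim_expr_order hz).
have zk1 : z ^+ k != 1 by apply: contra_neq z1 => zk1; rewrite zj zk1 expr1n.
split; first by rewrite mulf_neq0 ?invr_eq0 // subr_eq0 eq_sym.
  exact: alg_int_onesub_div.
rewrite invfM invrK mulrC {1}zj; apply: alg_int_onesub_div => //.
exact: alg_intX.
Qed.

Lemma prim_root_neq1 n z : n.-primitive_root z -> (1 < n)%N -> z != 1.
Proof.
by move=> hz n1; rewrite -[z]expr1 -(prim_order_dvd hz) dvdn1 gtn_eqF.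
Qed.

(** The prime [p] is the product of the [1 - w ^+ k] with [0 < k < p], and each of these is
    associate to [1 - w]. *)
Lemma prod_onesub_prime p w : prime p -> p.-primitive_root w ->
  alg_unit (p%:R / (1 - w) ^+ p.-1).
Proof.
move=> pp hw; have p1 := prime_gt1 pp.
have w1 : w != 1 by exact: prim_root_neq1 hw p1.
have := hw; rewrite -{1}(prednK (prime_gt0 pp)) => /prod_onesub_prim.
rewrite (prednK (prime_gt0 pp)) => <-.
have -> : (1 - w) ^+ p.-1 = \prod_(1 <= k < p) (1 - w).
  by rewrite prodr_const_nat subn1.
rewrite -prodf_div big_nat; apply: alg_unit_prod => k /andP[k0 kp].
apply: alg_unit_onesub_coprime hw _ _ => //.
by rewrite coprime_sym prime_coprime // gtnNdvd.
Qed.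

(** The power [w] of [z] of order [p] gives a chain of divisibilities: [1 - z] divides [1 - w],
    which divides [p], an associate of [(1 - w) ^+ p.-1]. *)
Lemma alg_int_prime_div_onesub n p z : n.-primitive_root z -> prime p ->
  (p %| n)%N -> z != 1 -> alg_int (p%:R / (1 - z)).
Proof.
move=> hz pp pn z1; have hw := dvdn_prim_root hz pn.
set w := z ^+ (n %/ p) in hw.
have [_ h _] := prod_onesub_prime pp hw.
have hzi : alg_int z.
  exact: alg_int_unity (prim_order_gt0 hz) (prim_expr_order hz).
have w1 : 1 - w != 0.
  by rewrite subr_eq0 eq_sym (prim_root_neq1 hw) ?prime_gt1.
have -> : p%:R / (1 - z) =
    p%:R / (1 - w) ^+ p.-1 * (1 - w) ^+ p.-1.-1 * ((1 - w) / (1 - z)).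
  have -> : p.-1 = p.-1.-1.+1 by have := prime_gt1 pp; lia.
  rewrite /= exprS; field.
  by rewrite subr_eq0 eq_sym z1 w1 expf_neq0.
apply: alg_intM; last exact: alg_int_onesub_div.
apply: alg_intM => //; apply: alg_intX; apply: alg_intB; first exact: (alg_int_nat 1).
exact: alg_intX.
Qed.

(** The factorization of [X^N - 1] at [y^-1]. For [z] of order [N * p], a power of [p], it is
    applied to [y = z] and [w = z ^+ p] and splits [1 - z ^+ N] into [N] associates of [1 - z]. *)
Lemma prod_onesub_shift N w y : N.-primitive_root w -> y != 0 ->
  \prod_(0 <= i < N) (1 - y * w ^+ i) = 1 - y ^+ N.
Proof.
move=> hw y0; have := factor_Xn_sub_1 hw => /(congr1 (horner^~ y^-1)).
rewrite horner_prod !hornerE.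
under eq_bigr do rewrite hornerXsubC.
move=> h.
have -> : 1 - y ^+ N = y ^+ N * (y^-1 ^+ N - 1).
  by rewrite mulrBr mulr1 -exprMn divff // expr1n.
rewrite -h -[X in y ^+ X](subn0 N) -prodr_const_nat -big_split /=.
by apply: eq_bigr => i _; rewrite mulrBr divff.
Qed.

(* If the order of [z] is not a prime power, then [1 - z] divides two distinct primes.
   If it is [p ^ a.+1], then [(1 - z) ^ (p ^ a)] is associate to [1 - w], where [w] has
   order [p], and [(1 - w) ^ p.-1] is associate to [p]. *)
Lemma onesub_unity_power m z : (0 < m)%N -> z ^+ m = 1 -> z != 1 ->
  exists e c, [/\ (0 < e)%N, c = 1%N \/ prime c /\ (c <= e.+1)%N
                & alg_unit ((1 - z) ^+ e / c%:R)].
Proof.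
move=> m0 zm z1; have [n hz _] := prim_order_exists m0 zm.
have n0 := prim_order_gt0 hz.
have n1 : (1 < n)%N.
  rewrite ltn_neqAle n0 andbT eq_sym; apply: contra_neq z1 => n1.
  by have := prim_expr_order hz; rewrite n1.
have u1 : 1 - z != 0 by rewrite subr_eq0 eq_sym.
have hzi : alg_int z by exact: alg_int_unity n0 (prim_expr_order hz).
pose p := pdiv n; have pp : prime p by exact: pdiv_prime.
have pn : (p %| n)%N by exact: pdiv_dvd.
have [a0 hn] : (0 < logn p n)%N /\ n = (p ^ logn p n * n`_p^')%N.
  by rewrite logn_gt0 mem_primes pp n0 pn -p_part partnC.
have [q1|q1] := leqP (n`_p^')%N 1.
  have /eqP q0 : (n`_p^')%N == 1%N by rewrite eqn_leq q1 part_gt0.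
  rewrite q0 muln1 in hn.
  case ha: (logn p n) a0 hn => [//|a] _ hn.
  pose N := (p ^ a)%N; have N0 : (0 < N)%N by rewrite expn_gt0 prime_gt0.
  have nN : n = (N * p)%N by rewrite hn expnSr.
  have hw : p.-primitive_root (z ^+ N).
    by have := dvdn_prim_root hz pn; rewrite {1}nN mulnK ?prime_gt0.
  have hmu : N.-primitive_root (z ^+ p).
    have := @dvdn_prim_root _ _ _ hz N; rewrite {1 2}nN dvdn_mulr // => /(_ isT).
    by rewrite mulKn.
  have h := prod_onesub_prime pp hw.
  exists (N * p.-1)%N, p; have p1 := prime_gt1 pp; split.
  - by rewrite muln_gt0 N0; lia.
  - by right; split => //; have := leq_pmull p.-1 N0; lia.
  have z0 : z != 0 by rewrite (prim_root_eq0 hz) -lt0n.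
  have hN := prod_onesub_shift hmu z0.
  have hu : alg_unit ((1 - z ^+ N) / (1 - z) ^+ N).
    have -> : (1 - z) ^+ N = \prod_(0 <= i < N) (1 - z).
      by rewrite prodr_const_nat subn0.
    rewrite -hN -prodf_div.
    apply: alg_unit_prod => i _; rewrite -exprM -exprS.
    apply: alg_unit_onesub_coprime hz _ _ => //.
    rewrite hn coprimeXr // coprime_sym prime_coprime // -addn1 dvdn_addr ?dvdn_mulr //.
    by rewrite dvdn1; lia.
  have hu' := alg_unitX p.-1 hu.
  rewrite expr_div_n -exprM in hu'.
  have := alg_unitV (alg_unitM h hu').
  have [w1 _ _] := hu; have /negbTE w0 : 1 - z ^+ N != 0.
    by apply: contra_neq w1 => ->; rewrite mul0r.
  by rewrite mulrA divfK ?expf_neq0 ?w0 // invfM invrK mulrC.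
exists 1%N, 1%N; split => //; first by left.
rewrite expr1 divr1; split => //.
  by apply: alg_intB => //; exact: (alg_int_nat 1).
pose q := pdiv (n`_p^')%N; have qq : prime q by exact: pdiv_prime.
have qn : (q %| n)%N by apply: dvdn_trans (pdiv_dvd _) (dvdn_part _ _).
have pq : coprime p q.
  have : q \in \pi(n`_p^')%N by rewrite mem_primes qq part_gt0 pdiv_dvd.
  move=> /(pnatPpi (part_pnat _ _)); rewrite inE /= => h.
  by rewrite prime_coprime // dvdn_prime2 // eq_sym.
case: (egcdnP q (prime_gt0 pp)) => u v huv _.
have -> : (1 - z)^-1 = u%:R * (p%:R / (1 - z)) - v%:R * (q%:R / (1 - z)).
  rewrite !mulrA -mulrBl -!natrM huv (eqP pq) natrD addrAC subrr add0r.
  by rewrite mul1r.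
by apply: alg_intB; apply: alg_intM; rewrite ?alg_int_nat //;
  try exact: alg_int_nat; apply: alg_int_prime_div_onesub hz _ _ _.
Qed.
End AlgebraicIntegers.

(** * Norms as determinants: integrality and independence of the basis *)

Lemma char_root_int (n : nat) (M : 'M[rat]_n.+1) (p : {poly int}) (a : algC) :
  p \is monic -> horner_mx M (map_poly intr p) = 0 ->
  root (char_poly (map_mx (ratr : rat -> algC) M)) a -> a \in Aint.
Proof.
move=> pm pM; rewrite -root_mxminpoly => ra.
have : mxminpoly (map_mx (ratr : rat -> algC) M) %| map_poly (intr : int -> algC) p.
  apply: mxminpoly_min.
  have -> : map_poly (intr : int -> algC) p = map_poly ratr (map_poly intr p).
    by rewrite -map_poly_comp; apply: eq_map_poly => x /=; rewrite ratr_int.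
  by rewrite -map_horner_mx pM map_mx0.
move=> h; have ra' : root (map_poly (intr : int -> algC) p) a.
  by move: ra; rewrite -!dvdp_XsubCl => /dvdp_trans; apply.
apply: (root_monic_Aint ra').
  by rewrite monic_map.
by apply/polyOverP => i; rewrite coef_map /= intr_int.
Qed.

(** Up to sign, the determinant is the product of the eigenvalues in [algC]; these are roots of [p],
    hence algebraic integers, and a rational algebraic integer is an integer. This argument replaces
    the choice of an integral basis. *)
Lemma det_int (n : nat) (M : 'M[rat]_n.+1) (p : {poly int}) :
  p \is monic -> horner_mx M (map_poly intr p) = 0 -> \det M \is a Num.int.
Proof.
move=> pm hp.
pose A := map_mx (ratr : rat -> algC) M.
have [r hr] := closed_field_poly_normal (char_poly A).
rewrite (monicP (char_poly_monic A)) scale1r in hr.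
have hdet : (-1) ^+ n.+1 * ratr (\det M) = \prod_(z <- r) (- z).
  rewrite -det_map_mx -/A -char_poly_det hr -horner_coef0 horner_prod.
  by apply: eq_bigr => z _; rewrite hornerXsubC sub0r.
have hA : ratr (\det M) \in Aint.
  have -> : ratr (\det M) = (-1) ^+ n.+1 * \prod_(z <- r) (- z) :> algC.
    by rewrite -hdet mulrA -expr2 sqrr_sign mul1r.
  rewrite rpredM ?rpredX ?rpredN ?rpred1 // big_seq rpred_prod // => z zr.
  rewrite rpredN; apply: (char_root_int pm hp).
  by rewrite hr root_prod_XsubC.
have : ratr (\det M) \is a (Num.int : qualifier 1 algC).
  by apply: Cint_rat_Aint => //; apply: Crat_rat.
by move=> /intrP[m]; rewrite -(ratr_int _ m) => /fmorph_inj ->; rewrite intr_int.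
Qed.

Section RationalCoordinates.
Variables (F : numFieldType) (n : nat) (b : 'I_n -> F).
Hypothesis b_inj : injective (rat_comb b).

Lemma rat_combD v w : rat_comb b (v + w) = rat_comb b v + rat_comb b w.
Proof.
by rewrite -big_split /=; apply: eq_bigr => i _; rewrite mxE rmorphD mulrDl.
Qed.

Lemma rat_combZ a v : rat_comb b (a *: v) = ratr a * rat_comb b v.
Proof.
by rewrite mulr_sumr; apply: eq_bigr => i _; rewrite mxE rmorphM mulrA.
Qed.

Lemma rat_comb0 : rat_comb b 0 = 0.
Proof. by apply: big1 => i _; rewrite mxE rmorph0 mul0r. Qed.

Lemma rat_comb_sum (I : Type) (r : seq I) (P : pred I) f :
  rat_comb b (\sum_(i <- r | P i) f i) = \sum_(i <- r | P i) rat_comb b (f i).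
Proof. exact: (big_morph _ rat_combD rat_comb0). Qed.

(** Coordinates are row vectors, so matrices act on the right and the order of factors is reversed
    in [rat_repM]. *)
Definition rat_rep x (M : 'M[rat]_n) :=
  forall v, x * rat_comb b v = rat_comb b (v *m M).

Lemma rat_rep_rows x M :
  (forall i, x * b i = rat_comb b (row i M)) -> rat_rep x M.
Proof.
move=> h v; rewrite mulmx_sum_row rat_comb_sum mulr_sumr.
by apply: eq_bigr => i _; rewrite rat_combZ -h mulrCA.
Qed.

Lemma rat_rep1 : rat_rep 1 1%:M.
Proof. by move=> v; rewrite mul1r mulmx1. Qed.

Lemma rat_repM x y M N : rat_rep x M -> rat_rep y N -> rat_rep (x * y) (N *m M).
Proof. by move=> hx hy v; rewrite -mulrA hy hx mulmxA. Qed.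

Lemma rat_repD x y M N : rat_rep x M -> rat_rep y N -> rat_rep (x + y) (M + N).
Proof. by move=> hx hy v; rewrite mulrDl hx hy -rat_combD mulmxDr. Qed.

Lemma rat_repZ a x M : rat_rep x M -> rat_rep (ratr a * x) (a *: M).
Proof. by move=> hx v; rewrite -mulrA hx -rat_combZ scalemxAr. Qed.

Lemma rat_rep_inj x M N : rat_rep x M -> rat_rep x N -> M = N.
Proof.
move=> hM hN; apply/row_matrixP => i; rewrite !rowE.
by apply: b_inj; rewrite -hM -hN.
Qed.

Lemma rat_rep_unit x M : x != 0 -> rat_rep x M -> M \in unitmx.
Proof.
move=> x0 hM; rewrite -row_free_unit -kermx_eq0; apply/eqP/row_matrixP => i.
rewrite row0; apply: b_inj; rewrite rat_comb0; apply: (mulfI x0).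
by rewrite hM mulr0 -row_mul mulmx_ker row0 rat_comb0.
Qed.

Lemma rat_repV x M : x != 0 -> rat_rep x M -> rat_rep x^-1 (invmx M).
Proof.
move=> x0 hM v; apply: (mulfI x0).
by rewrite mulrA divff // mul1r hM mulmxKV // (rat_rep_unit x0 hM).
Qed.

End RationalCoordinates.

(** Substitution into rational polynomials is compatible with [rat_rep], so a monic integral
    equation of [x] is also one of [M]. *)
Lemma rat_rep_det_int (F : numFieldType) (n : nat) (b : 'I_n -> F) x M (p : {poly int}) :
  injective (rat_comb b) -> rat_rep b x M -> p \is monic ->
  root (map_poly intr p) x -> \det M \is a Num.int.
Proof.
case: n b M => [|n] b M b_inj hM pm px; first by rewrite det_mx00.
apply: (det_int pm).
have hp (q : {poly rat}) : rat_rep b (map_poly ratr q).[x] (horner_mx M q).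
  elim/poly_ind: q => [|q c IH].
    by rewrite !rmorph0 horner0 => v; rewrite mul0r mulmx0 rat_comb0.
  rewrite rmorphD /= rmorphM /= map_polyX map_polyC /= hornerMXaddC.
  rewrite rmorphD rmorphM /= horner_mx_X horner_mx_C; apply: rat_repD.
    by have := rat_repM hM IH; rewrite mulrC.
  by have := rat_repZ c (rat_rep1 b); rewrite mulr1 scalemx1.
have := hp (map_poly intr p); rewrite -map_poly_comp.
rewrite (@eq_map_poly _ _ _ (intr : int -> F)) => [|m]; last by rewrite /= ratr_int.
rewrite (rootP px) => h0; apply: (rat_rep_inj b_inj h0) => v.
by rewrite mul0r mulmx0 rat_comb0.
Qed.

(** [field_norm] may use any basis, whereas the height bound depends on its length; hence this
    invariance. *)
Lemma rat_basis_size (F : numFieldType) (K : set F) m n (b : 'I_m -> F) (c : 'I_n -> F) :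
  rat_basis K b -> rat_basis K c -> m = n.
Proof.
have half k l (f : 'I_k -> F) (g : 'I_l -> F) : rat_basis K f -> rat_basis K g -> (k <= l)%N.
  move=> [fi fK] [gi gK].
  have sub r (e : 'I_r -> F) i : rat_comb e (delta_mx 0 i) = e i.
    rewrite /rat_comb (bigD1 i) //= mxE !eqxx rmorph1 mul1r big1 ?addr0 // => j ji.
    by rewrite mxE (negbTE ji) andbF rmorph0 mul0r.
  have ch r s (e : 'I_r -> F) (e' : 'I_s -> F) : range (rat_comb e) = K ->
    range (rat_comb e') = K -> exists A : 'M[rat]_(r, s), forall v, rat_comb e v = rat_comb e' (v *m A).
    move=> eK e'K.
    have h i : exists v, rat_comb e' v = e i.
      have : range (rat_comb e') (e i) by rewrite e'K -eK; exists (delta_mx 0 i) => //; exact: sub.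
      by move=> [v _ <-]; exists v.
    have [w hw] := choice h.
    exists (\matrix_i w i) => v.
    rewrite mulmx_sum_row rat_comb_sum.
    by apply: eq_bigr => i _; rewrite rat_combZ rowK hw.
  have [A hA] := ch _ _ _ _ fK gK; have [B hB] := ch _ _ _ _ gK fK.
  have AB : A *m B = 1%:M.
    apply/row_matrixP => i; rewrite !rowE mulmx1; apply: fi.
    by rewrite mulmxA -hB -hA.
  exact: mulmx1_min AB.
by move=> hb hc; apply/eqP; rewrite eqn_leq (half _ _ _ _ hb hc) (half _ _ _ _ hc hb).
Qed.

(** A common multiple of all prime powers with base at most [d.*2.+1] and exponent at most [d.*2],
    the only ones that can occur in a norm of degree [d]. *)
Definition norm_height_bound (d : nat) : nat := (((d.*2).+1)`! ^ d.*2)%N.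

(* For a prime [p] dividing [A], [E <= E * logn p A] is at most the sum of those [ki]
   with [ci = p]; since [ki * p.-1 <= d * E], this forces [p <= d.*2.+1]. *)
Lemma dvdn_norm_height_bound (A B E d e1 e2 c1 c2 k1 k2 : nat) :
  coprime A B -> (0 < A)%N -> (0 < E)%N -> (0 < e1)%N -> (0 < e2)%N ->
  (k1 * e1 = d * E)%N -> (k2 * e2 = d * E)%N ->
  c1 = 1%N \/ prime c1 /\ (c1 <= e1.+1)%N ->
  c2 = 1%N \/ prime c2 /\ (c2 <= e2.+1)%N ->
  (A ^ E %| B ^ E * (c1 ^ k1 * c2 ^ k2))%N ->
  (A <= norm_height_bound d)%N.
Proof.
move=> AB A0 E0 e10 e20 hk1 hk2 hc1 hc2.
rewrite Gauss_dvdr ?coprimeXl ?coprimeXr // => hA.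
apply: dvdn_leq; first by rewrite expn_gt0 fact_gt0.
apply/dvdn_partP => // p; rewrite mem_primes => /and3P[pp _ pA].
have t0 : (0 < logn p A)%N by rewrite logn_gt0 mem_primes pp A0.
have c0 c e : c = 1%N \/ prime c /\ (c <= e.+1)%N -> (0 < c)%N.
  by move=> [->|[/prime_gt0]].
have cl c e : c = 1%N \/ prime c /\ (c <= e.+1)%N ->
    logn p c = 0%N \/ logn p c = 1%N /\ (p <= e.+1)%N.
  move=> [->|[pc ce]]; first by left; rewrite logn1.
  by rewrite logn_prime //; case: eqP => [->|]; [right|left].
have := dvdn_leq_log p _ hA.
rewrite muln_gt0 !expn_gt0 (c0 _ _ hc1) (c0 _ _ hc2) => /(_ isT).
rewrite lognM ?expn_gt0 ?(c0 _ _ hc1) ?(c0 _ _ hc2) // !lognX.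
set t := logn p A in t0 *; move=> ht.
have key k e c : (0 < e)%N -> (k * e = d * E)%N ->
    logn p c = 0%N \/ logn p c = 1%N /\ (p <= e.+1)%N ->
    (k * logn p c <= d * E)%N /\ ((d.*2).+1 < p -> (k * logn p c).*2 < E)%N.
  move=> e0 hk [->|[-> pe]]; first by rewrite muln0.
  rewrite muln1; split; first by rewrite -hk leq_pmulr.
  move=> dp; have [->|k0] := posnP k; first by [].
  have : (k * (d.*2).+1 <= d * E)%N by rewrite -hk leq_mul2l; lia.
  nia.
have [h1 h1'] := key _ _ _ e10 hk1 (cl _ _ hc1).
have [h2 h2'] := key _ _ _ e20 hk2 (cl _ _ hc2).
have tE : (E * t <= d.*2 * E)%N by lia.
have td : (t <= d.*2)%N by rewrite -(leq_pmul2l E0) mulnC; lia.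
have pd : (p <= (d.*2).+1)%N.
  rewrite leqNgt; apply/negP => /[dup] /h1' ? /h2' ?.
  have : (E <= E * t)%N by rewrite leq_pmulr.
  lia.
rewrite p_part -/t; apply: dvdn_trans (dvdn_exp2l p td) _.
by rewrite dvdn_exp2r // dvdn_fact // prime_gt0.
Qed.

(** * Cyclotomic ratios in a field of finite degree *)

Section NormOfCyclotomicRatio.
Variable R : realType.
Implicit Types (q : R) (eta : 'I_4 -> R[i]).

Lemma alg_int_det n (b : 'I_n -> R) (u : R) M : injective (rat_comb b) ->
  rat_rep b u M -> alg_int (u%:C) -> \det M \is a Num.int.
Proof.
move=> b_inj hM [p pm pu]; apply: (rat_rep_det_int b_inj hM pm).
move: pu; rewrite (_ : map_poly intr p = map_poly (real_complex R) (map_poly intr p)).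
  by rewrite fmorph_root.
by rewrite -map_poly_comp; apply: eq_map_poly => m /=; rewrite rmorph_int.
Qed.

Lemma alg_unit_det n (b : 'I_n -> R) (u : R) M : injective (rat_comb b) ->
  rat_rep b u M -> alg_unit (u%:C) -> `|\det M| = 1.
Proof.
move=> b_inj hM [u0 ui uv].
have {}u0 : u != 0 by apply: contra_neq u0 => ->; rewrite rmorph0.
have hV := rat_repV b_inj u0 hM.
have /intrP[m hm] := alg_int_det b_inj hM ui.
rewrite -fmorphV in uv.
have /intrP[k hk] := alg_int_det b_inj hV uv.
have : \det M * \det (invmx M) = 1.
  by rewrite det_inv divff // -unitfE -unitmxE (rat_rep_unit b_inj u0 hM).
rewrite hm hk -intrM => /eqP; rewrite (eqr_int _ _ 1) => /eqP mk.
have /eqP : (`|m| * `|k| = 1)%N by rewrite -abszM mk.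
by rewrite muln_eq1 => /andP[/eqP m1 _]; rewrite -intr_norm -abszE m1.
Qed.

Lemma rat_repX n (b : 'I_n -> R) (x : R) M E : rat_rep b x M ->
  exists2 N, rat_rep b (x ^+ E) N & \det N = \det M ^+ E.
Proof.
move=> hM; elim: E => [|E [N hN dN]].
  by exists 1%:M; [exact: rat_rep1|rewrite det1].
exists (N *m M); last by rewrite det_mulmx dN exprSr.
by rewrite exprS; apply: rat_repM.
Qed.

(** With [E] a common multiple of the four exponents from [onesub_unity_power], some rational
    multiple [r] of [q ^+ E] is a unit and has a norm of absolute value 1. This expresses
    [\det M ^+ E] up to sign by [c1], ..., [c4]: the primes of its numerator come from [e1] and
    [e2], those of its denominator from [e3] and [e4]. *)
Lemma cyclotomic_ratio_det n (b : 'I_n -> R) q M (m : nat) (rho e1 e2 e3 e4 : R[i]) :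
  injective (rat_comb b) -> rat_rep b q M -> (0 < m)%N ->
  [/\ rho ^+ m = 1, e1 ^+ m = 1, e2 ^+ m = 1, e3 ^+ m = 1 & e4 ^+ m = 1] ->
  [/\ e1 != 1, e2 != 1, e3 != 1 & e4 != 1] ->
  q%:C = rho * ((1 - e1) * (1 - e2) / ((1 - e3) * (1 - e4))) ->
  (`|numq (\det M)| <= norm_height_bound n)%N /\
  (`|denq (\det M)| <= norm_height_bound n)%N.
Proof.
move=> b_inj hM m0 [rm m1 m2 m3 m4] [n1 n2 n3 n4] hq.
have [d1 [c1 [d10 hc1 u1]]] := onesub_unity_power m0 m1 n1.
have [d2 [c2 [d20 hc2 u2]]] := onesub_unity_power m0 m2 n2.
have [d3 [c3 [d30 hc3 u3]]] := onesub_unity_power m0 m3 n3.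
have [d4 [c4 [d40 hc4 u4]]] := onesub_unity_power m0 m4 n4.
pose E := (d1 * d2 * d3 * d4)%N.
have E0 : (0 < E)%N by rewrite !muln_gt0 d10 d20 d30.
pose f1 := (d2 * d3 * d4)%N; pose f2 := (d1 * d3 * d4)%N.
pose f3 := (d1 * d2 * d4)%N; pose f4 := (d1 * d2 * d3)%N.
have F1 : (E = d1 * f1)%N by rewrite /E /f1; ring.
have F2 : (E = d2 * f2)%N by rewrite /E /f2; ring.
have F3 : (E = d3 * f3)%N by rewrite /E /f3; ring.
have F4 : (E = d4 * f4)%N by rewrite /E /f4; ring.
pose r : rat := c3%:R ^+ f3 * c4%:R ^+ f4 / (c1%:R ^+ f1 * c2%:R ^+ f2).
have cn (K : numDomainType) c e : c = 1%N \/ prime c /\ (c <= e.+1)%N -> c%:R != 0 :> K.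
  by rewrite pnatr_eq0 -lt0n => -[->|[/prime_gt0]].
have hu : alg_unit ((ratr r * q ^+ E)%:C).
  rewrite rmorphM rmorphXn /= hq.
  have -> : (ratr r : R)%:C = c3%:R ^+ f3 * c4%:R ^+ f4 / (c1%:R ^+ f1 * c2%:R ^+ f2) :> R[i].
    by rewrite -[LHS]/((real_complex R \o ratr) r) /r;
       rewrite fmorph_div !rmorphM !rmorphXn /= !ratr_nat !rmorph_nat.
  rewrite !exprMn exprVn exprMn {2}F1 {2}F2 {2}F3 {2}F4.
  rewrite (exprM _ d1 f1) (exprM _ d2 f2) (exprM _ d3 f3) (exprM _ d4 f4).
  have hr : alg_unit (rho ^+ E) by apply: alg_unitX; exact: alg_unit_unity rm.
  have := alg_unitM hr (alg_unitM (alg_unitM (alg_unitX f1 u1) (alg_unitX f2 u2))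
    (alg_unitV (alg_unitM (alg_unitX f3 u3) (alg_unitX f4 u4)))).
  congr alg_unit.
  rewrite !expr_div_n.
  have := cn R[i] _ _ hc1; have := cn R[i] _ _ hc2; have := cn R[i] _ _ hc3; have := cn R[i] _ _ hc4.
  have : 1 - e3 != 0 by rewrite subr_eq0 eq_sym.
  have : 1 - e4 != 0 by rewrite subr_eq0 eq_sym.
  move=> /(expf_neq0 d4)/(expf_neq0 f4) ? /(expf_neq0 d3)/(expf_neq0 f3) ?.
  move=> /(expf_neq0 f4) ? /(expf_neq0 f3) ? /(expf_neq0 f2) ? /(expf_neq0 f1) ?.
  have aux (r0 x1 x2 x3 x4 g1 g2 g3 g4 : R[i]) : x3 != 0 -> x4 != 0 ->
      g1 != 0 -> g2 != 0 -> g3 != 0 -> g4 != 0 ->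
      r0 * (x1 / g1 * (x2 / g2) * (x3 / g3 * (x4 / g4))^-1) =
      g3 * g4 / (g1 * g2) * (r0 * (x1 * x2 * (x3 * x4)^-1)).
    by move=> x30 x40 g10 g20 g30 g40; field; do ?[apply/andP; split].
  by apply: aux.
have [N hN dN] := rat_repX E hM.
have := alg_unit_det b_inj (rat_repZ r hN) hu.
rewrite detZ dN normrM !normrX.
have -> : `|r| = r by rewrite ger0_norm // divr_ge0 // mulr_ge0 // exprn_ge0.
set D := \det M.
have -> : `|D| = `|numq D|%N%:R / `|denq D|%N%:R.
  rewrite -[in LHS](divq_num_den D) normrM normfV -!intr_norm -!abszE.
  by rewrite -!pmulrn.
have den0 : (0 < `|denq D|)%N by rewrite absz_gt0 denq_neq0.
set A := `|numq D|%N; set B := `|denq D|%N in den0 *.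
have AB : coprime A B by exact: coprime_num_den.
move=> hr.
have : (A ^ E * (c3 ^ (f3 * n) * c4 ^ (f4 * n)) = B ^ E * (c1 ^ (f1 * n) * c2 ^ (f2 * n)))%N.
  apply/eqP; rewrite -(eqr_nat rat) !natrM !natrX; apply/eqP.
  move: hr; rewrite /r expr_div_n !exprMn exprVn.
  rewrite (exprM _ f1 n) (exprM _ f2 n) (exprM _ f3 n) (exprM _ f4 n).
  have := cn rat _ _ hc1; have := cn rat _ _ hc2.
  move=> /(expf_neq0 f2)/(expf_neq0 n) H2 /(expf_neq0 f1)/(expf_neq0 n) H1.
  have HB : B%:R ^+ E != 0 :> rat by rewrite expf_neq0 // pnatr_eq0 -lt0n.
  move=> hr; have : forall x y z w v s : rat, z != 0 -> w != 0 -> v != 0 ->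
    x * y / (z * w) * (s / v) = 1 -> s * (x * y) = v * (z * w).
    move=> x y z w v s z0 w0 v0 h; rewrite -[RHS]mulr1 -h.
    by field; rewrite z0 w0 v0.
  by apply.
move=> hAB.
have A0 : (0 < A)%N.
  rewrite lt0n; apply: contraTneq isT => A0.
  move: hAB; rewrite A0 exp0n // mul0n => /esym/eqP; rewrite -leqn0 leqNgt !muln_gt0 !expn_gt0.
  have cp c e : c = 1%N \/ prime c /\ (c <= e.+1)%N -> (0 < c)%N by move=> [->|[/prime_gt0]].
  by rewrite den0 (cp _ _ hc1) (cp _ _ hc2).
split.
- apply: (@dvdn_norm_height_bound A B E n d1 d2 c1 c2 (f1 * n)%N (f2 * n)%N) => //.
  + by rewrite F1; ring.
  + by rewrite F2; ring.
  by rewrite -hAB dvdn_mulr.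
- apply: (@dvdn_norm_height_bound B A E n d3 d4 c3 c4 (f3 * n)%N (f4 * n)%N) => //.
  + by rewrite coprime_sym.
  + by rewrite F3; ring.
  + by rewrite F4; ring.
  by rewrite hAB dvdn_mulr.
Qed.

Lemma field_norm_cyclotomic_ratio (K : set R) : exists N : set rat, finite_set N /\
  forall q (m : nat) (rho e1 e2 e3 e4 : R[i]), (0 < m)%N ->
  [/\ rho ^+ m = 1, e1 ^+ m = 1, e2 ^+ m = 1, e3 ^+ m = 1 & e4 ^+ m = 1] ->
  [/\ e1 != 1, e2 != 1, e3 != 1 & e4 != 1] ->
  q%:C = rho * ((1 - e1) * (1 - e2) / ((1 - e3) * (1 - e4))) ->
  N (field_norm K q).
Proof.
have [[n [b hb]]|noK] := pselect (exists n (b : 'I_n -> R), rat_basis K b); last first.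
  (* Without a rational basis of [K], [field_norm] is constantly its default value. *)
  exists [set 0]; split; first exact: finite_set1.
  move=> q m rho e1 e2 e3 e4 _ _ _ _; rewrite /field_norm.
  by case: xgetP => // d _ [n [b [M [hb _ _]]]]; case: noK; exists n, b.
pose h := norm_height_bound n.
pose f (x : bool * ('I_h.+1 * 'I_h.+1)) : rat := (-1) ^+ x.1 * (x.2.1%:R / x.2.2%:R).
(* The element [0] covers the default value of [field_norm] for [q] outside [K]; the Boolean in [f]
   is the sign. *)
exists (0 |` range f); split.
  by rewrite finite_setU; split; [exact: finite_set1|apply: finite_image; exact: finite_finset].
move=> q m rho e1 e2 e3 e4 m0 hm hn hq; rewrite /field_norm.
case: xgetP => [d -> [k [c [M [hc hM ->]]]]|_]; last by left.
right; have nk := rat_basis_size hc hb; subst k.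
have [hA hB] := cyclotomic_ratio_det (proj1 hc) (rat_rep_rows hM) m0 hm hn hq.
rewrite -ltnS in hA; rewrite -ltnS in hB.
exists (\det M < 0, (Ordinal hA, Ordinal hB)) => //.
rewrite /f /= -[RHS]divq_num_den mulrA; congr (_ / _).
  by rewrite -numq_lt0 [in RHS](intEsign (numq _)) rmorphM rmorph_sign.
by rewrite -[in RHS](gez0_abs (denq_ge0 _)).
Qed.
End NormOfCyclotomicRatio.

(** * Plane vectors and the order of points around a direction *)

Section PlaneVectors.
Variable R : realType.
Implicit Types (u v x y z : R[i]).

(** As a function of [y], [det2 x y] is constant on each line in direction [x]; below it serves as
    the level of that line, and [dot2 x y] as the position on it. *)
Definition det2 x y : R := complex.Re x * complex.Im y - complex.Im x * complex.Re y.
Definition dot2 x y : R := complex.Re x * complex.Re y + complex.Im x * complex.Im y.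

Lemma det2N x y : det2 x y = - det2 y x.
Proof. by rewrite /det2; ring. Qed.

Lemma dot_det u x y :
  dot2 u u * det2 x y = dot2 u x * det2 u y - det2 u x * dot2 u y.
Proof. by rewrite /det2 /dot2; ring. Qed.

Lemma dot2_lin u x y (c d : R) :
  dot2 u (c%:C * x + d%:C * y) = c * dot2 u x + d * dot2 u y.
Proof. by move: u x y => [a1 a2] [b1 b2] [c1 c2]; rewrite /dot2 /=; ring. Qed.

Lemma det2_lin u x y (c d : R) :
  det2 u (c%:C * x + d%:C * y) = c * det2 u x + d * det2 u y.
Proof. by move: u x y => [a1 a2] [b1 b2] [c1 c2]; rewrite /det2 /=; ring. Qed.

Lemma det2Br x y z : det2 x (y - z) = det2 x y - det2 x z.
Proof. by move: x y z => [? ?] [? ?] [? ?]; rewrite /det2 /=; ring. Qed.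

Lemma dot2Br x y z : dot2 x (y - z) = dot2 x y - dot2 x z.
Proof. by move: x y z => [? ?] [? ?] [? ?]; rewrite /dot2 /=; ring. Qed.

Lemma det2Zl (c : R) x y : det2 (c%:C * x) y = c * det2 x y.
Proof. by move: x y => [? ?] [? ?]; rewrite /det2 /=; ring. Qed.

Lemma det2Zr (c : R) x y : det2 x (c%:C * y) = c * det2 x y.
Proof. by move: x y => [? ?] [? ?]; rewrite /det2 /=; ring. Qed.

Lemma det2xx x : det2 x x = 0.
Proof. by rewrite /det2; ring. Qed.

Lemma dot2_gt0 u : u != 0 -> 0 < dot2 u u.
Proof.
move: u => [a b]; rewrite eq_complex /= /dot2 /= => h.
rewrite -!expr2 lt_neqAle addr_ge0 ?sqr_ge0 // andbT eq_sym.
by rewrite paddr_eq0 ?sqr_ge0 // !sqrf_eq0.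
Qed.

Lemma dot_det_inj u x y : u != 0 -> dot2 u x = dot2 u y -> det2 u x = det2 u y -> x = y.
Proof.
move=> /dot2_gt0; move: u x y => [a b] [c d] [e f]; rewrite /dot2 /det2 /= => N0 h1 h2.
have N1 := lt0r_neq0 N0.
have h3 : (a * a + b * b) * (c - e) = 0.
  have -> : (a * a + b * b) * (c - e) =
    a * (a * c + b * d - (a * e + b * f)) - b * (a * d - b * c - (a * f - b * e)) by ring.
  by rewrite h1 h2 !subrr; ring.
have h4 : (a * a + b * b) * (d - f) = 0.
  have -> : (a * a + b * b) * (d - f) =
    b * (a * c + b * d - (a * e + b * f)) + a * (a * d - b * c - (a * f - b * e)) by ring.
  by rewrite h1 h2 !subrr; ring.
by move/eqP: h3; move/eqP: h4; rewrite !mulf_eq0 (negbTE N1) /= !subr_eq0 => /eqP-> /eqP->.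
Qed.

(* A piecewise rational substitute for the polar angle, with period 4. *)
Definition diamond_angle x : R :=
  let a := complex.Re x in let b := complex.Im x in
  if (0 < b) || (b == 0) && (0 < a) then 1 - a / (`|a| + `|b|)
  else 3 + a / (`|a| + `|b|).

(** The half-plane includes the positive real axis but not the negative one, so it contains exactly
    one of [x] and [- x] for nonzero [x]. *)
Definition upper x : bool :=
  (0 < complex.Im x) || (complex.Im x == 0) && (0 < complex.Re x).

Lemma upperN x : x != 0 -> upper (- x) = ~~ upper x.
Proof.
move: x => [a b]; rewrite /upper eq_complex /= oppr_gt0 oppr_eq0 oppr_gt0.
by case: (ltgtP b 0) => //= _; case: (ltgtP a 0).
Qed.

Lemma diamond_angleN x : x != 0 -> upper x -> diamond_angle (- x) = diamond_angle x + 2.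
Proof.
move=> x0 ux; rewrite /diamond_angle -!/(upper _) upperN // ux /=.
by move: x {x0 ux} => [a b] /=; rewrite !normrN; ring.
Qed.

Lemma diamond_angle_upper x : upper x -> 0 <= diamond_angle x < 2.
Proof.
move=> ux; rewrite /diamond_angle -/(upper x) ux; move: x ux => [a b]; rewrite /upper /= => ux.
have r0 : 0 < `|a| + `|b|.
  case/orP: ux => [b0|/andP[_ a0]]; first by rewrite ltr_wpDl // normr_gt0 gt_eqF.
  by rewrite ltr_wpDr // normr_gt0 gt_eqF.
have : a / (`|a| + `|b|) <= 1.
  by rewrite ler_pdivrMr // mul1r; have := ler_norm a; have := normr_ge0 b; lra.
have : -1 < a / (`|a| + `|b|).
  rewrite ltr_pdivlMr //; case/orP: ux => [b0|/andP[/eqP -> a0]].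
    by rewrite (gtr0_norm b0); have := ler_norm (- a); rewrite normrN; lra.
  by rewrite (gtr0_norm a0) normr0; lra.
lra.
Qed.

Lemma diamond_angle_lower x : x != 0 -> ~~ upper x -> 2 <= diamond_angle x < 4.
Proof.
move=> x0 ux; have := @diamond_angle_upper (- x); rewrite upperN // ux => /(_ isT).
have := @diamond_angleN (- x); rewrite oppr_eq0 upperN // opprK => /(_ x0 ux) ->.
lra.
Qed.

Lemma diamond_angle_range x : x != 0 -> 0 <= diamond_angle x < 4.
Proof.
move=> x0; have [/diamond_angle_upper|/(diamond_angle_lower x0)] := boolP (upper x); lra.
Qed.

(** The expression is the determinant of [(p, 1 - |p|)] and [(q, 1 - |q|)], two points on the upper
    half of the unit circle of the 1-norm, where the angle grows as the first coordinate
    decreases. *)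
Lemma diamond_det_sign (p q : R) : -1 < p <= 1 -> -1 < q <= 1 ->
  (0 < p * (1 - `|q|) - (1 - `|p|) * q) = (q < p).
Proof.
move=> /andP[p1 p2] /andP[q1 q2].
case: (ger0P p) => p0; case: (ger0P q) => q0.
- have -> : p * (1 - q) - (1 - p) * q = p - q by ring.
  by rewrite subr_gt0.
- have -> : q < p by lra.
  have : 0 <= p * (1 + q) by apply: mulr_ge0; lra.
  have : 0 <= - q * (1 - p) by apply: mulr_ge0; lra.
  have [p00|pp] := eqVneq p 0; first by rewrite p00; lra.
  have : 0 < p * (1 + q) by apply: mulr_gt0; lra.
  by rewrite opprK; lra.
- have -> : (q < p) = false by apply/negbTE; rewrite -leNgt; lra.
  have : 0 <= - p * (1 - q) by apply: mulr_ge0; lra.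
  have : 0 <= (1 + p) * q by apply: mulr_ge0; lra.
  by rewrite opprK => h1 h2; apply/negbTE; rewrite -leNgt; lra.
- have -> : p * (1 - - q) - (1 - - p) * q = p - q by ring.
  by rewrite subr_gt0.
Qed.

Lemma upper_coord x : upper x -> let r := `|complex.Re x| + `|complex.Im x| in
  [/\ 0 < r, complex.Im x = r * (1 - `|complex.Re x / r|)
    & -1 < complex.Re x / r <= 1].
Proof.
move: x => [a b] /=; rewrite /upper /= => ux.
have b0 : 0 <= b by case/orP: ux => [/ltW|/andP[/eqP->]].
rewrite (ger0_norm b0).
have r0 : 0 < `|a| + b.
  case/orP: ux => [b1|/andP[_ a0]]; first by rewrite ltr_wpDl.
  by rewrite ltr_wpDr // normr_gt0 gt_eqF.
split => //.
  rewrite normrM normfV (gtr0_norm r0) mulrBr mulr1 mulrCA divff ?gt_eqF // mulr1.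
  by ring.
rewrite ltr_pdivlMr // ler_pdivrMr // mul1r mulN1r.
apply/andP; split; last by rewrite (le_trans (ler_norm a)) // lerDl.
case/orP: ux => [b1|/andP[_ a0]]; last by rewrite (lt_trans _ a0) // oppr_lt0.
by have := ler_norm (- a); rewrite normrN; lra.
Qed.

Lemma diamond_angle_upper_lt x y : upper x -> upper y ->
  (diamond_angle x < diamond_angle y) = (0 < det2 x y).
Proof.
move=> ux uy; rewrite /diamond_angle -!/(upper _) ux uy /det2.
have /= [] := upper_coord ux; set rx := `|_| + _ => rx0 hx px.
have /= [] := upper_coord uy; set ry := `|complex.Re y| + _ => ry0 hy py.
rewrite -/rx -/ry.
have -> : complex.Re x * complex.Im y - complex.Im x * complex.Re y =
  rx * ry * (complex.Re x / rx * (1 - `|complex.Re y / ry|)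
             - (1 - `|complex.Re x / rx|) * (complex.Re y / ry)).
  have ex : complex.Re x = rx * (complex.Re x / rx) by rewrite mulrC divfK ?gt_eqF.
  have ey : complex.Re y = ry * (complex.Re y / ry) by rewrite mulrC divfK ?gt_eqF.
  rewrite hx hy; move: (complex.Re x / rx) (complex.Re y / ry) ex ey => p q -> ->.
  by ring.
by rewrite (pmulr_rgt0 _ (mulr_gt0 rx0 ry0)) diamond_det_sign // ltrD2l ltrN2.
Qed.

Lemma det2Nl x y : det2 (- x) y = - det2 x y.
Proof. by move: x y => [a b] [c d]; rewrite /det2 /=; ring. Qed.

Lemma det2Nr x y : det2 x (- y) = - det2 x y.
Proof. by move: x y => [a b] [c d]; rewrite /det2 /=; ring. Qed.

(** Negating the vectors in the lower half-plane reduces this to [diamond_angle_upper_lt]: each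
    negation shifts an angle by [2] and changes the sign of the determinant. The integer [n] is [1]
    if the turn from [x] to [y] crosses the positive real axis and [0] otherwise. *)
Lemma diamond_angle_det x y (n : int) : x != 0 -> y != 0 ->
  0 < diamond_angle y - diamond_angle x + 4 * n%:~R < 2 -> 0 < det2 x y.
Proof.
move=> x0 y0 h.
have n01 : n = 0 \/ n = 1.
  have n0 : (-1 : int)%:~R < (n%:~R : R).
    by have := diamond_angle_range x0; have := diamond_angle_range y0; lra.
  have n1 : (n%:~R : R) < (2 : int)%:~R.
    by have := diamond_angle_range x0; have := diamond_angle_range y0; lra.
  by move: n0 n1; rewrite !ltr_int; lia.
have xN0 : - x != 0 by rewrite oppr_eq0.
have yN0 : - y != 0 by rewrite oppr_eq0.
have dx := diamond_angleN x0; have dy := diamond_angleN y0.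
have dx' := diamond_angleN xN0; have dy' := diamond_angleN yN0.
rewrite !upperN // !opprK in dx' dy'.
have [ux|ux] := boolP (upper x); have [uy|uy] := boolP (upper y).
- have := diamond_angle_upper ux; have := diamond_angle_upper uy.
  by rewrite -diamond_angle_upper_lt //; case: n01 h => ->; lra.
- have := diamond_angle_upper ux; have := diamond_angle_lower y0 uy.
  have : upper (- y) by rewrite upperN.
  rewrite -oppr_lt0 -det2Nr det2N oppr_lt0 => uy'.
  by rewrite -diamond_angle_upper_lt //; have := dy' uy; case: n01 h => ->; lra.
- have := diamond_angle_upper uy; have := diamond_angle_lower x0 ux.
  have : upper (- x) by rewrite upperN.
  rewrite -oppr_lt0 -det2Nl det2N oppr_lt0 => ux'.
  by rewrite -diamond_angle_upper_lt //; have := dx' ux; case: n01 h => ->; lra.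
- have := diamond_angle_lower y0 uy; have := diamond_angle_lower x0 ux.
  have ux' : upper (- x) by rewrite upperN.
  have uy' : upper (- y) by rewrite upperN.
  rewrite -[det2 x y]opprK -det2Nl -det2Nr -diamond_angle_upper_lt //.
  by have := dx' ux; have := dy' uy; case: n01 h => ->; lra.
Qed.

Lemma scale_complex (c : R) x y : complex.Re y = c * complex.Re x ->
  complex.Im y = c * complex.Im x -> y = c%:C * x.
Proof. by move: x y => [a b] [d e] /= -> ->; simpc. Qed.

Lemma diamond_angle_eq x y : x != 0 -> y != 0 -> diamond_angle x = diamond_angle y ->
  exists2 c : R, 0 < c & y = c%:C * x.
Proof.
have main a b : upper a -> upper b -> diamond_angle a = diamond_angle b ->
    exists2 c : R, 0 < c & b = c%:C * a.
  move=> ua ub e.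
  have /= [ra ha pa] := upper_coord ua; have /= [rb hb pb] := upper_coord ub.
  move: e; rewrite /diamond_angle -!/(upper _) ua ub => /addrI/oppr_inj e.
  rewrite -e in hb.
  set s := `|_| + _ in ra ha pa e hb *; set t := `|complex.Re b| + _ in rb hb pb e *.
  exists (t / s); first by rewrite divr_gt0.
  have eb : complex.Re b = t / s * complex.Re a.
    by rewrite -[LHS](divfK (lt0r_neq0 rb)) -e; ring.
  have eb' : complex.Im b = t / s * complex.Im a.
    by rewrite ha hb mulrA divfK ?gt_eqF.
  exact: scale_complex.
move=> x0 y0 e.
have [ux|ux] := boolP (upper x); have [uy|uy] := boolP (upper y).
- exact: main.
- by have := diamond_angle_upper ux; have := diamond_angle_lower y0 uy; lra.
- by have := diamond_angle_upper uy; have := diamond_angle_lower x0 ux; lra.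
have ux' : upper (- x) by rewrite upperN.
have uy' : upper (- y) by rewrite upperN.
have xN0 : - x != 0 by rewrite oppr_eq0.
have yN0 : - y != 0 by rewrite oppr_eq0.
have e' : diamond_angle (- x) = diamond_angle (- y).
  have := diamond_angleN xN0 ux'; have := diamond_angleN yN0 uy'.
  by rewrite !opprK; lra.
have [c c0 hc] := main _ _ ux' uy' e'.
by exists c => //; rewrite -[y]opprK hc mulrN opprK.
Qed.
End PlaneVectors.

Definition cconvex (R : realType) (P : set R[i]) : Prop :=
  forall x y (t : R), P x -> P y -> 0 <= t <= 1 -> P (t%:C * x + (1 - t)%:C * y).

Lemma quotient_le1 (R : realFieldType) (a b : R) : 0 <= a <= b -> 0 < b -> 0 <= a / b <= 1.
Proof.
by move=> /andP[a0 ab] b0; rewrite ler_pdivrMr // mul1r ab divr_ge0 // ltW.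
Qed.

Lemma int_small (R : realDomainType) (k : int) : -1 < (k%:~R : R) < 1 -> k = 0.
Proof. by rewrite (ltr_int R (-1) k) (ltr_int R k 1); lia. Qed.

(** * Two convex sets around 0 and points of just one of them, matched along lines in direction
    [u] *)

Section DirectionOrder.
Variables (R : realType) (I : finType) (pt : I -> R[i]) (s : I -> bool).
Variable P : bool -> set R[i].
Hypothesis Pconvex : forall b, cconvex (P b).
Hypothesis P0 : forall b, P b 0.
Hypothesis ptP : forall i, P (s i) (pt i).
Hypothesis ptN : forall i, ~ P (~~ s i) (pt i).
Variables (u : R[i]) (p : I -> I).
Hypothesis u0 : u != 0.
Hypothesis pK : involutive p.
Hypothesis ps : forall i, s (p i) = ~~ s i.
Hypothesis ph : forall i, det2 u (pt (p i)) = det2 u (pt i).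

Local Notation w i := (dot2 u (pt i)).
Local Notation h i := (det2 u (pt i)).

Lemma ptP_opp i j : s i != s j -> P (~~ s i) (pt j).
Proof. by move=> ij; have := ptP j; rewrite (_ : s j = ~~ s i) //; case: (s i) (s j) ij => [] []. Qed.

(** Otherwise [pt i] would lie on the segment from [a] to [b], hence in the convex set that omits
    it. *)
Lemma between_notin i a b : P (~~ s i) a -> P (~~ s i) b ->
  det2 u a = h i -> det2 u b = h i -> 0 < (w i - dot2 u a) * (w i - dot2 u b).
Proof.
move=> Pa Pb ha hb; rewrite ltNge; apply/negP => le0; apply: (@ptN i).
have [ab|ab] := eqVneq (dot2 u a) (dot2 u b).
  have ia : dot2 u a = w i.
    by move: le0; rewrite -ab -expr2 => le0; apply/eqP; rewrite -subr_eq0 -sqrf_eq0 -oppr_eq0;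
       apply/eqP; have := sqr_ge0 (w i - dot2 u a); rewrite -sqrrN opprB; lra.
  by rewrite -(dot_det_inj u0 ia ha).
pose t := (w i - dot2 u b) / (dot2 u a - dot2 u b).
have d0 : dot2 u a - dot2 u b != 0 by rewrite subr_eq0.
have t01 : 0 <= t <= 1.
  have e : 0 < (dot2 u a - dot2 u b) ^+ 2 by rewrite exprn_even_gt0.
  have -> : t = (w i - dot2 u b) * (dot2 u a - dot2 u b) / (dot2 u a - dot2 u b) ^+ 2.
    by rewrite /t; field.
  by apply: quotient_le1 => //; nra.
have -> : pt i = t%:C * a + (1 - t)%:C * b; last exact: Pconvex.
apply: (dot_det_inj u0); last by rewrite det2_lin ha hb; ring.
by rewrite dot2_lin /t; field.
Qed.

Lemma partner_neq i : w (p i) != w i.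
Proof.
apply/eqP => wi; apply: (@ptN i).
by rewrite -(dot_det_inj u0 wi (ph i)) -ps.
Qed.

Lemma scale_opp i j (c : R) : s i != s j -> 0 <= c <= 1 -> P (~~ s i) (c%:C * pt j).
Proof.
move=> ij c01; have := @Pconvex (~~ s i) (pt j) 0 c (ptP_opp ij) (@P0 _) c01.
by rewrite mulr0 addr0.
Qed.

(* The triangle spanned by 0, the partner of [pt i] and [pt j] misses [pt i]. *)
Lemma triangle_sign i j : s i != s j -> h i != 0 -> h i ^+ 2 <= h i * h j ->
  0 < (w i - w (p i)) * h i * det2 (pt i) (pt j).
Proof.
move=> ij hi0 hij.
have hj0 : h j != 0.
  by apply: contraTneq hij => ->; rewrite mulr0 -ltNge exprn_even_gt0.
have hh : 0 < h i * h j by apply: lt_le_trans hij; rewrite exprn_even_gt0.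
pose c := h i / h j.
have c01 : 0 <= c <= 1.
  have -> : c = h i ^+ 2 / (h i * h j) by rewrite /c; field; rewrite hi0 hj0.
  by apply: quotient_le1 => //; rewrite sqr_ge0.
have Pp : P (~~ s i) (pt (p i)) by apply: ptP_opp; rewrite ps; case: (s i).
have Pj := scale_opp ij c01.
have e0 : c%:C * pt j = c%:C * pt j + 0%:C * pt j by rewrite mul0r addr0.
have := between_notin Pp Pj (ph i).
rewrite e0 det2_lin dot2_lin !mul0r !addr0 => /(_ _).
rewrite {1}/c divfK // => /(_ erefl).
have N0 := dot2_gt0 u0; have dd := dot_det u (pt i) (pt j).
have {}dd : dot2 u u * det2 (pt i) (pt j) = h j * (w i - c * w j).
  by rewrite dd /c; field.
move=> H; rewrite -(pmulr_rgt0 _ N0).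
have -> : dot2 u u * ((w i - w (p i)) * h i * det2 (pt i) (pt j)) =
  (h i * h j) * ((w i - w (p i)) * (w i - c * w j)).
  by rewrite mulrCA dd; ring.
exact: mulr_gt0.
Qed.

Definition right_side i := w (p i) < w i.

Lemma right_partner i : right_side (p i) = ~~ right_side i.
Proof. by rewrite /right_side pK -leNgt le_eqVlt eq_sym (negbTE (partner_neq i)). Qed.

Lemma partner_opp i : s i != s (p i).
Proof. by rewrite ps; case: (s i). Qed.

(** The origin and the partner both lie in the set that omits [pt i]. So on the line through the
    origin a right point has positive and a left point negative position; this keeps right points
    off the lifted angle [-2] and left points off [0]. *)
Lemma level0_sign i : h i = 0 -> 0 < (w i - w (p i)) * w i.
Proof.
move=> hi; have := @between_notin i (pt (p i)) 0 (ptP_opp (partner_opp i)) (@P0 _) (ph i).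
have -> : det2 u 0 = 0 by rewrite /det2 /=; ring.
have -> : dot2 u 0 = 0 by rewrite /dot2 /=; ring.
by rewrite hi subr0; apply.
Qed.

(** On a common line, [pt j] and the partner of [pt i] lie in the set that omits [pt i], hence on
    the same side of it, and conversely; each of the two points would be beyond the other. *)
Lemma same_side_level i j : s i != s j -> right_side i = right_side j -> h i != h j.
Proof.
move=> ij rij; apply/eqP => hij.
have si : s (p j) = s i by rewrite ps; case: (s i) (s j) ij => [] [].
have sj : s (p i) = s j by rewrite ps; case: (s i) (s j) ij => [] [].
have := @between_notin i (pt (p i)) (pt j) (ptP_opp (partner_opp i)) (ptP_opp ij) (ph i) (esym hij).
have ji : s j != s i by rewrite eq_sym.
have := @between_notin j (pt (p j)) (pt i) (ptP_opp (partner_opp j)) (ptP_opp ji) (ph j) hij.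
move: rij; rewrite /right_side; have := partner_neq i; have := partner_neq j.
by case: (ltgtP (w (p i)) (w i)) => //; case: (ltgtP (w (p j)) (w j)) => // *; nra.
Qed.

(** On a common line, both partners would lie strictly between [pt j] and [pt i], which belong to
    the set that omits the partners. *)
Lemma opposite_side_level i j : s i = s j -> right_side i -> ~~ right_side j -> h i != h j.
Proof.
move=> ij ri rj; apply/eqP => hij.
have ipj : s i != s (p j) by rewrite ij partner_opp.
have jpi : s j != s (p i) by rewrite -ij partner_opp.
have hji : h (p j) = h i by rewrite ph.
have := @between_notin i (pt (p i)) (pt (p j)) (ptP_opp (partner_opp i)) (ptP_opp ipj) (ph i) hji.
have hij' : h (p i) = h j by rewrite ph.
have := @between_notin j (pt (p j)) (pt (p i)) (ptP_opp (partner_opp j)) (ptP_opp jpi) (ph j) hij'.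
have pip : s (p i) != s i by rewrite eq_sym partner_opp.
have pij : s (p i) != s j by rewrite eq_sym.
have e1 : det2 u (pt i) = h (p i) by rewrite ph.
have e2 : det2 u (pt j) = h (p i) by rewrite ph.
have := between_notin (ptP_opp pip) (ptP_opp pij) e1 e2.
have pjp : s (p j) != s j by rewrite eq_sym partner_opp.
have pji : s (p j) != s i by rewrite eq_sym.
have e3 : det2 u (pt j) = h (p j) by rewrite ph.
have e4 : det2 u (pt i) = h (p j) by rewrite ph.
have := between_notin (ptP_opp pjp) (ptP_opp pji) e3 e4.
move: ri rj; rewrite /right_side -leNgt; nra.
Qed.

(** The segment from [pt i] to [pt k] meets the line of [pt j] in a point of the set that omits
    [pt j], so [pt j] is on the same side of this point as of its partner. The path therefore turns
    left at a right point passed upwards and at a left point passed downwards. *)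
Lemma turn_sign i j k : s i = s k -> s i != s j ->
  0 < (h j - h i) * (h k - h j) ->
  0 < (w j - w (p j)) * (h k - h i) * det2 (pt j - pt i) (pt k - pt j).
Proof.
move=> ik ij hijk.
have ji : s j != s i by rewrite eq_sym.
have jk : s j != s k by rewrite -ik.
pose c := (h k - h j) / (h k - h i).
have d0 : h k - h i != 0.
  apply: contraTneq hijk => d; rewrite -leNgt.
  have -> : h k = h i by lra.
  by have := sqr_ge0 (h j - h i); nra.
have e : (h k - h i) ^+ 2 > 0 by rewrite exprn_even_gt0.
have c01 : 0 <= c <= 1.
  have -> : c = (h k - h j) * (h k - h i) / (h k - h i) ^+ 2 by rewrite /c; field.
  by apply: quotient_le1 => //; nra.
have Pc := Pconvex (ptP_opp ji) (ptP_opp jk) c01.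
have := between_notin (ptP_opp (partner_opp j)) Pc (ph j) _.
rewrite det2_lin dot2_lin => /(_ _) H.
have {}H := H ltac:(by rewrite /c; field).
have N0 := dot2_gt0 u0; rewrite -(pmulr_rgt0 _ N0).
have dd := dot_det u (pt j - pt i) (pt k - pt j).
rewrite mulrCA dd !dot2Br !det2Br.
have -> : (w j - w (p j)) * (h k - h i) *
  ((w j - w i) * (h k - h j) - (h j - h i) * (w k - w j)) =
  (h k - h i) ^+ 2 * ((w j - w (p j)) * (w j - (c * w i + (1 - c) * w k))).
  by rewrite /c; field.
exact: mulr_gt0.
Qed.

Lemma pt_neq0 i : pt i != 0.
Proof. by apply/eqP => pi0; apply: (@ptN i); rewrite pi0; exact: P0. Qed.

Definition rel_angle i : R := diamond_angle (pt i) - diamond_angle u.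

(* Chosen so that the lifted angle of points on the right lies in (-2, 2) and that
   of points on the left in (0, 4), measured from [u] in units of right angles. *)
Definition angle_lift i : int :=
  if right_side i then
    if rel_angle i < -2 then 1 else if rel_angle i < 2 then 0 else -1
  else if rel_angle i < 0 then 1 else 0.

Definition lifted_angle i : R := rel_angle i + 4 * (angle_lift i)%:~R.

Lemma lifted_angle_det i j (n : int) :
  0 < lifted_angle j - lifted_angle i + 4 * n%:~R < 2 -> 0 < det2 (pt i) (pt j).
Proof.
move=> H; apply: (@diamond_angle_det _ _ _ (angle_lift j - angle_lift i + n)); try exact: pt_neq0.
by move: H; rewrite /lifted_angle /rel_angle !rmorphD rmorphN /=; lra.
Qed.

Lemma lifted_angle_det0 i j (n : int) :
  lifted_angle j - lifted_angle i + 4 * n%:~R = 0 -> det2 (pt i) (pt j) = 0.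
Proof.
rewrite /lifted_angle /rel_angle => H.
have [ri rj] := (diamond_angle_range (pt_neq0 i), diamond_angle_range (pt_neq0 j)).
have e : angle_lift j - angle_lift i + n = 0.
  by apply: (@int_small R); rewrite !rmorphD rmorphN /=; lra.
have e' : ((angle_lift j - angle_lift i + n)%:~R : R) = 0 by rewrite e.
have [|c c0 ->] := diamond_angle_eq (pt_neq0 i) (pt_neq0 j).
  by move: e' H; rewrite !rmorphD rmorphN /=; lra.
by move: (pt i) => [a b]; rewrite /det2 /=; ring.
Qed.

Lemma lifted_angle_cmp i j (n : int) : -2 < lifted_angle j - lifted_angle i + 4 * n%:~R < 2 ->
  (0 < det2 (pt i) (pt j) -> 0 < lifted_angle j - lifted_angle i + 4 * n%:~R) /\
  (det2 (pt i) (pt j) < 0 -> lifted_angle j - lifted_angle i + 4 * n%:~R < 0).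
Proof.
move=> H; have := @lifted_angle_det i j n; have := @lifted_angle_det0 i j n.
have := @lifted_angle_det j i (- n); rewrite (det2N (pt j)) rmorphN /=.
move: H; set t := lifted_angle j - lifted_angle i + 4 * n%:~R => H.
have -> : lifted_angle i - lifted_angle j + 4 * - n%:~R = - t by rewrite /t; ring.
move=> h1 h2 h3; split => d; rewrite ltNge; apply/negP => le.
  move: le; rewrite le_eqVlt => /orP[/eqP/h2 e|lt]; first by rewrite e ltxx in d.
  have : 0 < - det2 (pt i) (pt j) by apply: h1; lra.
  lra.
move: le; rewrite le_eqVlt => /orP[/eqP/esym/h2 e|lt]; first by rewrite e ltxx in d.
have : 0 < det2 (pt i) (pt j) by apply: h3; lra.
lra.
Qed.

Lemma lifted_angle_sign i (n : int) :
  [/\ 0 < lifted_angle i + 4 * n%:~R < 2 -> 0 < h i,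
      -2 < lifted_angle i + 4 * n%:~R < 0 -> h i < 0,
      lifted_angle i + 4 * n%:~R = 0 -> h i = 0 /\ 0 < w i
    & lifted_angle i + 4 * n%:~R = 2 -> h i = 0 /\ w i < 0].
Proof.
have x0 := pt_neq0 i; rewrite /lifted_angle.
set t := _ + _ + _; have et : t = diamond_angle (pt i) - diamond_angle u + 4 * (angle_lift i + n)%:~R.
  by rewrite /t /rel_angle rmorphD /=; ring.
have ru := diamond_angle_range u0; have ri := diamond_angle_range x0.
have uN0 : - u != 0 by rewrite oppr_eq0.
have ruN := diamond_angle_range uN0.
have N0 := dot2_gt0 u0.
have uN : exists k : int, diamond_angle (- u) = diamond_angle u + 2 - 4 * k%:~R.
  have [uu|uu] := boolP (upper u); first by exists 0; rewrite diamond_angleN //; ring.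
  have := diamond_angleN uN0; rewrite upperN // opprK => /(_ uu) e.
  by exists 1; rewrite e; ring.
move: (angle_lift i + n) et => m et.
have int0 (k : int) (a b : R) : 0 <= a < 4 -> 0 <= b < 4 -> a - b + 4 * k%:~R = 0 -> a = b.
  move=> ra rb e; have k0 : k = 0 by apply: (@int_small R); lra.
  by rewrite k0 in e; lra.
split => ht.
- by apply: (@diamond_angle_det _ _ _ m) => //; rewrite -et.
- rewrite det2N oppr_lt0; apply: (@diamond_angle_det _ _ _ (- m)) => //.
  by rewrite rmorphN /=; lra.
- have e := int0 m _ _ ri ru ltac:(lra).
  have [c c0 ->] := diamond_angle_eq u0 x0 (esym e).
  move: N0; rewrite /det2 /dot2; case: (u) => a b /=; split; first by ring.
  nra.
- have [k hk] := uN.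
  have e := int0 (m - k) _ _ ri ruN ltac:(by rewrite rmorphB /=; lra).
  have [c c0 ->] := diamond_angle_eq uN0 x0 (esym e).
  move: N0; rewrite /det2 /dot2; case: (u) => a b /=; split; first by ring.
  nra.
Qed.

Lemma lifted_angle_right i : right_side i ->
  [\/ 0 < lifted_angle i < 2 /\ 0 < h i, lifted_angle i = 0 /\ h i = 0
    | -2 < lifted_angle i < 0 /\ h i < 0].
Proof.
move=> ri; have [h1 h2 h3 _] := lifted_angle_sign i 0.
have [_ _ _ h4] := lifted_angle_sign i 1.
rewrite !mulr0 !addr0 in h1 h2 h3; rewrite mulr1 in h4.
have r : -2 <= lifted_angle i < 2.
  rewrite /lifted_angle /angle_lift ri /rel_angle.
  have ru := diamond_angle_range u0; have rx := diamond_angle_range (pt_neq0 i).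
  case: ltP => [l1|l1]; [|case: ltP => [l2|l2]]; rewrite ?mulrN1z ?mulr1z ?mulr0z; lra.
have [e|ne] := eqVneq (lifted_angle i) (-2).
  have [hi wi] := h4 ltac:(lra).
  by have := level0_sign hi; move: ri; rewrite /right_side; nra.
have [lt|[gt|e]] : lifted_angle i < 0 \/ 0 < lifted_angle i \/ lifted_angle i = 0.
  by case: ltgtP; auto.
- have r' : -2 < lifted_angle i < 0.
    by rewrite lt andbT lt_neqAle eq_sym ne; case/andP: r.
  exact: Or33 (conj r' (h2 r')).
- have r' : 0 < lifted_angle i < 2 by rewrite gt; case/andP: r => _ ->.
  exact: Or31 (conj r' (h1 r')).
by apply: Or32; split => //; case: (h3 e).
Qed.

Lemma lifted_angle_left i : ~~ right_side i ->
  [\/ 0 < lifted_angle i < 2 /\ 0 < h i, lifted_angle i = 2 /\ h i = 0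
    | 2 < lifted_angle i < 4 /\ h i < 0].
Proof.
move=> ri; have [h1 _ h3 h4] := lifted_angle_sign i 0.
have [_ h2 _ _] := lifted_angle_sign i (-1).
rewrite !mulr0 !addr0 in h1 h3 h4; rewrite mulrN1z mulrN1 in h2.
have r : 0 <= lifted_angle i < 4.
  rewrite /lifted_angle /angle_lift (negbTE ri) /rel_angle.
  have ru := diamond_angle_range u0; have rx := diamond_angle_range (pt_neq0 i).
  by case: ltP => [l1|l1]; rewrite ?mulr1z ?mulr0z; lra.
have [e|ne] := eqVneq (lifted_angle i) 0.
  have [hi wi] := h3 e.
  by have := level0_sign hi; move: ri; rewrite /right_side -leNgt; nra.
have gt0 : 0 < lifted_angle i by rewrite lt_neqAle eq_sym ne; case/andP: r.
have [lt|[gt|e]] : lifted_angle i < 2 \/ 2 < lifted_angle i \/ lifted_angle i = 2.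
  by case: ltgtP; auto.
- have r' : 0 < lifted_angle i < 2 by rewrite gt0 lt.
  exact: Or31 (conj r' (h1 r')).
- have r' : 2 < lifted_angle i < 4 by rewrite gt; case/andP: r => _ ->.
  apply: Or33; split => //; apply: h2; lra.
by apply: Or32; split => //; case: (h4 e).
Qed.

Lemma sqr_le_mul_pos (a b : R) : 0 < a -> a <= b -> a ^+ 2 <= a * b.
Proof. by move=> a0 ab; rewrite expr2 ler_pM2l. Qed.

Lemma sqr_le_mul_neg (a b : R) : a < 0 -> b <= a -> a ^+ 2 <= a * b.
Proof. by move=> a0 ab; rewrite expr2 ler_nM2l. Qed.

(** If the levels are not of the same sign, the ranges of the angles decide. Otherwise
    [triangle_sign], applied to the point of smaller absolute level, gives the sign of the
    determinant and hence the order of the angles. *)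
Lemma right_right i j : s i != s j -> right_side i -> right_side j -> h i < h j ->
  lifted_angle i < lifted_angle j.
Proof.
move=> ij ri rj hij; have ji : s j != s i by rewrite eq_sym.
have wi : 0 < w i - w (p i) by rewrite subr_gt0.
have wj : 0 < w j - w (p j) by rewrite subr_gt0.
have := lifted_angle_cmp (i := i) (j := j) (n := 0).
rewrite mulr0 addr0.
case: (lifted_angle_right ri) => -[ti hi]; case: (lifted_angle_right rj) => -[tj hj] H; try lra.
- have [|H1 _] := H; first lra.
  have T := triangle_sign ij (lt0r_neq0 hi) (sqr_le_mul_pos hi (ltW hij)).
  have : 0 < det2 (pt i) (pt j) by rewrite (pmulr_rgt0 _ (mulr_gt0 wi hi)) in T.
  by move/H1; rewrite subr_gt0.
- have [|H1 _] := H; first lra.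
  have T := triangle_sign ji (ltr0_neq0 hj) (sqr_le_mul_neg hj (ltW hij)).
  have : 0 < det2 (pt i) (pt j).
    rewrite det2N oppr_gt0 -(nmulr_rgt0 _ (_ : (w j - w (p j)) * h j < 0)) //.
    by rewrite pmulr_rlt0.
  by move/H1; rewrite subr_gt0.
Qed.

Lemma left_left i j : s i != s j -> ~~ right_side i -> ~~ right_side j -> h i < h j ->
  lifted_angle j < lifted_angle i.
Proof.
move=> ij ri rj hij; have ji : s j != s i by rewrite eq_sym.
have wi : w i - w (p i) < 0 by rewrite subr_lt0 lt_neqAle eq_sym partner_neq leNgt.
have wj : w j - w (p j) < 0 by rewrite subr_lt0 lt_neqAle eq_sym partner_neq leNgt.
have := lifted_angle_cmp (i := i) (j := j) (n := 0).
rewrite mulr0 addr0.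
case: (lifted_angle_left ri) => -[ti hi]; case: (lifted_angle_left rj) => -[tj hj] H; try lra.
- have [|_ H1] := H; first lra.
  have T := triangle_sign ij (lt0r_neq0 hi) (sqr_le_mul_pos hi (ltW hij)).
  have : det2 (pt i) (pt j) < 0.
    rewrite -(nmulr_rgt0 _ (_ : (w i - w (p i)) * h i < 0)) //.
    by rewrite nmulr_rlt0.
  by move/H1; rewrite subr_lt0.
- have [|_ H1] := H; first lra.
  have T := triangle_sign ji (ltr0_neq0 hj) (sqr_le_mul_neg hj (ltW hij)).
  have : det2 (pt i) (pt j) < 0.
    rewrite det2N oppr_lt0.
    by rewrite (pmulr_rgt0 _ (_ : 0 < (w j - w (p j)) * h j)) // in T; rewrite nmulr_rgt0.
  by move/H1; rewrite subr_lt0.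
Qed.

Lemma right_left i j : s i != s j -> right_side i -> ~~ right_side j ->
  lifted_angle i < lifted_angle j < lifted_angle i + 4.
Proof.
move=> ij ri rj; have ji : s j != s i by rewrite eq_sym.
have wi : 0 < w i - w (p i) by rewrite subr_gt0.
have wj : w j - w (p j) < 0 by rewrite subr_lt0 lt_neqAle eq_sym partner_neq leNgt.
have := lifted_angle_cmp (i := i) (j := j) (n := 0).
have := lifted_angle_cmp (i := i) (j := j) (n := -1).
rewrite mulr0 addr0 mulrN1z mulrN1.
case: (lifted_angle_right ri) => -[ti hi]; case: (lifted_angle_left rj) => -[tj hj] H H'; try lra.
- have [|H1 _] := H'; first lra.
  have : 0 < det2 (pt i) (pt j).
    have [le|lt] := lerP (h i) (h j).
      have T := triangle_sign ij (lt0r_neq0 hi) (sqr_le_mul_pos hi le).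
      by rewrite (pmulr_rgt0 _ (mulr_gt0 wi hi)) in T.
    have T := triangle_sign ji (lt0r_neq0 hj) (sqr_le_mul_pos hj (ltW lt)).
    rewrite det2N oppr_gt0 -(nmulr_rgt0 _ (_ : (w j - w (p j)) * h j < 0)) //.
    by rewrite nmulr_rlt0.
  by move/H1; lra.
- have [|_ H1] := H; first lra.
  have : det2 (pt i) (pt j) < 0.
    have [le|lt] := lerP (h j) (h i).
      have T := triangle_sign ij (ltr0_neq0 hi) (sqr_le_mul_neg hi le).
      rewrite -(nmulr_rgt0 _ (_ : (w i - w (p i)) * h i < 0)) //.
      by rewrite pmulr_rlt0.
    have T := triangle_sign ji (ltr0_neq0 hj) (sqr_le_mul_neg hj (ltW lt)).
    rewrite det2N oppr_lt0.
    by rewrite (pmulr_rgt0 _ (_ : 0 < (w j - w (p j)) * h j)) // in T; rewrite nmulr_rgt0.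
  by move/H1; lra.
Qed.

(** The critical case is a right point [i] and a left point [j] of the same sign, which no triangle
    compares directly. Their levels differ by [opposite_side_level], and the partner of the lower
    point, shifted by a turn if necessary, comes between [j] and the next turn of [i]. *)
Lemma lifted_angle_window i j : lifted_angle j < lifted_angle i + 4.
Proof.
have lt4 : lifted_angle j < 4.
  have [rj|rj] := boolP (right_side j).
    by case: (lifted_angle_right rj) => -[tj _]; lra.
  by case: (lifted_angle_left rj) => -[tj _]; lra.
have [ri|ri] := boolP (right_side i); last first.
  by case: (lifted_angle_left ri) => -[ti _]; lra.
have [rj|rj] := boolP (right_side j).
  by case: (lifted_angle_right ri) => -[ti _]; case: (lifted_angle_right rj) => -[tj _]; lra.
have [ij|ij] := eqVneq (s i) (s j); last by case/andP: (right_left ij ri rj).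
have : h i != h j by exact: opposite_side_level.
rewrite neq_lt => /orP[hij|hij].
- have rpi : ~~ right_side (p i) by rewrite right_partner ri.
  have pij : s (p i) != s j by rewrite -ij eq_sym partner_opp.
  have h1 := left_left pij rpi rj ltac:(by rewrite ph).
  by have /andP[] := right_left (partner_opp i) ri rpi; lra.
- have rpj : right_side (p j) by rewrite right_partner.
  have pji : s (p j) != s i by rewrite ij eq_sym partner_opp.
  have h1 := right_right pji rpj ri ltac:(by rewrite ph).
  have jpj : s (p j) != s j by rewrite eq_sym partner_opp.
  by have /andP[] := right_left jpj rpj rj; lra.
Qed.

(** A partner is on the other side at the same level, and for opposite signs the angle grows with
    the level on the right and falls with it on the left. *)
Lemma partner_reverses i j : s i != s j -> lifted_angle i < lifted_angle j ->
  lifted_angle (p j) < lifted_angle (p i).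
Proof.
move=> ij lij.
have pij : s (p i) != s (p j) by rewrite !ps; case: (s i) (s j) ij => [] [].
have pji : s (p j) != s (p i) by rewrite eq_sym.
have ji : s j != s i by rewrite eq_sym.
have [ri|ri] := boolP (right_side i); have [rj|rj] := boolP (right_side j).
- have : h i != h j by apply: same_side_level => //; rewrite ri rj.
  rewrite neq_lt => /orP[hij|hij]; last by have := right_right ji rj ri hij; lra.
  by apply: left_left; rewrite ?right_partner ?ri ?rj ?ph.
- have rpj : right_side (p j) by rewrite right_partner.
  have rpi : ~~ right_side (p i) by rewrite right_partner ri.
  by have /andP[] := right_left pji rpj rpi.
- by have /andP[] := right_left ji rj ri; lra.
have : h i != h j by apply: same_side_level => //; rewrite (negbTE ri) (negbTE rj).
rewrite neq_lt => /orP[hij|hij]; first by have := left_left ij ri rj hij; lra.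
by apply: right_right; rewrite ?right_partner ?ri ?rj ?ph.
Qed.

Lemma right_side_lt i : right_side i = (lifted_angle i < lifted_angle (p i)).
Proof.
have [ri|ri] := boolP (right_side i).
  by have /andP[->] := right_left (partner_opp i) ri ltac:(by rewrite right_partner ri).
have rpi : right_side (p i) by rewrite right_partner.
have pii : s (p i) != s i by rewrite eq_sym partner_opp.
by have /andP[lt _] := right_left pii rpi ri; rewrite ltNge ltW.
Qed.

Lemma side_level i j : s i != s j -> right_side i = right_side j ->
  lifted_angle i < lifted_angle j -> if right_side i then h i < h j else h j < h i.
Proof.
move=> ij rij lij; have ji : s j != s i by rewrite eq_sym.
have := same_side_level ij rij; rewrite neq_lt.
have [ri|ri] := boolP (right_side i) => /orP[] // hij.
  by have := right_right ji ltac:(by rewrite -rij) ri hij; lra.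
by have := left_left ij ri ltac:(by rewrite -rij) hij; lra.
Qed.

End DirectionOrder.

(** * Blocks of equal sign *)

(** [rho] numbers the maximal runs of constant sign in the order of the keys. The induction adds a
    point of largest key, which continues the last run or opens a new one. *)
Lemma sign_change_rank (R : realDomainType) (I : finType) (key : I -> R) (s : I -> bool) :
  (forall i j, key i = key j -> s i = s j) ->
  exists rho : I -> nat,
  [/\ forall i j, key i <= key j -> (rho i <= rho j)%N,
      forall i j, odd (rho i) (+) odd (rho j) = s i (+) s j
    & forall i k, (k <= rho i)%N -> exists j, rho j = k].
Proof.
move=> ks.
suff H (A : {set I}) : exists rho : I -> nat,
  [/\ {in A &, forall i j, key i <= key j -> (rho i <= rho j)%N},
      {in A &, forall i j, odd (rho i) (+) odd (rho j) = s i (+) s j}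
    & {in A, forall i k, (k <= rho i)%N -> exists2 j, j \in A & rho j = k}].
  have [rho [h1 h2 h3]] := H [set: I]%SET.
  exists rho; split=> [i j|i j|i k /(h3 i (finset.in_setT i))[j _]]; first exact: h1.
    exact: h2.
  by exists j.
elim: {A}#|A| {-2}A (erefl #|A|) => [|n IH] A cA.
  exists (fun=> 0%N); have A0 : A = finset.set0 by apply/eqP; rewrite -cards_eq0 cA.
  by split=> i; rewrite A0 finset.in_set0.
have [a0 a0A] : exists a, a \in A by apply/finset.set0Pn; rewrite -card_gt0 cA.
have [m mA mmax] : exists2 m, m \in A & forall i, i \in A -> key i <= key m.
  by case: (@Order.TotalTheory.arg_maxP _ _ _ a0 (mem A) key a0A) => m; exists m.
have cB : #|(A :\ m)%SET| = n by move: cA; rewrite (cardsD1 m A) mA add1n => -[].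
have [rho [h1 h2 h3]] := IH _ cB.
have [B0|/finset.set0Pn[b0 b0B]] := eqVneq (A :\ m)%SET finset.set0.
  have Am i : i \in A -> i = m.
    by move=> iA; apply/eqP; have := finset.in_set0 i; rewrite -B0 !inE iA andbT => /negbFE.
  exists (fun=> 0%N); split=> [//|i j /Am -> /Am ->|i _ k]; first by rewrite !addbb.
  by rewrite leqn0 => /eqP ->; exists m.
have [b bB bmax] : exists2 b, b \in (A :\ m)%SET & forall i, i \in (A :\ m)%SET -> key i <= key b.
  by case: (@Order.TotalTheory.arg_maxP _ _ _ b0 (mem (A :\ m)%SET) key b0B) => b; exists b.
have bA : b \in A by move: bB; rewrite inE => /andP[].
pose rho' i := if i == m then (rho b + (s b != s m))%N else rho i.
have inB i : i \in A -> i != m -> i \in (A :\ m)%SET by move=> iA im; rewrite !inE im.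
have rb i : i \in A -> i != m -> (rho i <= rho b)%N.
  by move=> iA im; apply: h1 => //; [exact: inB|apply: bmax; exact: inB].
exists rho'; split.
- move=> i j iA jA ij; rewrite /rho'; have [im|im] := eqVneq i m; have [jm|jm] := eqVneq j m => //.
  + have jb := bmax j (inB j jA jm); have bm := mmax b bA.
    have e1 : key b = key m by apply/eqP; rewrite eq_le bm; rewrite im in ij; exact: le_trans ij jb.
    have e2 : key j = key m by apply/eqP; rewrite eq_le (mmax j jA) /=; rewrite im in ij.
    rewrite (ks _ _ e1) eqxx addn0; apply: h1 => //; first exact: inB.
    by rewrite e1 e2.
  + exact: leq_trans (rb i iA im) (leq_addr _ _).
  + by apply: h1 => //; exact: inB.
- have par i : i \in A -> i != m -> odd (rho i) (+) odd (rho b + (s b != s m)) = s i (+) s m.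
    move=> iA im; have := h2 i b (inB i iA im) bB; rewrite oddD.
    by case: (s i) (s b) (s m) (odd (rho i)) (odd (rho b)) => [] [] [] [] [].
  move=> i j iA jA; rewrite /rho'; have [im|im] := eqVneq i m; have [jm|jm] := eqVneq j m.
  + by rewrite im jm !addbb.
  + by rewrite addbC par // im addbC.
  + by rewrite par // jm.
  + by apply: h2; exact: inB.
move=> i iA k; rewrite {1}/rho'; have [im|im] := eqVneq i m => hk.
  have [kb|kb] := leqP k (rho b).
    have [j jB jk] := h3 b bB k kb; exists j; first by move: jB; rewrite inE => /andP[].
    by move: jB; rewrite /rho' !inE => /andP[/negbTE ->].
  by exists m => //; rewrite /rho' eqxx; move: hk kb; case: (s b != s m) => /=; lia.
have [j jB jk] := h3 i (inB i iA im) k hk; exists j; first by move: jB; rewrite inE => /andP[].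
by move: jB; rewrite /rho' !inE => /andP[/negbTE ->].
Qed.

(** Around the circle the signs alternate, so the number [n.+2] of blocks is even. If the largest
    rank is odd, it is [n.+1]. If it is even, it is [n.+2]: the last run then has the sign of run
    [0] and forms one block with it, so ranks count modulo [n.+2]. *)
Lemma sign_change_period (I : finType) (s : I -> bool) (rho : I -> nat) (i0 i1 : I) :
  s i0 != s i1 ->
  (forall i j, odd (rho i) (+) odd (rho j) = s i (+) s j) ->
  (forall i k, (k <= rho i)%N -> exists j, rho j = k) ->
  exists n, [/\ ~~ odd n, forall i, (rho i <= n.+2)%N
    & forall k, (k < n.+2)%N -> exists i, rho i = k].
Proof.
move=> s01 par gap.
have [m _ mmax] : exists2 m, m \in I & forall i, (rho i <= rho m)%N.
  by case: (@arg_maxnP _ i0 predT rho isT) => m _ h; exists m => // i; exact: h.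
have m0 : (0 < rho m)%N.
  rewrite lt0n; apply: contraNneq s01 => m0.
  have := par i0 i1; have := mmax i0; have := mmax i1; rewrite m0 !leqn0 => /eqP-> /eqP->.
  by case: (s i0) (s i1) => [] [].
exists (rho m).-1./2.*2; rewrite odd_double; split => //.
  move=> i; apply: leq_trans (mmax i) _.
  by have := odd_double_half (rho m).-1; case: odd => /=; lia.
move=> k hk; apply: (gap m).
by have := odd_double_half (rho m).-1; case: odd => /=; lia.
Qed.

(** * Block numbers on the universal cover of the circle *)

Section Lift.
Variables (R : realDomainType) (I : finType) (s : I -> bool) (key : I -> R).
Variables (rho : I -> nat) (n : nat).
Hypothesis key_range : forall i, 0 <= key i < 4.
Hypothesis rho_mono : forall i j, key i <= key j -> (rho i <= rho j)%N.
Hypothesis rho_par : forall i j, odd (rho i) (+) odd (rho j) = s i (+) s j.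
Hypothesis n_even : ~~ odd n.
Hypothesis rho_le : forall i, (rho i <= n.+2)%N.
Hypothesis rho_onto : forall k, (k < n.+2)%N -> exists i, rho i = k.
Variables (p : I -> I) (d : I -> int).
Local Notation key' i := (key i + 4 * (d i)%:~R).
Hypothesis window : forall i j, key' j < key' i + 4.
Hypothesis pK : involutive p.
Hypothesis ps : forall i, s (p i) = ~~ s i.
Hypothesis reverses : forall i j, s i != s j -> key' i < key' j -> key' (p j) < key' (p i).

(** One full turn of the lifted angle, which is [4], counts [n.+2] blocks. *)
Definition block_lift i : int := (rho i)%:Z + n.+2%:Z * d i.
Local Notation B := block_lift.

(** The bound [r <= m] includes equality: rank [m] in one turn and rank [0] in the next denote the
    same block and have the same lift. *)
Lemma lift_monotone (r r' m e e' : int) : 0 <= r -> 0 <= r' -> r <= m -> r' <= m ->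
  (e = e' -> r <= r') -> e <= e' -> r + m * e <= r' + m * e'.
Proof.
move=> r0 r0' rm rm' h; rewrite le_eqVlt => /orP[/eqP ee|lt]; first by have := h ee; rewrite ee; lia.
have : m * (e + 1) <= m * e' by apply: ler_wpM2l; lia.
lia.
Qed.

Lemma block_lift_mono i j (k : int) : key' i <= key' j + 4 * k%:~R -> B i <= B j + n.+2%:Z * k.
Proof.
move=> h; have -> : B j + n.+2%:Z * k = (rho j)%:Z + n.+2%:Z * (d j + k) by rewrite /B; ring.
have ri := key_range i; have rj := key_range j.
apply: lift_monotone => //.
- exact: rho_le.
- exact: rho_le.
- move=> e; apply: rho_mono; move: h; rewrite e !rmorphD /=; lra.
have : (d i)%:~R < (d j + k + 1)%:~R :> R by rewrite !rmorphD /=; lra.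
by rewrite ltr_int ltzD1.
Qed.

Lemma block_lift_width i j : B i <= B j + n.+2%:Z.
Proof. by rewrite -[X in _ + X]mulr1; apply: block_lift_mono; rewrite mulr1 ltW. Qed.

Lemma block_lift_parity i j : s i != s j -> exists k : int, B i - B j = 2 * k + 1.
Proof.
move=> ij; have := rho_par i j; rewrite /B.
have [m ->] : exists m, n.+2 = m.*2 by exists n.+2./2; rewrite even_halfK //= negbK.
have ss : s i (+) s j by case: (s i) (s j) ij => [] [].
rewrite ss => o.
have [k hk] : exists k : int, (rho i)%:Z - (rho j)%:Z = 2 * k + 1.
  rewrite -[rho i]odd_double_half -[rho j]odd_double_half.
  case: (odd (rho i)) (odd (rho j)) o => [] [] //= _.
    by exists ((rho i)./2%:Z - (rho j)./2%:Z); lia.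
  by exists ((rho i)./2%:Z - (rho j)./2%:Z - 1); lia.
exists (k + m%:Z * (d i - d j)).
have -> : (rho i)%:Z + m.*2%:Z * d i - ((rho j)%:Z + m.*2%:Z * d j) =
  ((rho i)%:Z - (rho j)%:Z) + m.*2%:Z * (d i - d j) by ring.
by rewrite hk -muln2 PoszM; ring.
Qed.

Lemma block_lift_lt i j : s i != s j -> (B i < B j) = (key' i < key' j).
Proof.
move=> ij; have ne : B i != B j.
  by have [k hk] := block_lift_parity ij; apply/eqP => e; move: hk; rewrite e subrr; lia.
apply/idP/idP => [|h].
  by apply: contraTT; rewrite -!leNgt => h;
     have := @block_lift_mono j i 0; rewrite !mulr0 !addr0; apply.
rewrite lt_neqAle ne.
by have := @block_lift_mono i j 0; rewrite !mulr0 !addr0; apply; exact: ltW.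
Qed.

(** Some point has the right residue; its lift differs from [v] by a multiple of [n.+2], which the
    width bounds against [i] and [j] force to be zero. *)
Lemma block_lift_gap i j (v : int) : B i < v -> v < B j -> exists k, B k = v.
Proof.
move=> iv vj.
have [k hk] : exists k, ((rho k)%:Z = v %[mod n.+2])%Z.
  have h : (`|(v %% n.+2)%Z| < n.+2)%N.
    have := @ltz_pmod v n.+2 isT; have := @modz_ge0 v n.+2 isT; lia.
  have [k hk] := rho_onto h; exists k; rewrite hk gez0_abs ?modz_ge0 //.
  by rewrite modz_mod.
exists k.
have [q hq] : exists q : int, B k = v + n.+2%:Z * q.
  exists ((rho k %/ n.+2)%Z - (v %/ n.+2)%Z + d k).
  rewrite /B {1}(divz_eq (rho k) n.+2) {1}(divz_eq v n.+2) hk; ring.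
have h1 := block_lift_width k i; have h2 := block_lift_width j k.
have [q0|[q1|q1]] : q = 0 \/ 1 <= q \/ q <= -1 by lia.
- by rewrite hq q0 mulr0 addr0.
- have : n.+2%:Z * 1 <= n.+2%:Z * q by apply: ler_wpM2l.
  lia.
- have : n.+2%:Z * q <= n.+2%:Z * -1 by apply: ler_wpM2l.
  lia.
Qed.

Lemma block_lift_reverse i j : s i != s j -> B i < B j -> B (p j) < B (p i).
Proof.
move=> ij; rewrite block_lift_lt // => h.
rewrite block_lift_lt; first exact: reverses.
by rewrite !ps; case: (s i) (s j) ij => [] [].
Qed.

(** By parity, each of the [k.+1] unit steps leads to a point of opposite sign, and the matching
    turns it into a descent by at least one. *)
Lemma block_lift_chain k i j : B j - B i = k.+1%:Z -> B (p j) + k.+1%:Z <= B (p i).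
Proof.
elim: k i j => [|k IH] i j h.
  have ij : s i != s j.
    apply/eqP => ij; have := block_lift_parity (_ : s i != s (p j)).
    have := block_lift_parity (_ : s j != s (p j)).
    rewrite ij ps; case: (s j) => /(_ isT)[x hx] /(_ isT)[y hy]; lia.
  by have := block_lift_reverse ij; lia.
have [z hz] : exists z, B z = B i + 1.
  by apply: (@block_lift_gap i j); lia.
have h1 := IH z j ltac:(lia).
have iz : B i < B z by lia.
have iz' : s i != s z.
  apply/eqP => ij; have := block_lift_parity (_ : s i != s (p z)).
  have := block_lift_parity (_ : s z != s (p z)).
  rewrite ij ps; case: (s z) => /(_ isT)[x hx] /(_ isT)[y hy]; lia.
have := block_lift_reverse iz' iz; lia.
Qed.

Lemma block_lift_chain_le i j : B i <= B j -> B (p j) + (B j - B i) <= B (p i).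
Proof.
rewrite le_eqVlt => /orP[/eqP e|lt]; last first.
  have [k hk] : exists k, B j - B i = k.+1%:Z by exists `|B j - B i|%N.-1; lia.
  by rewrite hk; exact: block_lift_chain.
rewrite e subrr addr0 leNgt; apply/negP => lt.
have [k hk] : exists k, B (p j) - B (p i) = k.+1%:Z by exists `|B (p j) - B (p i)|%N.-1; lia.
by have := block_lift_chain hk; rewrite !pK; lia.
Qed.

(** As [p] is involutive, the estimate of [block_lift_chain_le] applies to the partners as well and
    becomes an equality: the matching acts on block numbers as a reflection. *)
Lemma block_lift_sum i j : B i + B (p i) = B j + B (p j).
Proof.
have H a b : B a <= B b -> B a + B (p a) = B b + B (p b).
  move=> ab; have h1 := block_lift_chain_le ab.
  have h2 := @block_lift_chain_le (p b) (p a); rewrite !pK in h2.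
  lia.
by case: (leP (B i) (B j)) => [|/ltW] h; [exact: H|rewrite -(H _ _ h)].
Qed.
End Lift.

Lemma Zp_int_eq0 n (a : int) : (a%:~R : 'I_n.+2) = 0 -> exists k : int, a = n.+2%:Z * k.
Proof.
have nat0 (m : nat) : (m%:R : 'I_n.+2) = 0 -> exists k : int, m%:Z = n.+2%:Z * k.
  rewrite Zp_nat => /(congr1 val) /= h; exists (m %/ n.+2)%N%:Z.
  by rewrite {1}(divn_eq m n.+2) h addn0 PoszM mulrC.
case: a => m.
  by rewrite -pmulrn; exact: nat0.
rewrite NegzE mulrNz => /eqP; rewrite oppr_eq0 -pmulrn => /eqP /nat0[k ->].
by exists (- k); rewrite mulrN.
Qed.

Lemma Zp_nat0 n : (n.+2%:R : 'I_n.+2) = 0.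
Proof. exact: (@pchar_Zp n.+2). Qed.

Section SumLemmas.
Variable R : realType.
Implicit Types u : R[i].

Lemma det2_sum u (J : Type) (r : seq J) (Q : pred J) (f : J -> R[i]) :
  det2 u (\sum_(i <- r | Q i) f i) = \sum_(i <- r | Q i) det2 u (f i).
Proof.
apply: (big_morph (det2 u)); last by rewrite /det2 /=; ring.
by move=> [a b] [c d]; case: u => e f'; rewrite /det2 /=; ring.
Qed.

Lemma dot2_sum u (J : Type) (r : seq J) (Q : pred J) (f : J -> R[i]) :
  dot2 u (\sum_(i <- r | Q i) f i) = \sum_(i <- r | Q i) dot2 u (f i).
Proof.
apply: (big_morph (dot2 u)); last by rewrite /dot2 /=; ring.
by move=> [a b] [c d]; case: u => e f'; rewrite /dot2 /=; ring.
Qed.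

Lemma det2_eq0_pair u v x : det2 u v != 0 -> det2 u x = 0 -> det2 v x = 0 -> x = 0.
Proof.
move: u v x => [a b] [c d] [e f]; rewrite /det2 /= => uv h1 h2.
have he : (a * d - b * c) * e = 0.
  have -> : (a * d - b * c) * e = c * (a * f - b * e) - a * (c * f - d * e) by ring.
  by rewrite h1 h2; ring.
have hf : (a * d - b * c) * f = 0.
  have -> : (a * d - b * c) * f = d * (a * f - b * e) - b * (c * f - d * e) by ring.
  by rewrite h1 h2; ring.
by move/eqP: he; move/eqP: hf; rewrite !mulf_eq0 (negbTE uv) /= => /eqP-> /eqP->.
Qed.
End SumLemmas.

(** * Lifted block numbers modulo the number of blocks *)

Section BlockIntegers.
Variables (I : finType) (s : I -> bool) (n : nat) (B : I -> int) (p : I -> I) (c : int).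
Hypothesis n_even : ~~ odd n.
Hypothesis Bsum : forall i, B i + B (p i) = c.
Hypothesis Bwidth : forall i j, B i <= B j + n.+2%:Z.
Hypothesis Bpar : forall i j, s i != s j -> exists k : int, B i - B j = 2 * k + 1.
Hypothesis ps : forall i, s (p i) = ~~ s i.

Lemma block_same_par i j : s i = s j -> exists k : int, B i - B j = 2 * k.
Proof.
move=> ij.
have [x hx] := @Bpar i (p j) ltac:(by rewrite ps ij; case: (s j)).
have [y hy] := @Bpar j (p j) ltac:(by rewrite ps; case: (s j)).
by exists (x - y); lia.
Qed.

Lemma block_sum_odd : forall i : I, exists k : int, c = 2 * k + 1.
Proof.
move=> i; have [x hx] := @Bpar i (p i) ltac:(by rewrite ps; case: (s i)).
by exists (B i - x - 1); have := Bsum i; lia.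
Qed.

Let half : exists m : int, n.+2%:Z = 2 * m /\ 1 <= m.
Proof. by exists (n./2.+1)%:Z; have := even_halfK n_even; lia. Qed.

(** The width bounds against the partners put [2 * B i] and [2 * B j] between [c - n.+2] and
    [c + n.+2]. Two different lifts of one block would have to attain these bounds, but [c] is odd
    and [n.+2] is even. *)
Lemma block_class_const i j (k : int) : B i - B j = n.+2%:Z * k -> B i = B j.
Proof.
have [m [hm m1]] := half; have [q hq] := block_sum_odd i.
have wi := Bwidth i (p i); have wi' := Bwidth (p i) i.
have wj := Bwidth j (p j); have wj' := Bwidth (p j) j.
have hi := Bsum i; have hj := Bsum j.
have wij := Bwidth i j; have wji := Bwidth j i.
rewrite hm in wi wi' wj wj' wij wji *.
move=> hk.
have [k0|[k1|[k1|[k2|k2]]]] : k = 0 \/ k = 1 \/ k = -1 \/ 2 <= k \/ k <= -2 by lia.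
- by rewrite k0 in hk; lia.
- by rewrite k1 in hk; lia.
- by rewrite k1 in hk; lia.
- have : 2 * m * 2 <= 2 * m * k by apply: ler_wpM2l; lia.
  lia.
- have : 2 * m * k <= 2 * m * -2 by apply: ler_wpM2l; lia.
  lia.
Qed.

(** The condition on [c] says that the reflection does not interchange the two neighbouring blocks,
    so its axis does not pass between them. *)
Lemma block_next i j (k : int) : B j - B i - 1 = n.+2%:Z * k ->
  (forall l : int, c - B i - B j <> n.+2%:Z * l) ->
  [/\ B j = B i + 1, s i != s j & (B i < B (p i)) = (B j < B (p j))].
Proof.
have [m [hm m1]] := half; have [q hq] := block_sum_odd i.
have wi := Bwidth i (p i); have wi' := Bwidth (p i) i.
have wj := Bwidth j (p j); have wj' := Bwidth (p j) j.
have hi := Bsum i; have hj := Bsum j.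
have wij := Bwidth i j; have wji := Bwidth j i.
move=> hk cl.
have ne := cl (-1); have ne0 := cl 0; have ne1 := cl 1.
rewrite hm in wi wi' wj wj' wij wji hk ne ne0 ne1 *.
have k0 : k = 0.
  have [//|[k1|[k1|[k2|k2]]]] : k = 0 \/ k = 1 \/ k = -1 \/ 2 <= k \/ k <= -2 by lia.
  - by rewrite k1 in hk; lia.
  - by rewrite k1 in hk; lia.
  - have : 2 * m * 2 <= 2 * m * k by apply: ler_wpM2l; lia.
    lia.
  - have : 2 * m * k <= 2 * m * -2 by apply: ler_wpM2l; lia.
    lia.
rewrite k0 in hk; split; first lia.
  by apply/eqP => /block_same_par[x hx]; lia.
by apply/idP/idP; lia.
Qed.
End BlockIntegers.

(** * The polygon of block centroids and its four reflections *)

Section BlockPolygon.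
Variables (R : realType) (I : finType) (pt : I -> R[i]) (s : I -> bool).
Variable P : bool -> set R[i].
Hypothesis Pconvex : forall b, cconvex (P b).
Hypothesis P0 : forall b, P b 0.
Hypothesis ptP : forall i, P (s i) (pt i).
Hypothesis ptN : forall i, ~ P (~~ s i) (pt i).
Variables (u : 'I_4 -> R[i]) (p : 'I_4 -> I -> I).
Hypothesis u_indep : forall a b, a != b -> det2 (u a) (u b) != 0.
Hypothesis pK : forall a, involutive (p a).
Hypothesis ps : forall a i, s (p a i) = ~~ s i.
Hypothesis ph : forall a i, det2 (u a) (pt (p a i)) = det2 (u a) (pt i).
Variable i0 : I.

Lemma direction_neq0 a : u a != 0.
Proof.
have [b ab] : exists b, a != b.
  by have [->|?] := eqVneq a ord0; [exists (inord 1); rewrite -val_eqE /= inordK|exists ord0].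
by apply: contraNneq (u_indep ab) => ->; rewrite /det2 /= !mul0r subrr.
Qed.

(** Of two points on one ray from the origin, the nearer lies on the segment from the origin to the
    farther, hence in the convex set of the farther. *)
Lemma diamond_angle_block i j : diamond_angle (pt i) = diamond_angle (pt j) -> s i = s j.
Proof.
have x0 := pt_neq0 P0 ptN.
have half a b (c : R) : 0 < c -> c <= 1 -> s a != s b -> pt b = c%:C * pt a -> False.
  move=> c0 c1 ab e; apply: (@ptN b); rewrite e.
  have c01 : 0 <= c <= 1 by rewrite ltW.
  by apply: (scale_opp Pconvex P0 ptP _ c01); rewrite eq_sym.
move=> e; have [//|ij] := eqVneq (s i) (s j); exfalso.
have [c c0 hc] := diamond_angle_eq (x0 i) (x0 j) e.
have [c1|c1] := lerP c 1; first exact: (half i j c).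
apply: (half j i c^-1); rewrite ?invr_gt0 ?invf_le1 ?ltW // 1?eq_sym //.
by rewrite hc mulrA -rmorphM mulVf ?gt_eqF // mul1r.
Qed.

Variables (rho : I -> nat) (n : nat).
Hypothesis rho_mono : forall i j,
  diamond_angle (pt i) <= diamond_angle (pt j) -> (rho i <= rho j)%N.
Hypothesis rho_par : forall i j, odd (rho i) (+) odd (rho j) = s i (+) s j.
Hypothesis n_even : ~~ odd n.
Hypothesis rho_le : forall i, (rho i <= n.+2)%N.
Hypothesis rho_onto : forall k, (k < n.+2)%N -> exists i, rho i = k.

Definition block i : 'I_n.+2 := (rho i)%:R.

Let B a i := block_lift rho n (angle_lift pt (u a) (p a)) i.
Let c a : int := B a i0 + B a (p a i0).

(** The constant of [block_lift_sum], for which [i0] is just one representative: direction [a]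
    reflects block [b] to [mirror a - b]. *)
Definition mirror a : 'I_n.+2 := (c a)%:~R.

Let key_range i : 0 <= diamond_angle (pt i) < 4.
Proof. exact/diamond_angle_range/(pt_neq0 P0 ptN). Qed.

Let angleE a i : diamond_angle (pt i) + 4 * (angle_lift pt (u a) (p a) i)%:~R =
  lifted_angle pt (u a) (p a) i + diamond_angle (u a).
Proof. by rewrite /lifted_angle /rel_angle; ring. Qed.

Let window a i j :
  diamond_angle (pt j) + 4 * (angle_lift pt (u a) (p a) j)%:~R <
  diamond_angle (pt i) + 4 * (angle_lift pt (u a) (p a) i)%:~R + 4.
Proof.
rewrite !angleE [X in _ < X]addrAC ltrD2r.
exact: (lifted_angle_window Pconvex P0 ptP ptN (direction_neq0 a) (pK a) (ps a) (ph a)).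
Qed.

Let Bsum a i : B a i + B a (p a i) = c a.
Proof.
apply: (block_lift_sum key_range rho_mono rho_par n_even rho_le rho_onto (window a) (pK a) (ps a)).
move=> i' j' ij; rewrite !angleE !ltrD2r.
exact: (partner_reverses Pconvex P0 ptP ptN (direction_neq0 a) (pK a) (ps a) (ph a)).
Qed.

Let Bwidth a i j : B a i <= B a j + n.+2%:Z.
Proof. exact: (block_lift_width key_range rho_mono n_even rho_le (window a)). Qed.

Let Bpar a i j : s i != s j -> exists k : int, B a i - B a j = 2 * k + 1.
Proof. exact: (block_lift_parity rho_par n_even). Qed.

Let Blt a i j : s i != s j ->
  (B a i < B a j) = (lifted_angle pt (u a) (p a) i < lifted_angle pt (u a) (p a) j).
Proof.
move=> ij; rewrite /B (block_lift_lt key_range rho_mono rho_par n_even rho_le) //.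
by rewrite !angleE ltrD2r.
Qed.

Let Bright a i : right_side pt (u a) (p a) i = (B a i < B a (p a i)).
Proof.
rewrite Blt; last by rewrite ps; case: (s i).
exact: (right_side_lt Pconvex P0 ptP ptN (direction_neq0 a) (pK a) (ps a) (ph a)).
Qed.

Let Bblock a i : (B a i)%:~R = block i.
Proof.
by rewrite /B /block_lift rmorphD rmorphM /= -!pmulrn Zp_nat0 mul0r addr0.
Qed.

Lemma block_partner a i : block (p a i) = mirror a - block i.
Proof. by rewrite /mirror -(Bsum a i) rmorphD /= !Bblock addrAC subrr add0r. Qed.

Lemma block_eq_side a i j : block i = block j ->
  right_side pt (u a) (p a) i = right_side pt (u a) (p a) j.
Proof.
move=> ij; have : ((B a i - B a j)%:~R : 'I_n.+2) = 0 by rewrite rmorphB /= !Bblock ij subrr.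
move=> /Zp_int_eq0[k hk].
have e := block_class_const n_even (Bsum a) (Bwidth a) (Bpar a) (ps a) hk.
rewrite !Bright e; congr (_ < _).
by apply: (@addrI _ (B a j)); rewrite (Bsum a j) -e (Bsum a i).
Qed.

Lemma sum_block_partner a (b : 'I_n.+2) (V : nmodType) (f : I -> V) :
  \sum_(i | block i == mirror a - b) f i = \sum_(i | block i == b) f (p a i).
Proof.
rewrite (reindex_inj (inv_inj (pK a))); apply: eq_bigl => i.
by rewrite block_partner (inj_eq (addrI _)) eqr_opp.
Qed.

(* Two directions with the same mirror would match the same blocks, so that a block and
   its image would have the same centroid; but the partners of all points of a block
   lie on the same side of these points. *)
Lemma mirror_inj : injective mirror.
Proof.
move=> a b ab; apply/eqP; apply: contraT => /u_indep uab; exfalso.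
pose r := block i0.
pose V : R[i] := \sum_(i | block i == r) pt i - \sum_(i | block i == mirror a - r) pt i.
have h d : mirror d = mirror a -> det2 (u d) V = 0.
  move=> da; rewrite /V det2Br !det2_sum -da sum_block_partner.
  by under [X in _ - X]eq_bigr do rewrite ph; rewrite subrr.
have V0 : V = 0 by apply: (det2_eq0_pair uab); exact: h.
have : dot2 (u a) V = 0 by rewrite V0 /dot2 /= !mulr0 addr0.
rewrite /V dot2Br !dot2_sum sum_block_partner -sumrB.
have ne i : dot2 (u a) (pt (p a i)) != dot2 (u a) (pt i).
  exact: (partner_neq ptP ptN (direction_neq0 a) (ps a) (ph a)).
have side i : block i == r -> right_side pt (u a) (p a) i = right_side pt (u a) (p a) i0.
  by move=> /eqP ir; apply: block_eq_side.
rewrite (bigD1 i0) //=; have := ne i0; have := side.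
rewrite /right_side; case: (ltgtP (dot2 (u a) (pt (p a i0)))) => // d0 {}side _.
- suff : 0 <= \sum_(i | (block i == r) && (i != i0))
    (dot2 (u a) (pt i) - dot2 (u a) (pt (p a i))) by lra.
  by apply: sumr_ge0 => i /andP[/side h1 _]; rewrite subr_ge0 ltW.
- suff : \sum_(i | (block i == r) && (i != i0))
    (dot2 (u a) (pt i) - dot2 (u a) (pt (p a i))) <= 0 by lra.
  apply: sumr_le0 => i /andP[/side h1 _]; rewrite subr_le0.
  by rewrite leNgt h1.
Qed.

(* At most two directions separate consecutive blocks among three; for any other
   direction the three blocks lie on one side, in the order of their levels. *)
Lemma block_turn i j k : block j = block i + 1 -> block k = block j + 1 ->
  0 < det2 (pt j - pt i) (pt k - pt j).
Proof.
move=> ij jk.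
have [a [a1 a2]] : exists a, mirror a != block i + block j /\ mirror a != block j + block k.
  have inj (x y : 'I_4) z : x != y -> mirror x = z -> mirror y = z -> False.
    by move=> xy e1 e2; move: xy; rewrite (mirror_inj (etrans e1 (esym e2))) eqxx.
  pose o m : 'I_4 := inord m.
  have o01 : o 0 != o 1 by rewrite -val_eqE /= !inordK.
  have o02 : o 0 != o 2 by rewrite -val_eqE /= !inordK.
  have o12 : o 1 != o 2 by rewrite -val_eqE /= !inordK.
  set x := block i + block j; set y := block j + block k.
  have [e0|n0] := eqVneq (mirror (o 0)) x.
    have [e1|n1] := eqVneq (mirror (o 1)) y.
      exists (o 2); split; apply/eqP => e2; first exact: (inj _ _ _ o02 e0 e2).
      exact: (inj _ _ _ o12 e1 e2).
    by exists (o 1); split => //; apply/eqP => e2; exact: (inj _ _ _ o01 e0 e2).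
  have [e0|n0'] := eqVneq (mirror (o 0)) y; last by exists (o 0).
  have [e1|n1] := eqVneq (mirror (o 1)) x.
    exists (o 2); split; apply/eqP => e2; first exact: (inj _ _ _ o12 e1 e2).
    exact: (inj _ _ _ o02 e0 e2).
  by exists (o 1); split => //; apply/eqP => e2; exact: (inj _ _ _ o01 e0 e2).
have next x y : block y = block x + 1 -> mirror a != block x + block y ->
    [/\ B a y = B a x + 1, s x != s y & right_side pt (u a) (p a) x = right_side pt (u a) (p a) y].
  move=> xy h; have : ((B a y - B a x - 1)%:~R : 'I_n.+2) = 0.
    by rewrite !rmorphB /= !Bblock xy addrAC addrK subrr.
  move=> /Zp_int_eq0[m hm]; rewrite !Bright.
  apply: (block_next n_even (Bsum a) (Bwidth a) (Bpar a) (ps a) hm) => l hl.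
  move/eqP: h; apply; rewrite -(Bblock a x) -(Bblock a y) /mirror -rmorphD /=.
  apply/eqP; rewrite -subr_eq0 -rmorphB /= opprD addrA hl rmorphM /=.
  by rewrite -pmulrn Zp_nat0 mul0r.
have [Bij sij rij] := next _ _ ij a1; have [Bjk sjk rjk] := next _ _ jk a2.
have lij : lifted_angle pt (u a) (p a) i < lifted_angle pt (u a) (p a) j.
  by rewrite -Blt // Bij ltzD1.
have ljk : lifted_angle pt (u a) (p a) j < lifted_angle pt (u a) (p a) k.
  by rewrite -Blt // Bjk ltzD1.
have ua := direction_neq0 a.
have h1 := side_level Pconvex P0 ptP ptN ua (ps a) (ph a) sij rij lij.
have h2 := side_level Pconvex P0 ptP ptN ua (ps a) (ph a) sjk rjk ljk.
have sik : s i = s k by case: (s i) (s j) (s k) sij sjk => [] [] [].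
have T := turn_sign Pconvex ptP ptN ua (ps a) (ph a) sik sij.
have ne : dot2 (u a) (pt (p a j)) != dot2 (u a) (pt j).
  exact: (partner_neq ptP ptN ua (ps a) (ph a)).
move: h1 h2; rewrite rij; have [rj|rj] := boolP (right_side pt (u a) (p a) j) => h1 h2.
- have w0 : 0 < dot2 (u a) (pt j) - dot2 (u a) (pt (p a j)) by rewrite subr_gt0.
  have {}T := T ltac:(by rewrite mulr_gt0 // subr_gt0).
  rewrite (pmulr_rgt0 _ (_ : 0 < (dot2 (u a) (pt j) - dot2 (u a) (pt (p a j))) *
    (det2 (u a) (pt k) - det2 (u a) (pt i)))) // in T.
  by rewrite mulr_gt0 // subr_gt0 (lt_trans h1 h2).
- have w0 : dot2 (u a) (pt j) - dot2 (u a) (pt (p a j)) < 0.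
    by rewrite subr_lt0 lt_neqAle eq_sym ne leNgt.
  have {}T := T ltac:(by rewrite nmulr_rgt0 subr_lt0).
  rewrite (pmulr_rgt0 _ (_ : 0 < (dot2 (u a) (pt j) - dot2 (u a) (pt (p a j))) *
    (det2 (u a) (pt k) - det2 (u a) (pt i)))) // in T.
  by rewrite nmulr_rgt0 // subr_lt0 (lt_trans h2 h1).
Qed.

Definition block_size b : nat := #|[pred i | block i == b]|.

Lemma block_size_gt0 b : (0 < block_size b)%N.
Proof.
have [i hi] := rho_onto (ltn_ord b).
by apply/card_gt0P; exists i; rewrite inE /block hi natr_Zp.
Qed.

Lemma block_size_mirror a b : block_size (mirror a - b) = block_size b.
Proof. by rewrite /block_size -!sum1_card; exact: sum_block_partner. Qed.

Definition centroid b : R[i] :=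
  ((block_size b)%:R^-1 : R)%:C * \sum_(i | block i == b) pt i.

Lemma det2_centroid x b :
  det2 x (centroid b) = (block_size b)%:R^-1 * \sum_(i | block i == b) det2 x (pt i).
Proof.
rewrite -det2_sum /centroid; move: (\sum_(i | _) _) (_^-1) => y z.
by rewrite -[z%:C * y]addr0 -(mul0r y) det2_lin mul0r addr0.
Qed.

Lemma det2_centroid_mirror a b : det2 (u a) (centroid (mirror a - b)) = det2 (u a) (centroid b).
Proof.
rewrite !det2_centroid block_size_mirror sum_block_partner.
by congr (_ * _); apply: eq_bigr => i _; rewrite ph.
Qed.

Lemma centroid_affine_gt0 b x (y : R) :
  (forall i, block i = b -> 0 < det2 x (pt i) + y) -> 0 < det2 x (centroid b) + y.
Proof.
move=> h; rewrite det2_centroid.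
have N0 : 0 < (block_size b)%:R :> R by rewrite ltr0n block_size_gt0.
rewrite -(pmulr_rgt0 _ N0) mulrDr mulrA divff ?gt_eqF // mul1r.
have -> : (block_size b)%:R * y = \sum_(i | block i == b) y.
  by rewrite sumr_const mulr_natl.
rewrite -big_split /=; have /card_gt0P[i hi] := block_size_gt0 b.
rewrite (bigD1 i) //= ltr_pwDl //; first exact/h/eqP.
by apply: sumr_ge0 => j /andP[/eqP/h/ltW].
Qed.

(** The determinant is affine in each of the three vertices, so these can be averaged over their
    blocks one after the other. *)
Lemma centroid_turn b :
  0 < det2 (centroid (b + 1) - centroid b) (centroid (b + 1 + 1) - centroid (b + 1)).
Proof.
have E1 (x y z : R[i]) : det2 (y - x) (z - y) = det2 (y - x) z - det2 (y - x) y.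
  by move: x y z => [? ?] [? ?] [? ?]; rewrite /det2 /=; ring.
have E2 (x y z : R[i]) : det2 (y - x) (z - y) = det2 (x - z) y + det2 z x.
  by move: x y z => [? ?] [? ?] [? ?]; rewrite /det2 /=; ring.
have E3 (x y z : R[i]) : det2 (y - x) (z - y) = det2 (z - y) x + det2 y z.
  by move: x y z => [? ?] [? ?] [? ?]; rewrite /det2 /=; ring.
rewrite E3; apply: centroid_affine_gt0 => i ib; rewrite -E3.
rewrite E2; apply: centroid_affine_gt0 => j jb; rewrite -E2.
rewrite E1; apply: centroid_affine_gt0 => k kb; rewrite -E1.
by apply: block_turn; rewrite ?ib ?jb ?kb.
Qed.
End BlockPolygon.

Lemma exists_block_polygon (R : realType) (I : finType) (pt : I -> R[i]) (s : I -> bool)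
    (P : bool -> set R[i]) (u : 'I_4 -> R[i]) (p : 'I_4 -> I -> I) (i0 : I) :
  (forall b, cconvex (P b)) -> (forall b, P b 0) ->
  (forall i, P (s i) (pt i)) -> (forall i, ~ P (~~ s i) (pt i)) ->
  (forall a b, a != b -> det2 (u a) (u b) != 0) ->
  (forall a, involutive (p a)) -> (forall a i, s (p a i) = ~~ s i) ->
  (forall a i, det2 (u a) (pt (p a i)) = det2 (u a) (pt i)) ->
  exists n (C : 'I_n.+2 -> R[i]) (m : 'I_4 -> 'I_n.+2),
    (forall b, 0 < det2 (C (b + 1) - C b) (C (b + 1 + 1) - C (b + 1))) /\
    (forall a b, det2 (u a) (C (m a - b)) = det2 (u a) (C b)).
Proof.
move=> Pc P0 ptP ptN ui pK ps ph.
have [rho [mono par gap]] := sign_change_rank (diamond_angle_block Pc P0 ptP ptN).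
have s01 : s i0 != s (p ord0 i0) by rewrite ps; case: (s i0).
have [n [n_even rle onto]] := sign_change_period s01 par gap.
exists n, (@centroid _ _ pt rho n), (mirror pt u p i0 rho n); split=> [b|a b].
  exact: (centroid_turn Pc P0 ptP ptN ui pK ps ph).
exact: (det2_centroid_mirror Pc P0 ptP ptN ui pK ps ph).
Qed.

(** * Fourier analysis of the block polygon *)

Lemma prim_root_exists (F : numClosedFieldType) n : (0 < n)%N ->
  exists z : F, n.-primitive_root z.
Proof.
move=> n0; have [r] := closed_field_poly_normal ('X^n - 1 : {poly F}).
rewrite (monicP (monicXnsubC 1 n0)) scale1r => hr.
have : has n.-primitive_root r.
  apply: has_prim_root => //.
  - by apply/allP => z zr; rewrite /root_of_unity hr root_prod_XsubC.
  - by rewrite -separable_prod_XsubC -hr separable_Xn_sub_1 // pnatr_eq0 -lt0n.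
  - by rewrite -ltnS -(size_prod_XsubC r id) -hr size_XnsubC.
by case/hasP => z _ hz; exists z.
Qed.

Section CyclicFourier.
Variables (R : realType) (n : nat) (zeta : R[i]).
Hypothesis zeta_prim : n.+2.-primitive_root zeta.
Local Notation Z := 'I_n.+2.
Implicit Types (a b k : Z) (f g : Z -> R).

Definition character k : R[i] := zeta ^+ k.
Local Notation chi := character.

Lemma characterD a b : chi (a + b) = chi a * chi b.
Proof. by rewrite /chi /= (prim_expr_mod zeta_prim) exprD. Qed.

Lemma character0 : chi 0 = 1.
Proof. exact: expr0. Qed.

Lemma characterN a : chi (- a) = (chi a)^-1.
Proof.
apply/esym/(mulfI (_ : chi a != 0)).
  by rewrite expf_neq0 // (prim_root_eq0 zeta_prim).
by rewrite -characterD subrr character0 divff // expf_neq0 // (prim_root_eq0 zeta_prim).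
Qed.

Lemma character_order a : chi a ^+ n.+2 = 1.
Proof. by rewrite /chi exprAC (prim_expr_order zeta_prim) expr1n. Qed.

Lemma conj_character a : ((chi a)^*)%C = chi (- a).
Proof.
have n1 : `|chi a| = 1.
  by apply/eqP; rewrite -(@pexpr_eq1 _ _ n.+2) // -normrX character_order normr1.
rewrite characterN invc_norm n1 expr1n invr1 mul1r //.
Qed.

Lemma character_eq1 a : (chi a == 1) = (a == 0).
Proof.
rewrite /chi -(prim_order_dvd zeta_prim) -val_eqE /=.
by apply/idP/eqP => [|->]; [rewrite /dvdn modn_small // => /eqP|exact: dvdn0].
Qed.

Lemma sum_character a : \sum_k chi (k * a) = if a == 0 then n.+2%:R else 0.
Proof.
case: eqVneq => [->|a0].
  under eq_bigr do rewrite mulr0 character0.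
  by rewrite sumr_const card_ord.
have h : \sum_k chi (k * a) = (\sum_k chi (k * a)) * chi a.
  rewrite [LHS](reindex_inj (addIr 1)) mulr_suml; apply: eq_bigr => k _.
  by rewrite mulrDl mul1r characterD.
move: h; set S := \sum_k _; move/eqP; rewrite -subr_eq0 -{1}[S]mulr1 -mulrBr mulf_eq0.
by rewrite subr_eq0 [_ == chi a]eq_sym character_eq1 (negbTE a0) orbF => /eqP.
Qed.

Definition fourier f k : R[i] := \sum_b chi (k * b) * (f b)%:C.

Lemma conj_fourier f k : ((fourier f k)^*)%C = \sum_b chi (- (k * b)) * (f b)%:C.
Proof.
rewrite /fourier rmorph_sum; apply: eq_bigr => b _.
by rewrite rmorphM /= conj_character; congr (_ * _); rewrite -[RHS]conjc_real.
Qed.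

Lemma fourier_shift f k : fourier (fun b => f (b + 1) - f b) k = (chi (- k) - 1) * fourier f k.
Proof.
rewrite mulrBl mul1r /fourier.
under eq_bigr do rewrite rmorphB mulrBr.
rewrite sumrB; congr (_ - _).
rewrite mulr_sumr [RHS](reindex_inj (addIr 1)) /=.
apply: eq_bigr => b _; rewrite mulrA -characterD.
by have -> : - k + k * (b + 1) = k * b by ring.
Qed.

(** Parseval's identity for [f] and the shift of [g] by one. *)
Lemma fourier_correlation f g :
  \sum_k chi (- k) * (((fourier f k)^*)%C * fourier g k) =
  n.+2%:R * (\sum_b f b * g (b + 1))%:C.
Proof.
transitivity (\sum_b \sum_b' (\sum_k chi (k * (b' - b - 1))) * (f b * g b')%:C).
  under eq_bigr => k _ do rewrite conj_fourier /fourier mulr_suml mulr_sumr.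
  rewrite exchange_big /=; apply: eq_bigr => b _.
  under eq_bigr => k _ do rewrite mulr_sumr mulr_sumr.
  rewrite exchange_big /=; apply: eq_bigr => b' _.
  rewrite mulr_suml; apply: eq_bigr => k _.
  have -> : k * (b' - b - 1) = - k + (- (k * b) + k * b') by ring.
  by rewrite !characterD rmorphM /=; ring.
rewrite rmorph_sum mulr_sumr; apply: eq_bigr => b _.
rewrite (bigD1 (b + 1)) //=; have -> : b + 1 - b - 1 = 0 :> Z by ring.
rewrite sum_character eqxx big1 ?addr0 //.
move=> b' hb; rewrite sum_character ifN ?mul0r //.
by apply: contra_neq hb => /eqP; rewrite -addrA -opprD subr_eq0 => /eqP.
Qed.

(** The expression vanishes exactly when the two transforms at [k] form a complex multiple of a real
    vector. If it vanished for all [k], it would do so for the edge vectors too, whose transforms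
    only gain the factor [chi (- k) - 1]. By [fourier_correlation] the turn determinants, all
    positive, would then sum to zero. *)
Lemma convex_polygon_mode (C : Z -> R[i]) :
  (forall b, 0 < det2 (C (b + 1) - C b) (C (b + 1 + 1) - C (b + 1))) ->
  exists k, ((fourier (fun b => complex.Re (C b)) k)^*)%C * fourier (fun b => complex.Im (C b)) k
   - ((fourier (fun b => complex.Im (C b)) k)^*)%C * fourier (fun b => complex.Re (C b)) k != 0.
Proof.
move=> turn; set f := fun b => complex.Re (C b); set g := fun b => complex.Im (C b).
apply/existsP; apply: contraT; rewrite negb_exists => /forallP D0.
pose df b := f (b + 1) - f b; pose dg b := g (b + 1) - g b.
have : \sum_k chi (- k) * (((fourier df k)^*)%C * fourier dg k) -
       \sum_k chi (- k) * (((fourier dg k)^*)%C * fourier df k) = 0.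
  rewrite -sumrB big1 // => k _; rewrite -mulrBr !fourier_shift !rmorphM /=.
  have /negPn/eqP := D0 k; move: (fourier f k) (fourier g k) => X Y e.
  set t := chi (- k) - 1; set t' := (t^*)%C.
  have -> : t' * (X^*)%C * (t * Y) - t' * (Y^*)%C * (t * X) =
    t' * t * ((X^*)%C * Y - (Y^*)%C * X) by ring.
  by rewrite e !mulr0.
rewrite !fourier_correlation -mulrBr -rmorphB /= => /eqP.
rewrite mulf_eq0 pnatr_eq0 /= => /eqP/complexI e.
have : 0 < \sum_b df b * dg (b + 1) - \sum_b dg b * df (b + 1).
  rewrite -sumrB (bigD1 ord0) //= ltr_pwDl //.
    by have := turn ord0; rewrite /det2 /df /dg /f /g; move: (C _) (C _) (C _) => [? ?] [? ?] [? ?].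
  apply: sumr_ge0 => b _; have := ltW (turn b).
  by rewrite /det2 /df /dg /f /g; move: (C _) (C _) (C _) => [? ?] [? ?] [? ?].
by rewrite e ltxx.
Qed.

Lemma fourier_mirror f (m : Z) k : (forall b, f (m - b) = f b) ->
  fourier f k = chi (k * m) * ((fourier f k)^*)%C.
Proof.
move=> fm; rewrite conj_fourier mulr_sumr {1}/fourier.
rewrite (reindex_inj (inj_comp (addrI m) oppr_inj)) /=.
by apply: eq_bigr => b _; rewrite fm mulrBr characterD mulrA.
Qed.
End CyclicFourier.

(** In the chosen mode, the levels in direction [u a] have transform [Z a], and the reflection makes
    [Z a] equal to [w a] times its conjugate. Hence [det2 (u a) (u b)] times [D] is [w b - w a]
    times the conjugates of [Z a] and [Z b]. As the left side is nonzero, [w] is injective, and in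
    the cross ratio all factors but the differences of the [w a] cancel. *)
Lemma block_polygon_cross_ratio (R : realType) n (C : 'I_n.+2 -> R[i]) (u : 'I_4 -> R[i])
    (m : 'I_4 -> 'I_n.+2) :
  (forall b, 0 < det2 (C (b + 1) - C b) (C (b + 1 + 1) - C (b + 1))) ->
  (forall a b, det2 (u a) (C (m a - b)) = det2 (u a) (C b)) ->
  (forall a b, a != b -> det2 (u a) (u b) != 0) ->
  exists w : 'I_4 -> R[i], [/\ forall a, w a ^+ n.+2 = 1, injective w
    & forall a b c d, a != b -> c != d -> a != d -> b != c ->
    (det2 (u a) (u c) * det2 (u b) (u d) / (det2 (u b) (u c) * det2 (u a) (u d)))%:C =
    (w c - w a) * (w d - w b) / ((w c - w b) * (w d - w a))].
Proof.
move=> turn mir ui; have [zeta hz] := @prim_root_exists R[i] n.+2 isT.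
have [k] := convex_polygon_mode hz turn.
set X := fourier _ _ k; set Y := fourier _ (fun b => complex.Im (C b)) k => D0.
pose Z a := (complex.Re (u a))%:C * Y - (complex.Im (u a))%:C * X.
have Zf a : Z a = fourier zeta (fun b => det2 (u a) (C b)) k.
  rewrite /Z /X /Y /fourier !mulr_sumr -sumrB; apply: eq_bigr => b _.
  by rewrite /det2 rmorphB !rmorphM /=; ring.
pose w a := character zeta (k * m a).
have Zw a : Z a = w a * ((Z a)^*)%C.
  by rewrite Zf; apply: (fourier_mirror hz) => b; exact: mir.
set D := _ - _ in D0.
have cZ a : ((Z a)^*)%C = (complex.Re (u a))%:C * (Y^*)%C - (complex.Im (u a))%:C * (X^*)%C.
  by rewrite /Z rmorphB !rmorphM /= !oppr0.
have key a b : (det2 (u a) (u b))%:C * D = ((Z a)^*)%C * ((Z b)^*)%C * (w b - w a).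
  transitivity (((Z a)^*)%C * Z b - Z a * ((Z b)^*)%C).
    rewrite !cZ /Z /det2 /D (rmorphB (real_complex R)) !(rmorphM (real_complex R)) /=.
    by ring.
  by rewrite {1}(Zw b) {2}(Zw a); ring.
have key0 a b : a != b -> [/\ ((Z a)^*)%C != 0, ((Z b)^*)%C != 0 & w b - w a != 0].
  move=> ab; have : (det2 (u a) (u b))%:C * D != 0.
    by rewrite mulf_neq0 // (fmorph_eq0 (real_complex R)) ui.
  by rewrite key !mulf_eq0 !negb_or => /andP[/andP[-> ->] ->].
exists w; split=> [a|a b wab|a b c d ab cd ad bc].
- exact: character_order.
- by apply/eqP; apply: contraT => /key0[_ _]; rewrite wab subrr eqxx.
have [za _ wad] := key0 _ _ ad; have [zb zc wbc] := key0 _ _ bc.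
have [_ zd _] := key0 _ _ cd.
have e x y : (det2 (u x) (u y))%:C = ((Z x)^*)%C * ((Z y)^*)%C * (w y - w x) / D.
  by rewrite -key mulfK.
rewrite fmorph_div !rmorphM /= !e.
move: ((Z a)^*)%C ((Z b)^*)%C ((Z c)^*)%C ((Z d)^*)%C za zb zc zd => xa xb xc xd za zb zc zd.
field; do ?[apply/andP; split] => //.
Qed.

(** * Convex subsets with equal X-rays *)

Lemma int_window (K : nat) (f : int) : - K%:Z - 1 < f -> f < K%:Z ->
  exists i : 'I_(K.*2.+2), i%:Z - K.+1%:Z = f.
Proof.
move=> h1 h2; have lt : (absz (f + K.+1%:Z)%R < K.*2.+2)%N by lia.
by exists (Ordinal lt) => /=; lia.
Qed.

Section PlaneSets.
Variable R : realType.
Implicit Types (F L P : set R[i]) (x y z u : R[i]).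

Lemma convex_setE P : @convex_set R (Rcomplex R) P <-> cconvex P.
Proof.
have convE (x y : R[i]) (t : {i01 R}) :
    (@conv R (convex_lmodType (Rcomplex R)) t x y : R[i]) =
    t%:num%:C * x + (1 - t%:num)%:C * y.
  by case: x y => [a b] [c d]; rewrite /conv /=; simpc.
split=> [h x y t Px Py t01|h x y t /set_mem Px /set_mem Py].
  have := h x y (Itv01 (proj1 (andP t01)) (proj2 (andP t01))) (mem_set Px) (mem_set Py).
  by move=> /set_mem; rewrite convE.
apply: mem_set; rewrite convE; apply: h => //.
by apply/andP; split.
Qed.

Lemma convex_hull_cconvex F : cconvex (convex_hull F).
Proof.
move=> x y t hx hy t01 A hA; have [/convex_setE cA _] := hA.
exact: cA (hx A hA) (hy A hA) t01.
Qed.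

Lemma sub_convex_hull F : F `<=` convex_hull F.
Proof. exact: sub_gen_smallest. Qed.

Lemma convex_hull_sub F P : cconvex P -> F `<=` P -> convex_hull F `<=` P.
Proof. by move=> /convex_setE cP FP; exact: smallest_sub. Qed.

Lemma mean_in_cconvex P (r : seq R[i]) : cconvex P -> r != [::] ->
  (forall x, x \in r -> P x) -> P (((size r)%:R^-1 : R)%:C * \sum_(x <- r) x).
Proof.
move=> cP; elim: r => // x [|y r] IH _ h.
  by rewrite big_seq1 invr1 rmorph1 mul1r; apply: h; rewrite inE.
have {}IH := IH isT (fun z zr => h z (mem_behead (s := x :: y :: r) zr)).
rewrite big_cons; set S := \sum_(_ <- _) _ in IH *; set n := (size (y :: r)) in IH *.
have n0 : n%:R != 0 :> R by rewrite pnatr_eq0.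
have n1 : n.+1%:R != 0 :> R by rewrite pnatr_eq0.
have := cP x _ (n.+1%:R^-1) (h x (mem_head _ _)) IH.
have t01 : 0 <= (n.+1%:R^-1 : R) <= 1 by rewrite invr_ge0 ler0n invf_le1 ?ltr0n // ler1n.
move=> /(_ t01); rewrite mulrA -rmorphM mulrDr /=.
have -> // : (1 - n.+1%:R^-1) * n%:R^-1 = n.+1%:R^-1 :> R.
rewrite -natr1 in n1 *; field; do ?[apply/andP; split] => //.
Qed.

Lemma mem_line u p x : u != 0 -> line p u x <-> det2 u x = det2 u p.
Proof.
move=> u0; split=> [[t _ <-]|h].
  by case: p u {u0} => [a b] [c d]; rewrite /det2 /=; ring.
exists ((dot2 u x - dot2 u p) / dot2 u u) => //.
have N0 := lt0r_neq0 (dot2_gt0 u0); set t := _ / _.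
have e : p + t%:C * u = 1%:C * p + t%:C * u by rewrite mul1r.
apply: (dot_det_inj u0).
  by rewrite e dot2_lin /t; field.
rewrite e det2_lin h (_ : det2 u u = 0); last by rewrite /det2; ring.
by ring.
Qed.

Lemma exists_level u (t : R) : u != 0 -> exists p, det2 u p = t.
Proof.
move=> u0; have N0 := lt0r_neq0 (dot2_gt0 u0).
exists ((t / dot2 u u)%:C * (- complex.Im u +i* complex.Re u)).
by move: N0; rewrite /det2 /dot2; case: u {u0} => a b /= N0; field.
Qed.

Lemma xray_level F F' u : finite_set F -> finite_set F' -> u != 0 ->
  xray F (u := u) = xray F' (u := u) ->
  forall t, count [pred x | det2 u x == t] (fset_set F) =
            count [pred x | det2 u x == t] (fset_set F').
Proof.
move=> fF fF' u0 e t; have [p hp] := exists_level t u0.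
pose l : lines_along u := exist _ (line p u) (ex_intro _ p erefl).
have cnt G : finite_set G ->
    xray G l = count [pred x | det2 u x == t] (fset_set G).
  move=> fG; rewrite /xray -size_filter; apply/perm_size/uniq_perm.
  - exact: fset_uniq.
  - exact/filter_uniq/fset_uniq.
  move=> x; rewrite mem_filter /= (in_fset_set fG) in_fset_set; last exact: finite_setIl.
  apply/idP/idP.
    move=> /set_mem [Gx /(mem_line p x u0)] /= ->.
    by rewrite hp eqxx /=; exact: mem_set.
  move=> /andP[/eqP hx /set_mem Gx]; apply: mem_set; split => //=.
  by apply/(mem_line p x u0); rewrite hx hp.
by rewrite -!cnt // e.
Qed.

Lemma normc_lt x (r : R) : complex.Re x ^+ 2 + complex.Im x ^+ 2 < r ^+ 2 -> 0 < r ->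
  `|x| < r%:C.
Proof.
move=> h r0; rewrite normc_def ltcR -[X in _ < X]ger0_norm ?ltW // -sqrtr_sqr.
by rewrite ltr_sqrt // exprn_gt0.
Qed.

Lemma bounded_coords F : bounded_set (F : set R[i]^o) ->
  exists2 M : R, 0 < M & forall x, F x -> `|complex.Re x| <= M /\ `|complex.Im x| <= M.
Proof.
move=> /pinfty_ex_gt0 [M M0 hM].
have [M1 eM] : exists M1 : R, M = M1%:C.
  by exists (complex.Re M); apply/esym/RRe_real; exact: gtr0_real.
rewrite eM ltcR in M0; exists M1 => // x Fx.
have := hM x Fx; rewrite /= eM => hx.
have key (a b : R) : `|a| <= Num.sqrt (a ^+ 2 + b ^+ 2).
  by rewrite -sqrtr_sqr ler_sqrt ?lerDl ?sqr_ge0 // addr_ge0 ?sqr_ge0.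
rewrite normc_def lecR in hx; split; apply: le_trans hx => //.
by rewrite addrC.
Qed.

(** Squares of side [r / 2] have diameter less than [r], so each contains at most one point of [F],
    and a bounded set meets only finitely many of them. *)
Lemma bounded_uniformly_discrete F L : uniformly_discrete L ->
  bounded_set (F : set R[i]^o) -> F `<=` L -> finite_set F.
Proof.
move=> [r r0 hr] /bounded_coords[M M0 hM] FL.
have sep x y : F x -> F y -> `|x - y| < r%:C -> x = y.
  move=> Fx Fy xy; apply: (hr x); split; try exact: FL.
    by rewrite /open_ball -ball_normE /= subrr normr0 ltcR.
  by rewrite /open_ball -ball_normE.
pose d := r / 2; have d0 : 0 < d by rewrite divr_gt0.
pose cell x : int * int := (Num.floor (complex.Re x / d), Num.floor (complex.Im x / d)).
have cell_close (a b : R) : Num.floor (a / d) = Num.floor (b / d) -> (a - b) ^+ 2 < d ^+ 2.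
  move=> e; have /andP[a1 a2] := floor_itv (a / d); have /andP[b1 b2] := floor_itv (b / d).
  rewrite e in a1 a2; rewrite ler_pdivlMr // in a1; rewrite ler_pdivlMr // in b1.
  rewrite ltr_pdivrMr // in a2; rewrite ltr_pdivrMr // in b2.
  by move: a2 b2; rewrite rmorphD /=; nra.
have cell_inj : {in F &, injective cell}.
  move=> x y /set_mem Fx /set_mem Fy [/cell_close h1 /cell_close h2].
  apply: sep => //; apply: normc_lt => //; move: x y h1 h2 {Fx Fy} => [a b] [a' b'] /=.
  by rewrite /d; nra.
have [K hK] : exists K : nat, M / d < K%:R by exists (Num.truncn (M / d)).+1; exact: truncnS_gt.
pose g (z : 'I_(K.*2.+2) * 'I_(K.*2.+2)) : int * int :=
  (z.1%:Z - K.+1%:Z, z.2%:Z - K.+1%:Z).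
have range_floor (a : R) : `|a| <= M -> exists i : 'I_(K.*2.+2), i%:Z - K.+1%:Z = Num.floor (a / d).
  move=> ha; have ad : `|a / d| < K%:R.
    by rewrite normrM normfV (gtr0_norm d0); apply: le_lt_trans hK; rewrite ler_pM2r ?invr_gt0.
  have /andP[f1 f2] := floor_itv (a / d); move: ad; rewrite ltr_norml => /andP[k1 k2].
  have h1 : (- K%:Z - 1)%:~R < (Num.floor (a / d))%:~R :> R.
    by move: f2; rewrite !rmorphD /= rmorphN /= -!pmulrn; lra.
  have h2 : (Num.floor (a / d))%:~R < (K%:Z)%:~R :> R by rewrite -pmulrn; lra.
  by rewrite !ltr_int in h1 h2; exact: int_window.
have fin : finite_set (cell @` F).
  apply: (@sub_finite_set _ _ (range g)); last by apply: finite_image; exact: finite_finset.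
  move=> _ [x Fx <-]; have [h1 h2] := hM x Fx.
  have [i hi] := range_floor _ h1; have [j hj] := range_floor _ h2.
  by exists (i, j) => //; rewrite /g /cell /= hi hj.
by apply: card_le_finite fin; rewrite (card_le_eqr (inj_card_eq cell_inj)).
Qed.
End PlaneSets.

Lemma count_eq_filter_notin (T : eqType) (a : pred T) (G G' : seq T) : uniq G -> uniq G' ->
  count a G = count a G' ->
  count a [seq x <- G | x \notin G'] = count a [seq x <- G' | x \notin G].
Proof.
move=> uG uG' e.
have split (s s' : seq T) : count a s =
    (count a [seq x <- s | x \in s'] + count a [seq x <- s | x \notin s'])%N.
  by rewrite -count_cat; apply/esym/seq.permP; exact: (permEl (perm_filterC _ _)).
have /seq.permP com : perm_eq [seq x <- G | x \in G'] [seq x <- G' | x \in G].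
  by apply: uniq_perm; rewrite ?filter_uniq // => x; rewrite !mem_filter andbC.
by apply/eqP; rewrite -(eqn_add2l (count a [seq x <- G | x \in G'])) -split e (split G' G) com.
Qed.

(** Source of the matchings: the points on each line are paired with equally many points of the
    other set, in an arbitrary way. *)
Lemma tuple_level_perm (T K : eqType) (n : nat) (t t' : n.-tuple T) (h : T -> K) :
  (forall l, count [pred x | h x == l] t = count [pred x | h x == l] t') ->
  exists q : {perm 'I_n}, forall i, h (tnth t i) = h (tnth t' (q i)).
Proof.
move=> e; have /tuple_permP[q hq] : perm_eq (map h t) (map_tuple h t').
  by apply/allP => l _ /=; rewrite !count_map; exact/eqP/e.
exists q => i; have := congr1 (fun s => nth (h (tnth t i)) s i) hq.
have st : (i < size t)%N by rewrite size_tuple.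
rewrite (nth_map (tnth t i)) // -tnth_nth => ->.
have -> : nth (h (tnth t i)) (mktuple (fun i => tnth (map_tuple h t') (q i))) i =
  tnth (mktuple (fun i => tnth (map_tuple h t') (q i))) i by rewrite (tnth_nth (h (tnth t i))).
by rewrite tnth_mktuple tnth_map.
Qed.

Section Undetermined.
Variables (R : realType) (L : set R[i]).

Lemma undetermined_cross_ratio (F F' : set R[i]) (u : 'I_4 -> R[i]) :
  uniformly_discrete L -> convex_subset L F -> convex_subset L F' -> F <> F' ->
  (forall a b, a != b -> det2 (u a) (u b) != 0) ->
  (forall a, xray F (u := u a) = xray F' (u := u a)) ->
  exists m (w : 'I_4 -> R[i]), [/\ (0 < m)%N, forall a, w a ^+ m = 1, injective w
    & forall a b c d, a != b -> c != d -> a != d -> b != c ->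
    (det2 (u a) (u c) * det2 (u b) (u d) / (det2 (u b) (u c) * det2 (u a) (u d)))%:C =
    (w c - w a) * (w d - w b) / ((w c - w b) * (w d - w a))].
Proof.
move=> ud cF cF' FF' ui ux.
have u0 := direction_neq0 ui.
have sub G : convex_subset L G -> G `<=` L by move=> [_ ->] x [].
have fF : finite_set F by apply: bounded_uniformly_discrete ud (proj1 cF) (sub _ cF).
have fF' : finite_set F' by apply: bounded_uniformly_discrete ud (proj1 cF') (sub _ cF').
pose G : seq R[i] := fset_set F; pose G' : seq R[i] := fset_set F'.
have uG : uniq G by exact: fset_uniq.
have uG' : uniq G' by exact: fset_uniq.
have inG x : x \in G <-> F x.
  by rewrite (in_fset_set fF); split=> [/set_mem|/mem_set].
have inG' x : x \in G' <-> F' x.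
  by rewrite (in_fset_set fF'); split=> [/set_mem|/mem_set].
pose A := [seq x <- G | x \notin G']; pose A' := [seq x <- G' | x \notin G].
have lev a l : count [pred x | det2 (u a) x == l] A = count [pred x | det2 (u a) x == l] A'.
  by apply: count_eq_filter_notin => //; exact: (xray_level fF fF' (u0 a) (ux a)).
have szA : size A' = size A.
  have /perm_size : perm_eq (map (det2 (u ord0)) A') (map (det2 (u ord0)) A).
    by apply/allP => l _ /=; rewrite !count_map; apply/eqP; rewrite -lev.
  by rewrite !size_map.
set n := size A in szA.
pose t : n.-tuple R[i] := in_tuple A; pose t' : n.-tuple R[i] := tcast szA (in_tuple A').
have tA' : t' = A' :> seq _ by rewrite /t' val_tcast.
have q_ex a : exists q : {perm 'I_n}, forall i, det2 (u a) (tnth t i) = det2 (u a) (tnth t' (q i)).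
  by apply: tuple_level_perm => l; rewrite tA'; exact: lev.
have [q hq] := choice q_ex.
have n0 : (0 < n)%N.
  rewrite lt0n; apply: contra_notN FF' => /eqP sz0.
  have sub' (r r' : seq R[i]) : size [seq x <- r | x \notin r'] = 0%N -> {subset r <= r'}.
    move=> /size0nil e x xr; apply: contraT => xr'.
    by have := in_nil x; rewrite -e mem_filter xr xr'.
  have s1 := sub' G G' sz0; have s2 := sub' G' G (etrans szA sz0).
  by apply/seteqP; split=> x; [move=> /inG/s1/inG'|move=> /inG'/s2/inG].
pose o := ((n%:R^-1 : R)%:C * \sum_(i < n) tnth t i).
(* Matching preserves the sum of the levels in every direction, and the levels in two independent
   directions determine a vector. *)
have sumt : \sum_(i < n) tnth t i = \sum_(i < n) tnth t' i.
  have h a : det2 (u a) (\sum_(i < n) tnth t i - \sum_(i < n) tnth t' i) = 0.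
    rewrite -(mul1r (\sum_i tnth t i)) -[X in _ - X]mul1r -mulNr.
    have := det2_lin (u a) (\sum_(i < n) tnth t i) (\sum_(i < n) tnth t' i) 1 (-1).
    rewrite rmorphN rmorph1 => ->; rewrite !det2_sum mul1r mulN1r.
    rewrite [X in _ - X](reindex_inj (@perm_inj _ (q a))).
    by rewrite (eq_bigr _ (fun i _ => hq a i)) subrr.
  have d01 : det2 (u ord0) (u (inord 1)) != 0 by apply: ui; rewrite -val_eqE /= inordK.
  by apply/eqP; rewrite -subr_eq0; apply/eqP; exact: (det2_eq0_pair d01).
have sum_tup (r : n.-tuple R[i]) : \sum_(i < n) tnth r i = \sum_(x <- r) x.
  by rewrite big_tuple.
have oF : convex_hull F o.
  rewrite /o sum_tup -[in n%:R](size_tuple t).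
  apply: mean_in_cconvex; first exact: convex_hull_cconvex.
    by rewrite -size_eq0 size_tuple -lt0n.
  by move=> x; rewrite mem_filter => /andP[_ /inG]; exact: sub_convex_hull.
have oF' : convex_hull F' o.
  rewrite /o sumt sum_tup -[in n%:R](size_tuple t').
  apply: mean_in_cconvex; first exact: convex_hull_cconvex.
    by rewrite -size_eq0 size_tuple -lt0n.
  by move=> x; rewrite tA' mem_filter => /andP[_ /inG']; exact: sub_convex_hull.
(* The tag [true] marks the points of [F] outside [F'], [false] those of [F'] outside [F]; the
   common centroid [o] is moved to the origin. *)
pose I : finType := (bool * 'I_n)%type.
pose pt (z : I) := tnth (if z.1 then t else t') z.2 - o.
pose P (b : bool) : set R[i] := [set x | convex_hull (if b then F else F') (x + o)].
pose p a (z : I) : I := if z.1 then (false, q a z.2) else (true, (q a)^-1%g z.2).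
have [||||||||k [C [m [turn mir]]]] := @exists_block_polygon R I pt fst P u p (true, Ordinal n0).
- move=> b x y c hx hy c01; have := convex_hull_cconvex hx hy c01.
  rewrite /P /=; congr (convex_hull _ _).
  by rewrite !mulrDr addrACA -mulrDl -rmorphD /= addrCA subrr addr0 mul1r.
- by move=> [] ; rewrite /P /= add0r.
- move=> [[] i]; rewrite /P /pt /= subrK; apply: sub_convex_hull.
    by apply/inG; have := mem_tnth i t; rewrite mem_filter => /andP[].
  have : tnth t' i \in A' by rewrite -tA' mem_tnth.
  by rewrite mem_filter => /andP[_ /inG'].
- move=> [[] i]; rewrite /P /pt /= subrK => h.
    have := mem_tnth i t; rewrite mem_filter => /andP[/negP xG' /inG Fx].
    by apply: xG'; apply/inG'; rewrite (proj2 cF'); split => //; exact: (sub _ cF).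
  have : tnth t' i \in A' by rewrite -tA' mem_tnth.
  rewrite mem_filter => /andP[/negP xG /inG' Fx].
  by apply: xG; apply/inG; rewrite (proj2 cF); split => //; exact: (sub _ cF').
- exact: ui.
- by move=> a [[] i]; rewrite /p /= ?permK ?permKV.
- by move=> a [[] i].
- move=> a [[] i]; rewrite /pt /p /= !det2Br; first by rewrite hq.
  by rewrite hq permKV.
have [w [w1 wi wr]] := block_polygon_cross_ratio turn mir ui.
by exists k.+2, w.
Qed.

Lemma det2_parallel (u v : R[i]) : direction u -> direction v -> det2 u v = 0 -> parallel u v.
Proof.
move=> du dv duv.
have nz (x : R[i]) : direction x -> x != 0.
  by move=> dx; rewrite -normr_eq0 dx oner_eq0.
have e : u = (dot2 v u / dot2 v v)%:C * v.
  have N0 := lt0r_neq0 (dot2_gt0 (nz _ dv)); set c := _ / _.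
  have e' : c%:C * v = c%:C * v + 0%:C * v by rewrite mul0r addr0.
  apply: (dot_det_inj (nz _ dv)).
    by rewrite e' dot2_lin /c; field.
  by rewrite e' det2_lin det2N duv (_ : det2 v v = 0); [ring|rewrite /det2; ring].
exists (dot2 v u / dot2 v v) => //; apply: contra_neq (nz _ du) => c0.
by rewrite e c0 mul0r.
Qed.

(** A difference of slopes is [det2] divided by the product of the real parts, which cancel. At most
    one direction is vertical, because two vertical ones would have determinant 0. *)
Lemma cross_ratio_slopes (u1 u2 u3 u4 : R[i]) : det2 u1 u2 != 0 -> det2 u1 u3 != 0 ->
  det2 u1 u4 != 0 -> det2 u2 u3 != 0 -> det2 u2 u4 != 0 -> det2 u3 u4 != 0 ->
  cross_ratio (slope u1) (slope u2) (slope u3) (slope u4) =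
  det2 u1 u3 * det2 u2 u4 / (det2 u2 u3 * det2 u1 u4).
Proof.
move: u1 u2 u3 u4 => [a1 b1] [a2 b2] [a3 b3] [a4 b4].
have E a b c d : a != 0 -> c != 0 -> d / c - b / a = det2 (a +i* b) (c +i* d) / (a * c).
  by move=> a0 c0; rewrite /det2 /=; field; rewrite a0 c0.
have V b c d : det2 (0 +i* b) (c +i* d) = - (b * c) by rewrite /det2 /=; ring.
have W a b d : det2 (a +i* b) (0 +i* d) = a * d by rewrite /det2 /=; ring.
rewrite /slope /=.
case: (eqVneq a1 0) => [->|h1].
  rewrite !V !oppr_eq0 !mulf_eq0 !negb_or => /andP[k1 k2] /andP[_ k3] /andP[_ k4] d23 d24 d34.
  rewrite /cross_ratio (negbTE k2) (negbTE k3) (negbTE k4) !E //.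
  by move: (det2 _ _) (det2 _ _) d23 d24 => x y x0 y0; field; do ?[apply/andP; split].
case: (eqVneq a2 0) => [->|h2].
  rewrite !V !W !oppr_eq0 !mulf_eq0 !negb_or => /andP[_ k1] d13 d14 /andP[_ k3] /andP[_ k4] d34.
  rewrite /cross_ratio (negbTE k3) (negbTE k4) !E //.
  by move: (det2 _ _) (det2 _ _) d13 d14 => x y x0 y0; field; do ?[apply/andP; split].
case: (eqVneq a3 0) => [->|h3].
  rewrite !V !W !oppr_eq0 !mulf_eq0 !negb_or => d12 /andP[_ k1] d14 _ d24 /andP[_ k4].
  rewrite /cross_ratio (negbTE k4) !E //.
  by move: (det2 _ _) (det2 _ _) d14 d24 => x y x0 y0; field; do ?[apply/andP; split].
case: (eqVneq a4 0) => [->|h4].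
  rewrite !W !mulf_eq0 !negb_or => d12 d13 /andP[_ k1] d23 _ _.
  rewrite /cross_ratio !E //.
  by move: (det2 _ _) (det2 _ _) d13 d23 => x y x0 y0; field; do ?[apply/andP; split].
rewrite /cross_ratio !E // => _.
move: (det2 _ (a3 +i* b3)) (det2 _ (a4 +i* b4)) (det2 (a2 +i* b2) _) (det2 _ (a4 +i* b4)).
by move=> x y z t x0 y0 z0 t0 _; field; do ?[apply/andP; split].
Qed.

Lemma angles_cross_ratio_norm : delone L -> exists N : set rat, finite_set N /\
  forall U : set R[i], (forall u, U u -> set_direction L u) -> pairwise_nonparallel U ->
  forall u1 u2 u3 u4 : R[i], U = [set u1; u2; u3; u4] ->
  angle u1 < angle u2 -> angle u2 < angle u3 -> angle u3 < angle u4 ->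
  ~ N (field_norm (real_field_of L)
         (cross_ratio (slope u1) (slope u2) (slope u3) (slope u4))) ->
  determined_by_xrays (convex_subset L) U.
Proof.
move=> [ud _]; have [N [fN hN]] := field_norm_cyclotomic_ratio (real_field_of L).
exists N; split=> // U UL Upar u1 u2 u3 u4 eU a12 a23 a34 nN F F' cF cF' hx.
apply: contrapT => FF'; apply: nN.
pose u (a : 'I_4) := tnth [tuple u1; u2; u3; u4] a.
have Uu a : U (u a).
  rewrite eU /u; case: a => -[|[|[|[|//]]]] h; rewrite (tnth_nth 0) /=.
  - by do 3!left.
  - by do 2!left; right.
  - by left; right.
  - by right.
have angu (a b : 'I_4) : (a < b)%N -> angle (u a) < angle (u b).
  case: a b => -[|[|[|[|//]]]] ha [[|[|[|[|//]]]] hb] //= _; rewrite /u !(tnth_nth 0) /= //.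
  - exact: lt_trans a23.
  - by apply: lt_trans a34; apply: lt_trans a23.
  - exact: lt_trans a34.
have ui a b : a != b -> det2 (u a) (u b) != 0.
  move=> ab; apply/eqP => d0.
  have [da _] := UL _ (Uu a); have [db _] := UL _ (Uu b).
  apply: (Upar _ _ (Uu a) (Uu b)); last exact: det2_parallel.
  move=> e; move: ab; rewrite neq_ltn => /orP[] /angu; rewrite e ltxx //.
have [m [w [m0 w1 wi wr]]] := undetermined_cross_ratio ud cF cF' FF' ui (fun a => hx _ (Uu a)).
pose o k : 'I_4 := inord k.
have oE k : (k < 4)%N -> o k = k :> nat by move=> k4; rewrite inordK.
have ne j k : (j < 4)%N -> (k < 4)%N -> j != k -> o j != o k.
  by move=> hj hk jk; rewrite -val_eqE /= !oE.
have uo k : (k < 4)%N -> u (o k) = nth 0 [:: u1; u2; u3; u4] k.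
  by move=> hk; rewrite /u (tnth_nth 0) /= oE.
have eu1 := uo 0 isT; have eu2 := uo 1 isT; have eu3 := uo 2 isT; have eu4 := uo 3 isT.
rewrite /= in eu1 eu2 eu3 eu4.
have wz a : w a != 0.
  by apply: contra_eq_neq (w1 a) => ->; rewrite expr0n gtn_eqF // eq_sym oner_neq0.
have quo a b : (w a / w b) ^+ m = 1 by rewrite expr_div_n !w1 divr1.
have quo1 j k : (j < 4)%N -> (k < 4)%N -> j != k -> w (o j) / w (o k) != 1.
  move=> hj hk jk; apply: contra_neq (ne _ _ hj hk jk) => e; apply: wi.
  by rewrite -[LHS](divfK (wz (o k))) e mul1r.
(* A difference [w b - w a] is [w b] times [1 - w a / w b]; the outer factors cancel in the cross
   ratio, which leaves [rho = 1]. *)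
apply: (hN _ m 1 (w (o 0) / w (o 2)) (w (o 1) / w (o 3)) (w (o 1) / w (o 2)) (w (o 0) / w (o 3))) => //.
- by rewrite expr1n !quo.
- by split; apply: quo1.
rewrite -eu1 -eu2 -eu3 -eu4 cross_ratio_slopes; try by apply: ui; apply: ne.
rewrite wr; try by apply: ne.
have n23 : w (o 2) - w (o 1) != 0 by rewrite subr_eq0 (inj_eq wi) ne.
have n14 : w (o 3) - w (o 0) != 0 by rewrite subr_eq0 (inj_eq wi) ne.
rewrite mul1r; have := wz (o 2); have := wz (o 3) => z3 z2.
have e a b : w b != 0 -> 1 - w a / w b = (w b - w a) / w b.
  by move=> b0; rewrite mulrBl divff.
rewrite !e //; move: n23 n14; move: (w (o 2) - w (o 1)) (w (o 3) - w (o 0)).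
by move=> x y x0 y0; field; do ?[apply/andP; split].
Qed.
End Undetermined.

(** * Three directions do not suffice *)

Section Ambiguity.
Variables (R : realType) (L : set R[i]).
Implicit Types (a b u v z : R[i]) (F P : set R[i]).

(** The map [sw] moves each [o k] along its line to [e k] and fixes [D], so it is a bijection
    between the points of the two sets on every line. *)
Lemma xray_exchange (D : set R[i]) (o e : 'I_3 -> R[i]) u : u != 0 ->
  finite_set (D `|` range o) -> injective o -> injective e ->
  (forall k, ~ D (o k)) -> (forall k, ~ D (e k)) ->
  (forall k, det2 u (o k) = det2 u (e k)) ->
  xray (D `|` range o) (u := u) = xray (D `|` range e) (u := u).
Proof.
move=> u0 fin oi ei Do De oe; apply: funext => -[l [p hl]]; rewrite /xray /= {}hl.
pose sw z := if [pick k | z == o k] is Some k then e k else z.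
have swo k : sw (o k) = e k.
  rewrite /sw; case: pickP => [j /eqP/oi -> //|/(_ k)]; by rewrite eqxx.
have swD z : D z -> sw z = z.
  by move=> Dz; rewrite /sw; case: pickP => // k /eqP zo; case: (Do k); rewrite -zo.
have lineE k : line p u (o k) <-> line p u (e k).
  by rewrite !mem_line // oe.
have img : sw @` ((D `|` range o) `&` line p u) = (D `|` range e) `&` line p u.
  apply/seteqP; split=> [_ [z [[Dz|[k _ <-]] lz] <-]|z [[Dz|[k _ <-]] lz]].
  - by rewrite swD //; split=> //; left.
  - by rewrite swo; split; [right; exists k|apply/lineE].
  - by exists z; [split=> //; left|exact: swD].
  - by exists (o k); [split; [right; exists k|apply/lineE]|exact: swo].
have inj : {in (D `|` range o) `&` line p u &, injective sw}.
  move=> x y /set_mem [hx _] /set_mem [hy _].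
  case: hx hy => [Dx|[k _ <-]] [Dy|[j _ <-]]; rewrite ?swo ?swD //.
  - by move=> xe; case: (De j); rewrite -xe.
  - by move=> xe; case: (De k); rewrite xe.
  - by move=> /ei ->.
have := inj_card_eq inj; rewrite img => ce.
have [n fn] : finite_set ((D `|` range o) `&` line p u) by exact: finite_setIl.
by rewrite (card_fset_set fn); apply/esym/card_fset_set; rewrite (card_eql ce).
Qed.

Lemma convex_subset_of_cconvex P : cconvex P -> bounded_set (P : set R[i]^o) ->
  convex_subset L (P `&` L).
Proof.
move=> cP bP; split.
  move: bP => [N [Nr hN]]; exists N; split=> // M NM x [Px _]; exact: (hN M NM x Px).
apply/seteqP; split=> [z PLz|z [hz Lz]].
  by split; [exact: sub_convex_hull|case: PLz].
by split=> //; apply: (convex_hull_sub cP _ hz) => x [].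
Qed.

(* In the coordinates [z = t + x A + y B] the hexagon with vertices [+-A], [+-B],
   [+-(A - B)] is given by [|x|, |y|, |x + y| <= 1]; the strict inequalities remove
   the three vertices [sg A], [sg (B - A)] and [- sg B]. *)
Definition hexagon_part A B (t : R[i]) (sg : R) : set R[i] := [set z |
  let x := det2 (z - t) B / det2 A B in let y := det2 A (z - t) / det2 A B in
  [/\ `|x| <= 1, `|y| <= 1 & `|x + y| <= 1] /\
  [/\ sg * (2 * x + y) < 2, sg * (y - x) < 2 & sg * (- x - 2 * y) < 2]].

Lemma coords_affine A B (t z1 z2 : R[i]) (c : R) :
  det2 (c%:C * z1 + (1 - c)%:C * z2 - t) B = c * det2 (z1 - t) B + (1 - c) * det2 (z2 - t) B /\
  det2 A (c%:C * z1 + (1 - c)%:C * z2 - t) = c * det2 A (z1 - t) + (1 - c) * det2 A (z2 - t).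
Proof.
by move: A B t z1 z2 => [? ?] [? ?] [? ?] [? ?] [? ?]; rewrite /det2 /=; split; ring.
Qed.

Lemma norm_comb (c x y : R) : 0 <= c <= 1 -> `|x| <= 1 -> `|y| <= 1 ->
  `|c * x + (1 - c) * y| <= 1.
Proof.
move=> /andP[c0 c1]; rewrite !ler_norml => /andP[? ?] /andP[? ?].
by apply/andP; split; nra.
Qed.

Lemma lt_comb (c x y m : R) : 0 <= c <= 1 -> x < m -> y < m -> c * x + (1 - c) * y < m.
Proof.
move=> /andP[c0 c1] xm ym; have [->|cn] := eqVneq c 0; first by lra.
have : 0 < c by rewrite lt_neqAle eq_sym cn.
nra.
Qed.

Lemma hexagon_part_convex A B t sg : cconvex (hexagon_part A B t sg).
Proof.
move=> z1 z2 c; rewrite /hexagon_part /=.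
have [-> ->] := coords_affine A B t z1 z2 c.
have E (x y : R) : (c * x + (1 - c) * y) / det2 A B =
  c * (x / det2 A B) + (1 - c) * (y / det2 A B) by rewrite mulrDl !mulrA.
rewrite !E; move: (det2 (z1 - t) B / _) (det2 A (z1 - t) / _) => x1 y1.
move: (det2 (z2 - t) B / _) (det2 A (z2 - t) / _) => x2 y2.
move=> [[h1 h2 h3] [h4 h5 h6]] [[k1 k2 k3] [k4 k5 k6]] c01.
split; split.
- exact: norm_comb.
- exact: norm_comb.
- by have := norm_comb c01 h3 k3; congr (`|_| <= _); ring.
- by have := lt_comb c01 h4 k4; congr (_ < _); ring.
- by have := lt_comb c01 h5 k5; congr (_ < _); ring.
- by have := lt_comb c01 h6 k6; congr (_ < _); ring.
Qed.

Lemma coords_expand A B v : det2 A B != 0 ->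
  v = (det2 v B / det2 A B)%:C * A + (det2 A v / det2 A B)%:C * B.
Proof.
move: A B v => [a b] [c d] [e f]; rewrite /det2 /= => h.
by apply/eqP; rewrite eq_complex /=; apply/andP; split; apply/eqP; field.
Qed.

Lemma hexagon_part_bounded A B t sg : det2 A B != 0 ->
  bounded_set (hexagon_part A B t sg : set R[i]^o).
Proof.
move=> AB; exists (`|A| + `|B| + `|t|); split.
  by rewrite !rpredD // ger0_real.
move=> M hM z [[hx hy _] _] /=.
apply: le_trans (ltW hM).
have -> : z = (z - t) + t by rewrite subrK.
rewrite {1}(coords_expand (z - t) AB).
apply: le_trans (ler_normD _ _) _; rewrite lerD2r.
apply: le_trans (ler_normD _ _) _; rewrite !normrM.
have nc (x : R) : `|x| <= 1 -> `|x%:C| <= 1 :> R[i].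
  by move=> h; rewrite normc_def /= expr0n addr0 sqrtr_sqr lecR.
apply: lerD; rewrite -[X in _ <= X]mul1r; apply: ler_wpM2r => //; exact: nc.
Qed.

(** The signs [1] and [-1] give the two classes of alternate vertices; [hexagon_part A B t sg] lacks
    the class of [sg]. *)
Definition hexagon_vertex A B (t : R[i]) (sg : R) (k : 'I_3) : R[i] :=
  t + sg%:C * nth 0 [:: A; B - A; - B] k.

Lemma coords_inj A B z1 z2 : det2 A B != 0 -> det2 z1 B = det2 z2 B ->
  det2 A z1 = det2 A z2 -> z1 = z2.
Proof. by move=> AB e1 e2; rewrite (coords_expand z1 AB) (coords_expand z2 AB) e1 e2. Qed.

Lemma ord3P (Q : 'I_3 -> Prop) : Q (inord 0) -> Q (inord 1) -> Q (inord 2) -> forall k, Q k.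
Proof.
move=> q0 q1 q2 [[|[|[|//]]] hk].
- by rewrite (_ : Ordinal hk = inord 0) //; apply: val_inj; rewrite /= inordK.
- by rewrite (_ : Ordinal hk = inord 1) //; apply: val_inj; rewrite /= inordK.
- by rewrite (_ : Ordinal hk = inord 2) //; apply: val_inj; rewrite /= inordK.
Qed.

Lemma ord3_exists (Q : 'I_3 -> Prop) : (exists k, Q k) <-> [\/ Q (inord 0), Q (inord 1) | Q (inord 2)].
Proof.
split=> [[k Qk]|]; last by move=> []; eexists; eassumption.
move: k Qk; apply: ord3P => Qk; [exact: Or31|exact: Or32|exact: Or33].
Qed.

Definition vertex_coord (k : 'I_3) : R * R := nth 0 [:: (1, 0); (-1, 1); (0, -1)] k.

Lemma hexagon_vertex_coords A B t sg k : det2 A B != 0 ->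
  det2 (hexagon_vertex A B t sg k - t) B / det2 A B = sg * (vertex_coord k).1 /\
  det2 A (hexagon_vertex A B t sg k - t) / det2 A B = sg * (vertex_coord k).2.
Proof.
move=> AB; rewrite /hexagon_vertex addrC addKr /vertex_coord.
move: k; apply: ord3P; rewrite !inordK //= /det2; move: AB; rewrite /det2.
all: by case: A B => [a1 a2] [b1 b2] /= AB; split; field.
Qed.

Lemma eq_hexagon_vertex A B t sg k z : det2 A B != 0 ->
  det2 (z - t) B / det2 A B = sg * (vertex_coord k).1 ->
  det2 A (z - t) / det2 A B = sg * (vertex_coord k).2 -> z = hexagon_vertex A B t sg k.
Proof.
move=> AB; have [<- <-] := hexagon_vertex_coords t sg k AB.
move=> /(divIf AB) h1 /(divIf AB) h2.
by apply: (addIr (- t)); exact: coords_inj AB h1 h2.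
Qed.

(** The hexagon may contain further points of [L]; they do no harm, since the two parts differ in
    the vertices only. *)
Lemma hexagon_partE A B t sg : det2 A B != 0 -> sg = 1 \/ sg = -1 ->
  hexagon_part A B t sg =
    (hexagon_part A B t 1 `&` hexagon_part A B t (-1)) `|` range (hexagon_vertex A B t (- sg)).
Proof.
move=> AB hsg; apply/seteqP; split=> z.
- move=> hz; have [hz'|hz'] := pselect (hexagon_part A B t (- sg) z).
    by left; case: hsg => e; move: hz hz'; rewrite e ?opprK; split.
  right; move: hz hz'; rewrite /hexagon_part /=.
  have V k := @eq_hexagon_vertex A B t (- sg) k z AB; move: V.
  rewrite /vertex_coord; move: (det2 (z - t) B / _) (det2 A (z - t) / _) => x y V.
  move=> [[h1 h2 h3] [h4 h5 h6]] hz'.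
  rewrite !ler_norml in h1 h2 h3.
  suff [k [k1 k2]] : exists k, x = - sg * (vertex_coord k).1 /\ y = - sg * (vertex_coord k).2.
    by exists k => //; rewrite (V k k1 k2).
  apply/ord3_exists; rewrite /vertex_coord !inordK //=.
  (* On the hexagon, [2 * x + y = x + (x + y)] is at most [2], with equality only at the vertex
     [(1, 0)]; the other two forms single out [(-1, 1)] and [(0, -1)] likewise. *)
  have [l1|l1] := ltP (- sg * (2 * x + y)) 2; last by apply: Or31; case: hsg => e; rewrite e in l1 *; lra.
  have [l2|l2] := ltP (- sg * (y - x)) 2; last by apply: Or32; case: hsg => e; rewrite e in l2 *; lra.
  have [l3|l3] := ltP (- sg * (- x - 2 * y)) 2; last by apply: Or33; case: hsg => e; rewrite e in l3 *; lra.
  by case: hz'; rewrite !ler_norml.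
- move=> [[h1 h2]|[k _ <-]]; first by case: hsg => ->.
  rewrite /hexagon_part /=; have [-> ->] := hexagon_vertex_coords t (- sg) k AB.
  move: k; apply: ord3P; rewrite /vertex_coord !inordK //= !ler_norml.
  all: by case: hsg => ->; do !split; lra.
Qed.

Lemma hexagon_vertex_notin A B t sg k : det2 A B != 0 -> sg = 1 \/ sg = -1 ->
  ~ hexagon_part A B t sg (hexagon_vertex A B t sg k).
Proof.
move=> AB hsg; rewrite /hexagon_part /=; have [-> ->] := hexagon_vertex_coords t sg k AB.
move: k; apply: ord3P; rewrite /vertex_coord !inordK //= => -[_].
all: by case: hsg => -> []; lra.
Qed.

Lemma hexagon_vertex_inj A B t sg : det2 A B != 0 -> sg = 1 \/ sg = -1 ->
  injective (hexagon_vertex A B t sg).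
Proof.
move=> AB hsg j k e.
have [j1 j2] := hexagon_vertex_coords t sg j AB; have [k1 k2] := hexagon_vertex_coords t sg k AB.
move: j1 j2; rewrite e k1 k2; have sg0 : sg != 0 by case: hsg => ->; rewrite ?oppr_eq0 oner_eq0.
move=> /(mulfI sg0) e1 /(mulfI sg0) e2; move: e1 e2 {e k1 k2}.
move: j; apply: ord3P; move: k; apply: ord3P; rewrite /vertex_coord !inordK //= => e1 e2.
all: by exfalso; lra.
Qed.

Lemma hexagon_not_determined A B (t : R[i]) : uniformly_discrete L -> det2 A B != 0 ->
  (forall sg k, sg = 1 \/ sg = -1 -> L (hexagon_vertex A B t sg k)) ->
  exists F F', [/\ convex_subset L F, convex_subset L F', F <> F'
    & forall u, u != 0 -> [\/ det2 u A = 0, det2 u B = 0 | det2 u (A - B) = 0] ->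
      xray F (u := u) = xray F' (u := u)].
Proof.
move=> ud AB Lv.
have s1 : (1 : R) = 1 \/ (1 : R) = -1 by left.
have sN : (-1 : R) = 1 \/ (-1 : R) = -1 by right.
pose H sg := hexagon_part A B t sg `&` L.
have cH sg : convex_subset L (H sg).
  by apply: convex_subset_of_cconvex; [exact: hexagon_part_convex|exact: hexagon_part_bounded].
pose D := H 1 `&` H (-1).
have HE sg : sg = 1 \/ sg = -1 -> H sg = D `|` range (hexagon_vertex A B t (- sg)).
  move=> hsg; rewrite /H {1}(hexagon_partE t AB hsg) setIUl; congr (_ `|` _).
    by rewrite /D /H setIACA setIid.
  apply/setIidl => _ [k _ <-]; apply: Lv.
  by case: hsg => ->; rewrite ?opprK; auto.
have E1 := HE 1 s1; have EN := HE (-1) sN; rewrite opprK in EN.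
have finH sg : finite_set (H sg).
  by apply: (bounded_uniformly_discrete ud (proj1 (cH sg))) => z [].
have notD sg k : sg = 1 \/ sg = -1 -> ~ D (hexagon_vertex A B t sg k).
  move=> hsg; have := hexagon_vertex_notin (t := t) (k := k) AB hsg; rewrite /D /H.
  by case: hsg => -> h [[h1 _] [h2 _]].
exists (H 1), (H (-1)); split=> //.
- move=> e; have : H 1 (hexagon_vertex A B t (-1) ord0) by rewrite E1; right; exists ord0.
  by rewrite e => -[h _]; exact: (hexagon_vertex_notin AB sN h).
- move=> u u0 hu.
  have [q [qi hq]] : exists q : 'I_3 -> 'I_3, injective q /\
      forall k, det2 u (hexagon_vertex A B t (-1) k) = det2 u (hexagon_vertex A B t 1 (q k)).
    (* Relative to [t], the vertices of class [sg] have the levels [sg * d k]. Each of the three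
       directions makes one entry of [d] zero and the other two opposite, so the transposition of
       these two matches the classes. *)
    pose d := nth 0 [:: det2 u A; det2 u B - det2 u A; - det2 u B].
    have vE sg (k : 'I_3) : det2 u (hexagon_vertex A B t sg k) = det2 u t + sg * d k.
      rewrite /hexagon_vertex /d; move: k; apply: ord3P; rewrite !inordK //=;
      by move: u A B t {AB Lv H cH D HE E1 EN finH notD hu u0 d} => [? ?] [? ?] [? ?] [? ?];
         rewrite /det2 /=; ring.
    have qq (q : 'I_3 -> 'I_3) : involutive q -> (forall k : 'I_3, - d k = d (q k)) ->
      exists q : 'I_3 -> 'I_3, injective q /\
      forall k, det2 u (hexagon_vertex A B t (-1) k) = det2 u (hexagon_vertex A B t 1 (q k)).
      move=> /inv_inj qi h; exists q; split=> // k; rewrite !vE mulN1r mul1r h //.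
    pose tr (i j k : nat) (x : 'I_3) : 'I_3 := inord (nth 0%N [:: i; j; k] x).
    case: hu => h.
    + apply: (qq (tr 0 2 1)%N); first by apply: ord3P; rewrite /tr !inordK.
      by apply: ord3P; rewrite /tr /d !inordK //= h; ring.
    + apply: (qq (tr 1 0 2)%N); first by apply: ord3P; rewrite /tr !inordK.
      by apply: ord3P; rewrite /tr /d !inordK //= h; ring.
    + have {}h : det2 u A = det2 u B.
        apply/eqP; rewrite -subr_eq0 -[X in _ == X]h; apply/eqP.
        by move: (u) (A) (B) => [? ?] [? ?] [? ?]; rewrite /det2 /=; ring.
      apply: (qq (tr 2 1 0)%N); first by apply: ord3P; rewrite /tr !inordK.
      by apply: ord3P; rewrite /tr /d !inordK //= h; ring.
  have rq : range (hexagon_vertex A B t 1 \o q) = range (hexagon_vertex A B t 1).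
    apply/seteqP; split=> [_ [k _ <-]|_ [k _ <-]]; first by exists (q k).
    by exists (invF qi k) => //=; rewrite f_invF.
  rewrite E1 EN -rq; apply: xray_exchange => //.
  - by rewrite -E1.
  - exact: hexagon_vertex_inj AB sN.
  - exact: inj_comp (hexagon_vertex_inj AB s1) qi.
  - by move=> k; apply: notD.
  - by move=> k; apply: notD.
Qed.
End Ambiguity.

(** * Directions and vectors over the field of the set *)

Section GeneratedField.
Variables (F : numFieldType) (S : set F).
Local Notation K := (generated_field S).

Lemma generated_fieldB x y : K x -> K y -> K (x - y).
Proof.
move=> Kx Ky A hA; have [[_ cB _] _] := hA.
by apply/set_mem/cB; apply/mem_set; [exact: Kx|exact: Ky].
Qed.

Lemma generated_field_div x y : K x -> K y -> K (x / y).
Proof.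
move=> Kx Ky A hA; have [[_ _ cD] _] := hA.
by apply/set_mem/cD; apply/mem_set; [exact: Kx|exact: Ky].
Qed.

Lemma generated_field1 : K 1.
Proof. by move=> A [[c1 _ _] _]; apply: set_mem. Qed.

Lemma generated_fieldN x : K x -> K (- x).
Proof.
move=> Kx; rewrite -sub0r; apply: generated_fieldB => //.
by rewrite -(subrr 1); apply: generated_fieldB; exact: generated_field1.
Qed.

Lemma generated_fieldM x y : K x -> K y -> K (x * y).
Proof.
move=> Kx Ky; rewrite -[y]invrK; apply: generated_field_div => //.
by rewrite -[y^-1]mul1r; apply: generated_field_div => //; exact: generated_field1.
Qed.
End GeneratedField.

Section SmallSets.
Variables (R : realType) (L : set R[i]).
Hypothesis hL : algebraic_delone L.
Local Notation K := (field_of L).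

Lemma differences_field v : differences L v -> K v /\ K (v^*%C).
Proof. by move=> Lv; split; apply: sub_gen_smallest; [left|right; exists v]. Qed.

(** For differences of [L], the left side is in the field because the generators include the
    conjugates. The factor ['i] may lie outside, but it cancels in a quotient of two
    determinants. *)
Lemma conj_det2 (x y : R[i]) : x^*%C * y - x * y^*%C = (2 * det2 x y)%:C * 'i%C.
Proof.
move: x y => [a b] [c d]; rewrite /det2; apply/eqP.
by rewrite eq_complex /=; apply/andP; split; apply/eqP; ring.
Qed.

Lemma det2_ratio_field x y z w : differences L x -> differences L y ->
  differences L z -> differences L w -> K ((det2 x y / det2 z w)%:C).
Proof.
move=> /differences_field[x1 x2] /differences_field[y1 y2].
move=> /differences_field[z1 z2] /differences_field[w1 w2].
have i0 : ('i%C : R[i]) != 0 by rewrite eq_complex /= oner_eq0 andbF.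
have -> : (det2 x y / det2 z w)%:C =
    (x^*%C * y - x * y^*%C) / (z^*%C * w - z * w^*%C).
  rewrite !conj_det2 fmorph_div !rmorphM /= invfM mulrACA divff // mulr1 invfM mulrACA.
  by rewrite divff ?mul1r // fmorph_eq0 pnatr_eq0.
by apply: generated_field_div; apply: generated_fieldB; apply: generated_fieldM.
Qed.

(** A ball far away from [p] in the direction orthogonal to [v] contains a point of [L]. The
    constant [c] raises the level of its centre by [e * r + 1], while moving within the ball changes
    the level by at most [e * r]. *)
Lemma exists_transverse_difference (v : R[i]) : v != 0 ->
  exists2 d, differences L d & det2 v d != 0.
Proof.
move=> v0; have [[_ [r r0 dense]] _ _] := hL.
have N0 := dot2_gt0 v0.
have [p [_ Lp]] := dense 0.
pose e := `|complex.Re v| + `|complex.Im v|.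
pose c := (e * r + 1) / dot2 v v.
have [q [hq Lq]] := dense (p + c%:C * (- complex.Im v +i* complex.Re v)).
exists (q - p); first by exists q => //; exists p.
move: hq; rewrite /open_ball -ball_normE /=; set z := p + _ => hq.
have -> : det2 v (q - p) = e * r + 1 - det2 v (z - q).
  have aux (m : R) (x y w : R[i]) : det2 x (w - y) =
      m * dot2 x x - det2 x (y + m%:C * (- complex.Im x +i* complex.Re x) - w).
    by move: x y w => [? ?] [? ?] [? ?]; rewrite /det2 /dot2 /=; ring.
  by rewrite (aux c v p q) -/z {1}/c divfK // gt_eqF.
move: hq; rewrite normc_def ltcR => hq.
have key (a b : R) : `|a| <= Num.sqrt (a ^+ 2 + b ^+ 2).
  by rewrite -sqrtr_sqr ler_sqrt ?lerDl ?sqr_ge0 // addr_ge0 ?sqr_ge0.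
have h1 := le_lt_trans (key _ _) hq; rewrite addrC in hq; have h2 := le_lt_trans (key _ _) hq.
have : `|det2 v (z - q)| <= e * r.
  rewrite /det2 /e; apply: le_trans (ler_normB _ _) _; rewrite !normrM mulrDl.
  by apply: lerD; apply: ler_wpM2l => //; exact: ltW.
by move=> h; rewrite gt_eqF //; have := ler_norm (det2 v (z - q)); lra.
Qed.

Lemma set_direction_difference u : set_direction L u ->
  exists v (c : R), [/\ differences L v, v != 0, c != 0 & u = c%:C * v].
Proof. by move=> [_ [v [Lv v0 [c c0 e]]]]; exists v, c. Qed.

(* Rescaling two of three directions makes the third one parallel to their difference. *)
Lemma three_directions (U : set R[i]) : (U #<= `I_3)%card ->
  (forall u, U u -> set_direction L u) -> pairwise_nonparallel U ->
  exists a b, [/\ K a, K b, det2 a b != 0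
    & forall u, U u -> [\/ det2 u a = 0, det2 u b = 0 | det2 u (a - b) = 0]].
Proof.
move=> cU UL Upar.
have fU : finite_set U by apply/finite_set_leP; exists 3%N.
have := geq_card_fset_set cU.
have inU x : U x <-> x \in (fset_set U : seq R[i]).
  by rewrite (in_fset_set fU); split=> [/mem_set|/set_mem].
have : uniq (fset_set U : seq R[i]) by exact: fset_uniq.
have par u v : U u -> U v -> u != v -> det2 u v != 0.
  move=> Uu Uv uv; apply/eqP => d0; apply: (Upar _ _ Uu Uv (elimN eqP uv)).
  by apply: det2_parallel d0; [case: (UL _ Uu)|case: (UL _ Uv)].
move: inU; case: (fset_set U : seq R[i]) => [|u1 [|u2 [|u3 [|//]]]] inU uq _.
(* With fewer than two directions, transverse differences supply the missing vectors. *)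
- have [d Ld d0] := exists_transverse_difference (oner_neq0 R[i]).
  have dn0 : d != 0 by apply: contra_neq d0 => ->; rewrite /det2 /=; ring.
  have [e Le e0] := exists_transverse_difference dn0.
  exists d, e; split=> //; try by apply differences_field.
  by move=> u /inU.
- have [v1 [c1 [Lv1 v10 c10 e1]]] := set_direction_difference (UL u1 (iffRL (inU u1) (mem_head _ _))).
  have [e Le e0] := exists_transverse_difference v10.
  exists v1, e; split=> //; try by apply differences_field.
  by move=> u /inU; rewrite inE => /eqP ->; apply: Or31; rewrite e1 det2Zl det2xx mulr0.
- have U1 : U u1 by apply/inU; rewrite !inE eqxx.
  have U2 : U u2 by apply/inU; rewrite !inE eqxx orbT.
  have [v1 [c1 [Lv1 v10 c10 e1]]] := set_direction_difference (UL _ U1).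
  have [v2 [c2 [Lv2 v20 c20 e2]]] := set_direction_difference (UL _ U2).
  have := par _ _ U1 U2; move: uq; rewrite /= inE andbT => -> /(_ isT).
  rewrite e1 e2 det2Zl det2Zr !mulf_eq0 (negbTE c10) (negbTE c20) /= => d12.
  exists v1, v2; split=> //; try by apply differences_field.
  move=> u /inU; rewrite !inE => /orP[/eqP ->|/eqP ->].
    by apply: Or31; rewrite e1 det2Zl det2xx mulr0.
  by apply: Or32; rewrite e2 det2Zl det2xx mulr0.
have U1 : U u1 by apply/inU; rewrite !inE eqxx.
have U2 : U u2 by apply/inU; rewrite !inE eqxx orbT.
have U3 : U u3 by apply/inU; rewrite !inE eqxx !orbT.
have [v1 [c1 [Lv1 v10 c10 e1]]] := set_direction_difference (UL _ U1).
have [v2 [c2 [Lv2 v20 c20 e2]]] := set_direction_difference (UL _ U2).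
have [v3 [c3 [Lv3 v30 c30 e3]]] := set_direction_difference (UL _ U3).
move: uq; rewrite /= !inE negb_or andbT => /andP[/andP[n12 n13] n23].
have := par _ _ U1 U2 n12; have := par _ _ U1 U3 n13; have := par _ _ U2 U3 n23.
rewrite e1 e2 e3 !det2Zl !det2Zr !mulf_eq0 (negbTE c10) (negbTE c20) (negbTE c30) /=.
move=> d23 d13 d12; have d21 : det2 v2 v1 != 0 by rewrite det2N oppr_eq0.
(* Cramer's rule for [v3] in the basis [v1], [v2]; the sign of [b] makes [v3] the difference
   [a - b]. *)
pose a := (det2 v2 v3 / det2 v2 v1)%:C * v1; pose b := (- (det2 v1 v3 / det2 v1 v2))%:C * v2.
have e : a - b = v3.
  apply: (coords_inj d12).
    rewrite det2N [RHS]det2N; congr (- _).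
    by rewrite /a /b det2Br !det2Zr det2xx mulr0 subr0 divfK.
  by rewrite /a /b det2Br !det2Zr det2xx mulr0 sub0r mulNr opprK divfK.
exists a, b; split.
- by apply: generated_fieldM; [exact: det2_ratio_field|apply differences_field].
- rewrite /b rmorphN /=; apply: generated_fieldM; last by apply differences_field.
  by apply: generated_fieldN; exact: det2_ratio_field.
- by rewrite /a /b det2Zl det2Zr !mulf_neq0 // ?oppr_eq0 ?mulf_neq0 ?invr_eq0.
move=> u /inU; rewrite !inE => /or3P[] /eqP ->.
- by apply: Or31; rewrite e1 /a det2Zl det2Zr det2xx !mulr0.
- by apply: Or32; rewrite e2 /b det2Zl det2Zr det2xx !mulr0.
- by apply: Or33; rewrite e e3 det2Zl det2xx mulr0.
Qed.

Lemma three_directions_not_determined (U : set R[i]) : (U #<= `I_3)%card ->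
  (forall u, U u -> set_direction L u) -> pairwise_nonparallel U ->
  ~ determined_by_xrays (convex_subset L) U.
Proof.
move=> cU UL Upar; have [a [b [Ka Kb ab hab]]] := three_directions cU UL Upar.
have [[ud _] _ hom] := hL.
(* Homotheties preserve directions, so a hexagon around the origin with vertices in the field is
   enough. *)
pose V := range (hexagon_vertex a b 0 1) `|` range (hexagon_vertex a b 0 (-1)).
have fV : finite_set V by rewrite finite_setU; split; apply: finite_image; exact: finite_finset.
have KV : V `<=` K.
  have nK (k : 'I_3) : K (nth 0 [:: a; b - a; - b] k).
    by move: k; apply: ord3P; rewrite !inordK //=; [exact: generated_fieldB|exact: generated_fieldN].
  move=> _ [[k _ <-]|[k _ <-]]; rewrite /hexagon_vertex add0r.
    by rewrite rmorph1 mul1r; exact: nK.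
  by rewrite rmorphN rmorph1 mulN1r; apply: generated_fieldN; exact: nK.
have [l l0 [t ht]] := hom V fV KV.
have ln0 := lt0r_neq0 l0.
have [||F [F' [cF cF' FF' hF]]] := @hexagon_not_determined R L (l%:C * a) (l%:C * b) t ud.
- by rewrite det2Zl det2Zr !mulf_neq0.
- move=> sg k hsg; apply: ht; exists (hexagon_vertex a b 0 sg k).
    by case: hsg => ->; [left|right]; exists k.
  rewrite /homothety /hexagon_vertex add0r addrC mulrCA; congr (_ + _ * _).
  by move: k; apply: ord3P; rewrite !inordK //= ?mulrBr ?mulrN.
move=> /(_ F F' cF cF') det; apply: FF'; apply: det => u Uu; apply: hF.
  by have [du _] := UL _ Uu; rewrite -normr_eq0 du oner_eq0.
rewrite -mulrBr !det2Zr.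
by case: (hab u Uu) => ->; rewrite mulr0; [exact: Or31|exact: Or32|exact: Or33].
Qed.
End SmallSets.

Theorem theorem4p21 (R : realType) (L : set R[i]) (hL : algebraic_delone L) :
  (exists N : set rat, finite_set N /\
     forall U : set R[i],
       (U #= `I_4)%card ->
       (forall u, U u -> set_direction L u) ->
       pairwise_nonparallel U ->
       forall u1 u2 u3 u4 : R[i],
         U = [set u1; u2; u3; u4] ->
         angle u1 < angle u2 -> angle u2 < angle u3 -> angle u3 < angle u4 ->
         ~ N (field_norm (real_field_of L)
                (cross_ratio (slope u1) (slope u2) (slope u3) (slope u4))) ->
         determined_by_xrays (convex_subset L) U) /\
  (forall U : set R[i],
     (U #<= `I_3)%card ->
     (forall u, U u -> set_direction L u) ->
     pairwise_nonparallel U ->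
     ~ determined_by_xrays (convex_subset L) U).
Proof.
split; last exact: three_directions_not_determined hL.
have [dL _ _] := hL; have [N [fN hN]] := angles_cross_ratio_norm dL.
by exists N; split=> // U _; exact: hN.
Qed.
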